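(* In the setting of the context (CMZ structure with $\mu_Y(\varphi>n)=O(n^{-\beta'})$, $\beta'>1$), there is a constant $C>0$ such that for all $n\ge1$: (a) for all $\tilde v\in\mathcal F_\theta(\hat X)$ and $\tilde w\in L^\infty(\hat X)$, $$\Big|\rho^*_{\tilde v,\tilde w}(n)-\Big(1+\bar\Phi^{-1}\sum_{j>n}\mu_Y(\Phi>j)\Big)\int_\Delta\tilde v\,d\mu_\Delta\int_\Delta\tilde w\,d\mu_\Delta\Big|\le C\|\tilde v\|_\theta|\tilde w|_\infty(\gamma_{nd}+\zeta_{\beta'}(n));$$ (b) for all $\tilde v\in\mathcal F_\theta(\hat X)$ with $\int_\Delta\tilde v\,d\mu_\Delta=0$ and all $\tilde w\in L^\infty(\Delta)$, $$|\rho^*_{\tilde v,\tilde w}(n)|\le C\|\tilde v\|_\theta|\tilde w|_\infty\,\gamma_{nd}.$$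
   Context: CMZ structure: $f:M\to M$ ergodic mixing measure-preserving on a probability space $(M,\mu)$; measurable $Y\subset X\subset M$, $\mu(Y)>0$; $h:X\to\mathbb Z^+$ first return time to $X$, $f_X=f^h$; integrable $\sigma:Y\to\mathbb Z^+$, constant on elements of a countable partition $\alpha$ of $Y$, with $F=f_X^\sigma:Y\to Y$ a full-branch Gibbs–Markov map (w.r.t. probability $\mu_Y$, partition $\alpha$, separation time $s$: least $n\ge 0$ with $F^ny,F^ny'$ in different partition elements; $F|_a:a\to Y$ bijective and $\xi=d\mu_Y/d(\mu_Y\circ F)$ satisfies $|\log\xi(y)-\log\xi(y')|\le C_0\theta^{s(y,y')}$ on each $a$), $h$ constant on $f_X^\ell a$ for $0\le\ell<\sigma(a)$, $f_X$ modelled by the tower $Y^\sigma$, and $f$ modelled by the tower over $Y$ with height $\varphi(y)=\sum_{\ell=0}^{\sigma(y)-1}h(f_X^\ell y)$ (so $F=f^\varphi$), i.e. $(y,\ell)\mapsto f^\ell y$ pushes $(\mu_Y\times\text{counting})/\int\varphi\,d\mu_Y$ to $\mu$. Tower: let $d=\gcd\{\varphi(a):a\in\alpha\}$, $\Phi=\varphi/d$, $\bar\Phi=\int_Y\Phi\,d\mu_Y$. Let $\Delta=\{(y,\ell)\in Y\times\mathbb Z:0\le\ell\le\Phi(y)-1\}$ with $f_\Delta(y,\ell)=(y,\ell+1)$ if $\ell\le\Phi(y)-2$ and $f_\Delta(y,\ell)=(Fy,0)$ if $\ell=\Phi(y)-1$, and $\mu_\Delta=(\mu_Y\times\text{counting})/\bar\Phi$.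 Let $\pi_M(y,\ell)=f^{d\ell}y$, $X_d=X\cup f^{-1}X\cup\dots\cup f^{-(d-1)}X$ and $\hat X=\pi_M^{-1}(X_d)\subset\Delta$. For $\tilde v:\Delta\to\mathbb R$, $|\tilde v|_\theta=\sup_{y\ne y'\in Y}\sup_{0\le\ell\le\Phi(y)-1}|\tilde v(y,\ell)-\tilde v(y',\ell)|/\theta^{s(y,y')}$ and $\|\tilde v\|_\theta=|\tilde v|_\infty+|\tilde v|_\theta$; $\mathcal F_\theta(\hat X)$ is the space of $\tilde v$ supported in $\hat X$ with $\|\tilde v\|_\theta<\infty$; $L^\infty(\hat X)$ the bounded functions on $\Delta$ vanishing off $\hat X$. $\rho^*_{\tilde v,\tilde w}(n)=\int_\Delta\tilde v\,\tilde w\circ f_\Delta^n\,d\mu_\Delta$. Sequences: $\sigma_n=\int_Y\sigma1_{\{\varphi>n\}}d\mu_Y$; $\gamma_n=\sigma_n+\sum_{j=1}^nj^{-\beta'}\sigma_{n-j}$; $\zeta_{\beta'}(n)=n^{-\beta'}$ if $\beta'>2$, $n^{-2}\log n$ if $\beta'=2$, $n^{-2(\beta'-1)}$ if $1<\beta'<2$. *)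

(* Defs.v *)
From HB Require Import structures.
From mathcomp Require Import all_boot all_order all_algebra.
From mathcomp Require Import all_classical all_reals all_analysis.
Set Implicit Arguments. Unset Strict Implicit. Unset Printing Implicit Defensive.
Import Order.TTheory GRing.Theory Num.Theory.
Import numFieldNormedType.Exports.
Local Open Scope classical_set_scope.
Local Open Scope ring_scope.

Section Defs.
Context {R : realType} {d0 : measure_display} {M : measurableType d0}.

Definition measure_preserving (mu : {measure set M -> \bar R}) (f : M -> M) :=
  measurable_fun setT f /\
  forall A, measurable A -> mu (f @^-1` A) = mu A.

Definition ergodic (mu : {measure set M -> \bar R}) (f : M -> M) :=
  forall A, measurable A -> f @^-1` A = A -> mu A = 0%E \/ mu A = 1%E.

Definition mixing (mu : {measure set M -> \bar R}) (f : M -> M) :=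
  forall A B, measurable A -> measurable B ->
    (fun n => fine (mu (A `&` (iter n f) @^-1` B))) @ \oo -->
      fine (mu A) * fine (mu B).

Definition first_return (f : M -> M) (X : set M) (h : M -> nat) :=
  forall x, X x ->
    [/\ (0 < h x)%N, X (iter (h x) f x) &
        forall k, (0 < k)%N -> (k < h x)%N -> ~ X (iter k f x)].

Definition induced (f : M -> M) (h : M -> nat) : M -> M :=
  fun x => iter (h x) f x.

Definition FY (f : M -> M) (h sigma : M -> nat) : M -> M :=
  fun y => iter (sigma y) (induced f h) y.

(** phi(y) = sum_{l < sigma y} h(f_X^l y), so that F = f^phi *)
Definition phiY (f : M -> M) (h sigma : M -> nat) (y : M) : nat :=
  (\sum_(l < sigma y) h (iter l (induced f h) y))%N.

(** The countable partition alpha of Y is given by a labelling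
    part : M -> nat; its elements are the nonempty sets atom k. *)
Definition atom (Y : set M) (part : M -> nat) (k : nat) : set M :=
  Y `&` part @^-1` [set k].

(** separation time: least n >= 0 with F^n y, F^n y' in different
    partition elements; None stands for s = infinity. *)
Definition sep_time (part : M -> nat) (F : M -> M) (y y' : M) : option nat :=
  match pselect (exists n, part (iter n F y) != part (iter n F y')) with
  | left H => Some (@ex_minn (fun n => part (iter n F y) != part (iter n F y')) H)
  | right _ => None
  end.

Definition thpow (theta : R) (o : option nat) : R :=
  if o is Some n then theta ^+ n else 0.

(** Full-branch Gibbs-Markov map F : Y -> Y w.r.t. muY, the partition
    given by part, separation time s, with xi = d muY / d (muY o F)
    expressed through the Jacobian 1/xi : muY (F A) = int_A 1/xi dmuY
    for measurable A inside a partition element. *)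
Record gibbs_markov (muY : {measure set M -> \bar R}) (Y : set M)
    (part : M -> nat) (F : M -> M) (xi : M -> R) (theta C0 : R) : Prop := {
  gm_theta : 0 < theta < 1;
  gm_F_meas : measurable_fun Y F;
  gm_F_pres : forall A, measurable A -> muY (Y `&` F @^-1` A) = muY A;
  gm_part_meas : forall k, measurable (atom Y part k);
  gm_full_branch : forall k, (exists y, atom Y part k y) ->
      [/\ (forall y, atom Y part k y -> Y (F y)),
          (forall y y', atom Y part k y -> atom Y part k y' ->
             F y = F y' -> y = y') &
          (forall z, Y z -> exists2 y, atom Y part k y & F y = z)];
  gm_F_image_meas : forall k A, measurable A -> A `<=` atom Y part k ->
      measurable (F @` A);
  gm_xi_meas : measurable_fun Y xi;
  gm_xi_pos : forall y, Y y -> 0 < xi y;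
  gm_jacobian : forall k A, measurable A -> A `<=` atom Y part k ->
      muY (F @` A) = (\int[muY]_(y in A) ((xi y)^-1)%:E)%E;
  gm_distortion : forall y y', Y y -> Y y' -> part y = part y' ->
      `|ln (xi y) - ln (xi y')| <= C0 * thpow theta (sep_time part F y y')
}.

Record CMZ (mu : probability M R) (f : M -> M) (X Y : set M)
    (h sigma part : M -> nat) (muY : probability M R) (xi : M -> R)
    (theta C0 : R) : Prop := {
  cmz_mp : measure_preserving mu f;
  cmz_ergodic : ergodic mu f;
  cmz_mixing : mixing mu f;
  cmz_X : measurable X;
  cmz_Y : measurable Y;
  cmz_YX : Y `<=` X;
  cmz_muY_pos : (0 < mu Y)%E;
  cmz_h : first_return f X h;
  cmz_h_meas : forall n, measurable (X `&` h @^-1` [set n]);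
  cmz_muY_Y : muY Y = 1%E;
  cmz_sigma_pos : forall y, Y y -> (0 < sigma y)%N;
  cmz_sigma_int : muY.-integrable Y (fun y => ((sigma y)%:R)%:E);
  cmz_sigma_const : forall y y', Y y -> Y y' -> part y = part y' ->
      sigma y = sigma y';
  cmz_GM : gibbs_markov muY Y part (FY f h sigma) xi theta C0;
  cmz_h_const : forall y y', Y y -> Y y' -> part y = part y' ->
      forall l, (l < sigma y)%N ->
        h (iter l (induced f h) y) = h (iter l (induced f h) y');
  (* f_X modelled by the tower Y^sigma: pushes
     (muY x counting)/int sigma to mu_X = mu(. /\ X)/mu X *)
  cmz_tower_X : forall A, measurable A ->
      (mu (A `&` X) * \int[muY]_(y in Y) ((sigma y)%:R)%:E =
       mu X * \int[muY]_(y in Y)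
                \sum_(l < sigma y) (\1_A (iter l (induced f h) y))%:E)%E;
  (* f modelled by the tower over Y with height phi: pushes
     (muY x counting)/int phi to mu *)
  cmz_tower : forall A, measurable A ->
      (mu A * \int[muY]_(y in Y) ((phiY f h sigma y)%:R)%:E =
       \int[muY]_(y in Y)
                \sum_(l < phiY f h sigma y) (\1_A (iter l f y))%:E)%E
}.

Definition gcd_of (S : set nat) (d : nat) :=
  (forall m, S m -> (d %| m)%N) /\
  (forall e, (forall m, S m -> (e %| m)%N) -> (e %| d)%N).

(** The tower Delta; functions on Delta are represented as M -> nat -> R *)
Definition Delta (Y : set M) (Phi : M -> nat) : set (M * nat) :=
  [set p | Y p.1 /\ (p.2 < Phi p.1)%N].

Definition fDelta (F : M -> M) (Phi : M -> nat) (p : M * nat) : M * nat :=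
  if (p.2.+1 < Phi p.1)%N then (p.1, p.2.+1) else (F p.1, 0%N).

Definition Phibar (muY : {measure set M -> \bar R}) (Y : set M) (Phi : M -> nat) : R :=
  Rintegral muY Y (fun y => (Phi y)%:R).

(** integral over Delta w.r.t. mu_Delta = (muY x counting)/Phibar *)
Definition intDelta (muY : {measure set M -> \bar R}) (Y : set M)
    (Phi : M -> nat) (g : M -> nat -> R) : R :=
  Rintegral muY Y (fun y => \sum_(l < Phi y) g y l) / Phibar muY Y Phi.

Definition rho_star (muY : {measure set M -> \bar R}) (Y : set M)
    (F : M -> M) (Phi : M -> nat) (v w : M -> nat -> R) (n : nat) : R :=
  intDelta muY Y Phi
    (fun y l => v y l * w (iter n (fDelta F Phi) (y, l)).1
                          (iter n (fDelta F Phi) (y, l)).2).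

(** Xhat = pi_M^{-1}(X_d), pi_M(y,l) = f^{dl} y,
    X_d = X \/ f^{-1}X \/ ... \/ f^{-(d-1)}X *)
Definition Xhat (f : M -> M) (X Y : set M) (Phi : M -> nat) (d : nat) : set (M * nat) :=
  [set p | Delta Y Phi p /\
     exists2 k, (k < d)%N & X (iter k f (iter (d * p.2) f p.1))].

Definition supnorm (Y : set M) (Phi : M -> nat) (w : M -> nat -> R) : R :=
  sup [set `|w p.1 p.2| | p in Delta Y Phi].

Definition holder_semi (Y : set M) (Phi : M -> nat) (part : M -> nat)
    (F : M -> M) (theta : R) (v : M -> nat -> R) : R :=
  sup [set `|v q.1.1 q.2 - v q.1.2 q.2| / thpow theta (sep_time part F q.1.1 q.1.2)
      | q in [set q : (M * M) * nat | [/\ Y q.1.1, Y q.1.2, q.1.1 <> q.1.2 &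
                                          (q.2 < Phi q.1.1)%N]]].

Definition norm_theta (Y : set M) (Phi : M -> nat) (part : M -> nat)
    (F : M -> M) (theta : R) (v : M -> nat -> R) : R :=
  supnorm Y Phi v + holder_semi Y Phi part F theta v.

Definition Linf (Y : set M) (Phi : M -> nat) (w : M -> nat -> R) :=
  (forall l, measurable_fun Y (fun y => w y l)) /\
  exists K : R, forall p, Delta Y Phi p -> `|w p.1 p.2| <= K.

Definition Linf_on (Y : set M) (Phi : M -> nat) (S : set (M * nat))
    (w : M -> nat -> R) :=
  Linf Y Phi w /\ forall p, ~ S p -> w p.1 p.2 = 0.

Definition Ftheta (Y : set M) (Phi : M -> nat) (part : M -> nat)
    (F : M -> M) (theta : R) (S : set (M * nat)) (v : M -> nat -> R) :=
  Linf_on Y Phi S v /\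
  exists K : R, forall y y' l, Y y -> Y y' -> y <> y' -> (l < Phi y)%N ->
    `|v y l - v y' l| <= K * thpow theta (sep_time part F y y').

Definition sigma_seq (muY : {measure set M -> \bar R}) (Y : set M)
    (sigma phi : M -> nat) (n : nat) : R :=
  Rintegral muY (Y `&` [set y | (n < phi y)%N]) (fun y => (sigma y)%:R).

Definition gamma_seq (muY : {measure set M -> \bar R}) (Y : set M)
    (sigma phi : M -> nat) (beta : R) (n : nat) : R :=
  sigma_seq muY Y sigma phi n +
  \sum_(1 <= j < n.+1) (j%:R `^ (- beta)) * sigma_seq muY Y sigma phi (n - j).

Definition zeta (beta : R) (n : nat) : R :=
  if 2 < beta then n%:R `^ (- beta)
  else if beta == 2 then ln n%:R / n%:R ^+ 2
  else n%:R `^ (- (2 * (beta - 1))).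

Definition tail_sum (muY : {measure set M -> \bar R}) (Y : set M)
    (Phi : M -> nat) (n : nat) : R :=
  fine (\sum_(n.+1 <= j <oo) muY (Y `&` [set y | (j < Phi y)%N]))%E.

End Defs.

(* Main.v *)
Require Import Defs.
From HB Require Import structures.
From mathcomp Require Import all_boot all_order all_algebra.
From mathcomp Require Import all_classical all_reals all_analysis.
From mathcomp Require Import measurable_realfun.
From mathcomp Require Import ring lra zify.
Set Implicit Arguments. Unset Strict Implicit. Unset Printing Implicit Defensive.
Import Order.TTheory GRing.Theory Num.Theory.
Import numFieldNormedType.Exports.
Local Open Scope classical_set_scope.
Local Open Scope ring_scope.

(** Transporting a log-Lipschitz density on the base by a branch of [F] gives a
    density in a smaller cone, which dominates a fixed multiple of the constant
    density. Splitting off this multiple regenerates the process, and the first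
    regeneration time inherits the tail [O(n^-beta)] of the return time, so that
    the observations of the tower from its base obey a scalar renewal equation.
    For a scalar renewal sequence [u] with tail sequence [tau], the differences
    [delta_n = u_n - u_(n-1)] are summable by a coupling of two delayed renewal
    processes, and the derivation [x d/dx] applied to [tau * delta = 1] then
    improves this to [delta_n = O(n^-beta)].

    Cutting a correlation at the first return to the base expresses it through
    these observations, up to the orbits that have not returned by time [n]; on
    the latter [v] or [w] is nonzero at most [sigma] times per column, whence
    the terms [sigma_(nd)]. The same expansion for [v = 1], where the correlation
    is constant by invariance, determines the observations of the base up to the
    required order. *)

(** * Formal power series and renewal sequences *)

(** The density after a return depends on the branch taken, so the returns themselves do not form a
    scalar renewal process; splitting off the constant density erases the past at a regeneration.
    The law of the first regeneration time involves neither observable, so a single scalar inversion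
    gives constants uniform in [v] and [w]. As [beta] is only assumed larger than 1, the
    regeneration time has a finite mean but possibly no variance. The coupling uses the mean alone,
    at the price of giving no rate. The derivation supplies one: it yields [n delta_n = - sum_k k
    tau_k (delta delta)_(n-k)], where [k tau_k = O(k^(1-beta))] is small on average, so the unknown
    [delta] on the right enters with a small factor and strong induction closes. The term [zeta]
    comes from the second order of the base expansion, which contains the square of the series
    [b_n = E (Phi - n)^+]. Its coefficients are too large by themselves, but their consecutive
    differences are of order [n^-beta sum_(k <= n) (k+1)^(1-beta)]. *)

Definition fps (R : Type) := nat -> R.

Section FormalSeries.
Context {R : comNzRingType}.
Implicit Types a b c : nat -> R.

Definition cauchy a b : nat -> R := fun n => \sum_(i < n.+1) a i * b (n - i)%N.

Lemma cauchy_coef a b n N : (n < N)%N ->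
  cauchy a b n = (\poly_(i < N) a i * \poly_(i < N) b i)`_n.
Proof.
move=> nN; rewrite coefM; apply: eq_bigr => i _; rewrite !coef_poly.
by rewrite (leq_ltn_trans _ nN) ?leq_ord// (leq_ltn_trans _ nN)// leq_subr.
Qed.

Lemma coef_mul_congr (p q p' q' : {poly R}) n :
  (forall i, (i <= n)%N -> p`_i = p'`_i) -> (forall i, (i <= n)%N -> q`_i = q'`_i) ->
  (p * q)`_n = (p' * q')`_n.
Proof.
move=> pp qq; rewrite !coefM; apply: eq_bigr => i _.
by rewrite pp ?leq_ord// qq// leq_subr.
Qed.

Lemma cauchyC : commutative cauchy.
Proof.
by move=> a b; apply/funext => n; rewrite !(cauchy_coef _ _ (ltnSn n)) mulrC.
Qed.

Lemma cauchyA : associative cauchy.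
Proof.
move=> a b c; apply/funext => n; rewrite !(cauchy_coef _ _ (ltnSn n)).
pose A := \poly_(i < n.+1) a i; pose B := \poly_(i < n.+1) b i.
pose C := \poly_(i < n.+1) c i.
rewrite (@coef_mul_congr _ _ A (B * C))//; last first.
  by move=> i le_in; rewrite coef_poly ltnS le_in (cauchy_coef _ _ (le_in : (i < n.+1)%N)).
rewrite mulrA; apply: coef_mul_congr => // i le_in.
by rewrite coef_poly ltnS le_in (cauchy_coef _ _ (le_in : (i < n.+1)%N)).
Qed.

Definition fps_zero : nat -> R := fun=> 0.
Definition fps_one : nat -> R := fun n => (n == 0%N)%:R.
Definition fps_opp a : nat -> R := fun n => - a n.
Definition fps_add a b : nat -> R := fun n => a n + b n.

Lemma fps_addA : associative fps_add.
Proof. by move=> a b c; apply/funext => n; rewrite /fps_add addrA. Qed.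
Lemma fps_addC : commutative fps_add.
Proof. by move=> a b; apply/funext => n; rewrite /fps_add addrC. Qed.
Lemma fps_add0 : left_id fps_zero fps_add.
Proof. by move=> a; apply/funext => n; rewrite /fps_add add0r. Qed.
Lemma fps_addN : left_inverse fps_zero fps_opp fps_add.
Proof. by move=> a; apply/funext => n; rewrite /fps_add addNr. Qed.
Lemma cauchy1 : left_id fps_one cauchy.
Proof.
move=> a; apply/funext => n; rewrite /cauchy big_ord_recl big1 ?addr0.
  by rewrite /fps_one mul1r subn0.
by move=> i _; rewrite /fps_one mul0r.
Qed.
Lemma cauchyDl : left_distributive cauchy fps_add.
Proof.
move=> a b c; apply/funext => n; rewrite /cauchy /fps_add -big_split.
by apply: eq_bigr => i _; rewrite mulrDl.
Qed.
Lemma fps_one_neq0 : fps_one != fps_zero.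
Proof.
apply/eqP => /(congr1 (fun a : nat -> R => a 0%N)) /eqP.
by rewrite /fps_one /fps_zero eqxx oner_eq0.
Qed.

HB.instance Definition _ := Choice.copy (fps R) (nat -> R).
HB.instance Definition _ :=
  GRing.isZmodule.Build (fps R) fps_addA fps_addC fps_add0 fps_addN.
HB.instance Definition _ :=
  GRing.Zmodule_isComNzRing.Build (fps R) cauchyA cauchyC cauchy1 cauchyDl fps_one_neq0.

Lemma fpsM (a b : fps R) n : (a * b) n = \sum_(i < n.+1) a i * b (n - i)%N.
Proof. by []. Qed.
Lemma fpsD (a b : fps R) n : (a + b) n = a n + b n. Proof. by []. Qed.
Lemma fpsN (a : fps R) n : (- a) n = - a n. Proof. by []. Qed.
Lemma fpsB (a b : fps R) n : (a - b) n = a n - b n. Proof. by []. Qed.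
Lemma fps1 n : (1 : fps R) n = (n == 0%N)%:R. Proof. by []. Qed.

Definition fpsC (c : R) : fps R := fun n => if n is 0%N then c else 0.
Definition fpsX : fps R := fun n => (n == 1%N)%:R.

Lemma fpsCM (x : R) (a : fps R) n : (fpsC x * a) n = x * a n.
Proof. by rewrite fpsM big_ord_recl big1 ?addr0 ?subn0// => i _; rewrite mul0r. Qed.

Lemma fpsXM0 (a : fps R) : (fpsX * a) 0%N = 0.
Proof. by rewrite fpsM big_ord_recl big_ord0 addr0 mul0r. Qed.

Lemma fpsXMS (a : fps R) n : (fpsX * a) n.+1 = a n.
Proof.
rewrite fpsM big_ord_recl mul0r add0r big_ord_recl big1 ?addr0; last first.
  by move=> i _; rewrite mul0r.
by rewrite mul1r /bump/= subn1.
Qed.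

Definition fps_ones : fps R := fun=> 1.

Lemma fps_sum_ones (a : fps R) n : (a * fps_ones) n = \sum_(i < n.+1) a i.
Proof. by rewrite fpsM; apply: eq_bigr => i _; rewrite mulr1. Qed.

Lemma fps_geometric : (1 - fpsX) * fps_ones = 1.
Proof.
apply/funext => -[|n]; rewrite mulrBl mul1r fpsB.
  by rewrite fpsXM0 subr0.
by rewrite fpsXMS subrr.
Qed.

(** The geometric series in [f]: without constant term, [f ^+ k] starts at degree [k], so every
    coefficient of the series is a finite sum. *)
Lemma renewal_seq_exists (f : fps R) : f 0%N = 0 -> exists u : fps R, (1 - f) * u = 1.
Proof.
move=> f0; have fX N n : (n < N)%N -> (f ^+ N) n = 0.
  elim: N n => // N IH n ltn; rewrite exprS fpsM big_ord_recl f0 mul0r add0r.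
  by rewrite big1// => i _; rewrite IH ?mulr0// lift0; have := ltn_ord i; lia.
exists (fun n => (\sum_(k < n.+1) f ^+ k) n).
apply/funext => n; pose S := \sum_(k < n.+1) f ^+ k.
have -> : ((1 - f) * (fun n => (\sum_(k < n.+1) f ^+ k) n : R)) n = ((1 - f) * S) n.
  rewrite !fpsM; apply: eq_bigr => i _; congr (_ * _).
  rewrite /S -!(big_mkord xpredT (fun k => f ^+ k)).
  rewrite [in RHS](big_cat_nat (n := (n - i).+1))//=; last by rewrite ltnS leq_subr.
  rewrite fpsD [X in _ = _ + X](_ : _ = 0) ?addr0//.
  rewrite big_nat; elim/big_rec: _ => // j x /andP[lt1 lt2] x0.
  by rewrite fpsD x0 addr0 fX//; lia.
have -> : (1 - f) * S = 1 - f ^+ n.+1 by rewrite -[in RHS]opprB subrX1 -mulNr opprB.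
by rewrite fpsB fX// subr0.
Qed.

Definition fps_euler (a : fps R) : fps R := fun n => n%:R * a n.

Lemma fps_eulerM (a b : fps R) :
  fps_euler (a * b) = fps_euler a * b + a * fps_euler b.
Proof.
apply/funext => n; rewrite fpsD /fps_euler !fpsM mulr_sumr -big_split.
apply: eq_bigr => i _ /=.
have -> : n%:R = i%:R + (n - i)%:R :> R by rewrite -natrD subnKC ?leq_ord.
ring.
Qed.

End FormalSeries.

(** * Summability of renewal differences by coupling *)

Section Coupling.
Context {R : realFieldType}.
Variables (f u tau : fps R).
Hypothesis f_ge0 : forall n, 0 <= f n.
Hypothesis f0 : f 0%N = 0.
Hypothesis tau_ge0 : forall n, 0 <= tau n.
Hypothesis tauE : forall n, tau n = 1 - \sum_(k < n) f k.+1.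
Hypothesis uE : (1 - f) * u = 1.

Lemma renewal0 : u 0%N = 1.
Proof.
have := congr1 (fun a : fps R => a 0%N) uE.
by rewrite /= fpsM big_ord_recl big_ord0 addr0 fpsB f0 subr0 !fps1 mul1r.
Qed.

Lemma renewalS n : u n.+1 = \sum_(k < n.+1) f k.+1 * u (n - k)%N.
Proof.
have := congr1 (fun a : fps R => a n.+1) uE.
rewrite mulrBl mul1r /= fpsB fpsM big_ord_recl f0 mul0r add0r fps1 => /eqP.
by rewrite subr_eq add0r => /eqP ->; apply: eq_bigr => i _; rewrite subSS.
Qed.

Lemma renewal_ge0 n : 0 <= u n.
Proof.
elim/ltn_ind: n => -[|n] IH; first by rewrite renewal0.
rewrite renewalS; apply: sumr_ge0 => i _; rewrite mulr_ge0// IH//.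
by rewrite ltnS leq_subr.
Qed.

Lemma tail_mul : (1 - fpsX) * tau = 1 - f.
Proof.
apply/funext => -[|n]; rewrite mulrBl mul1r !fpsB.
  by rewrite fpsXM0 fps1 f0 tauE big_ord0 !subr0.
by rewrite fpsXMS fps1 !tauE big_ord_recr/=; ring.
Qed.

(** Partition according to the last renewal up to time [n]; in series, [tau = (1 - f) / (1 - x)] and
    [u = 1 / (1 - f)]. *)
Lemma tail_renewal : tau * u = fps_ones.
Proof.
have : (1 - fpsX) * (tau * u) = 1 by rewrite mulrA tail_mul.
move/(congr1 (fun a => fps_ones * a)).
by rewrite mulrA [fps_ones * _]mulrC fps_geometric mul1r mulr1.
Qed.

Lemma tail_renewal_sum n : \sum_(k < n.+1) tau k * u (n - k)%N = 1.
Proof. by rewrite -fpsM tail_renewal. Qed.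

Lemma renewal_le1 n : u n <= 1.
Proof.
rewrite -(tail_renewal_sum n) big_ord_recl subn0 tauE big_ord0 subr0 mul1r.
by rewrite lerDl sumr_ge0// => i _; rewrite mulr_ge0// renewal_ge0.
Qed.

(* u delayed by i: the probability of a renewal at time n when the first
   renewal takes place at time i *)
Definition delayed n i := if (i <= n)%N then u (n - i)%N else 0.

Lemma delayed_ge0 n i : 0 <= delayed n i.
Proof. by rewrite /delayed; case: ifP => // _; exact: renewal_ge0. Qed.

Lemma delayed_le1 n i : delayed n i <= 1.
Proof. by rewrite /delayed; case: ifP => // _; exact: renewal_le1. Qed.

Lemma delayedS n : delayed n.+1 0 = \sum_(k < n.+1) f k.+1 * delayed n k.
Proof.
rewrite /delayed/= subn0 renewalS; apply: eq_bigr => i _.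
by rewrite -ltnS ltn_ord.
Qed.

(* One step of the residual waiting time at a renewal; only residuals up to n matter. *)
Definition jump n (g : nat -> R) := \sum_(k < n.+1) f k.+1 * g k + tau n.+1.

(* Probability that two independent renewal processes with delays i and j
   have no common renewal up to time n. *)
Fixpoint unmet n i j : R :=
  match i, j with
  | 0%N, 0%N => 0
  | i'.+1, j'.+1 => if n is n'.+1 then unmet n' i' j' else 1
  | 0%N, j'.+1 => if n is n'.+1 then jump n' (fun k => unmet n' k j') else 1
  | i'.+1, 0%N => if n is n'.+1 then jump n' (fun k => unmet n' i' k) else 1
  end.

Lemma jump_sum n : \sum_(k < n.+1) f k.+1 = 1 - tau n.+1.
Proof. by rewrite tauE; ring. Qed.

Lemma unmet_ge0 n i j : 0 <= unmet n i j.
Proof.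
by elim: n i j => [|n IH] [|i] [|j] //=; rewrite addr_ge0//;
  apply: sumr_ge0 => k _; rewrite mulr_ge0.
Qed.

(** Coupling inequality: after a common renewal the two processes have the same future, so their
    renewal probabilities at time [n] differ at most by the probability of not having met. *)
Lemma delayed_diff n i j : `|delayed n i - delayed n j| <= unmet n i j.
Proof.
elim: n i j => [|n IH] [|i] [|j] /=; rewrite ?subrr ?normr0 //.
- by rewrite /delayed/= renewal0 subr0 normr1.
- by rewrite /delayed/= renewal0 sub0r normrN normr1.
- have -> : delayed n.+1 j.+1 = delayed n j by rewrite /delayed ltnS subSS.
  (* The waiting times beyond [n.+1] have mass [tau n.+1] and give no renewal at time [n.+1]; hence
     the correction to the average over the residuals. *)
  have -> : delayed n.+1 0 - delayed n j = \sum_(k < n.+1) f k.+1 * (delayed n k - delayed n j)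
      - tau n.+1 * delayed n j.
    under eq_bigr do rewrite mulrBr.
    by rewrite big_split/= sumrN -mulr_suml jump_sum delayedS; ring.
  rewrite (le_trans (ler_normB _ _))// /jump lerD//.
    rewrite (le_trans (ler_norm_sum _ _ _))// ler_sum// => k _.
    by rewrite normrM ger0_norm// ler_wpM2l.
  by rewrite normrM !ger0_norm// ?delayed_ge0// ler_piMr// delayed_le1.
- have -> : delayed n.+1 i.+1 = delayed n i by rewrite /delayed ltnS subSS.
  have -> : delayed n i - delayed n.+1 0 = \sum_(k < n.+1) f k.+1 * (delayed n i - delayed n k)
      + tau n.+1 * delayed n i.
    under eq_bigr do rewrite mulrBr.
    by rewrite big_split/= sumrN -mulr_suml jump_sum delayedS; ring.
  rewrite (le_trans (ler_normD _ _))// /jump lerD//.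
    rewrite (le_trans (ler_norm_sum _ _ _))// ler_sum// => k _.
    by rewrite normrM ger0_norm// ler_wpM2l.
  by rewrite normrM !ger0_norm// ?delayed_ge0// ler_piMr// delayed_le1.
- by rewrite /delayed !ltnS !subSS; exact: IH.
Qed.

(* Probability that the two processes, both renewing now, do not meet again up to time m. *)
Definition apart m : R :=
  if m is m'.+1 then jump m' (fun k => jump m' (fun l => unmet m' k l)) else 1.

Lemma apartS m : apart m.+1 = jump m (fun k => jump m (unmet m k)).
Proof. by []. Qed.

Lemma apart_ge0 m : 0 <= apart m.
Proof.
case: m => [|m] //=; rewrite addr_ge0// sumr_ge0// => k _.
by rewrite mulr_ge0// addr_ge0// sumr_ge0// => l _; rewrite mulr_ge0// unmet_ge0.
Qed.

Lemma delayed_big n i : (n < i)%N -> delayed n i = 0.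
Proof. by rewrite /delayed [(i <= n)%N]leqNgt => ->. Qed.

Lemma delayed_jump n m : (m <= n)%N ->
  delayed m.+1 0 = \sum_(k < n.+1) f k.+1 * delayed m k.
Proof.
move=> mn; rewrite delayedS.
rewrite -[LHS](big_mkord xpredT (fun k => f k.+1 * delayed m k)).
rewrite -[RHS](big_mkord xpredT (fun k => f k.+1 * delayed m k)).
rewrite [RHS](big_cat_nat (n := m.+1))//= [X in _ = _ + X]big_nat.
by rewrite [X in _ = _ + X]big1 ?addr0// => k /andP[lt _]; rewrite delayed_big ?mulr0.
Qed.

Lemma jump_compl n (g a : nat -> R) : (forall k, g k + a k = 1) ->
  jump n g + \sum_(k < n.+1) f k.+1 * a k = 1.
Proof.
move=> ga; rewrite /jump addrAC -big_split/=.
under eq_bigr => k _ do rewrite -mulrDr ga mulr1.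
by rewrite jump_sum; ring.
Qed.

(** Partition according to the last common renewal [k] up to time [n]: both processes renew at [k]
    and stay apart during the remaining [n - k] steps. *)
Lemma last_meeting n i j :
  unmet n i j + \sum_(k < n.+1) delayed k i * delayed k j * apart (n - k) = 1.
Proof.
have dS m p : delayed m.+1 p.+1 = delayed m p by rewrite /delayed ltnS subSS.
have d0S p : delayed 0 p.+1 = 0 by [].
elim: n i j => [|n IH] i j.
  rewrite big_ord1 subnn mulr1; case: i j => [|i] [|j] /=;
  by rewrite ?d0S /delayed/= ?renewal0; ring.
rewrite big_ord_recl subn0.
under eq_bigr => k _ do rewrite lift0 subSS.
case: i j => [|i] [|j].
- rewrite [unmet _ _ _]/= {1 2}/delayed/= renewal0 !mul1r add0r.
  rewrite (_ : \sum_(i < n.+1) _ = \sum_(k < n.+1) f k.+1 * \sum_(l < n.+1) f l.+1 *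
       \sum_(i < n.+1) delayed i k * delayed i l * apart (n - i)); last first.
    under [RHS]eq_bigr do rewrite mulr_sumr.
    under [RHS]eq_bigr do under eq_bigr do rewrite !mulr_sumr.
    under [RHS]eq_bigr do rewrite exchange_big/=.
    rewrite [RHS]exchange_big/=; apply: eq_bigr => i _.
    have -> := @delayed_jump n i (leq_ord i).
    rewrite -mulrA mulr_suml; apply: eq_bigr => k _.
    rewrite mulr_suml mulr_sumr; apply: eq_bigr => l _; ring.
  pose S k l := \sum_(i < n.+1) delayed i k * delayed i l * apart (n - i)%N.
  have S1 k : jump n (unmet n k) + \sum_(l < n.+1) f l.+1 * S k l = 1.
    exact: (@jump_compl n (unmet n k) (S k) (IH k)).
  exact: (@jump_compl n (fun k => jump n (unmet n k)) (fun k => \sum_(l < n.+1) f l.+1 * S k l)).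
- rewrite [unmet _ _ _]/= d0S mulr0 mul0r add0r.
  rewrite (_ : \sum_(i < n.+1) _ = \sum_(k < n.+1) f k.+1 *
       \sum_(i < n.+1) delayed i k * delayed i j * apart (n - i)); last first.
    under [RHS]eq_bigr do rewrite mulr_sumr.
    rewrite [RHS]exchange_big/=; apply: eq_bigr => i _.
    have -> := @delayed_jump n i (leq_ord i); rewrite dS.
    rewrite -mulrA mulr_suml; apply: eq_bigr => k _; ring.
  by apply: (@jump_compl n (fun k => unmet n k j) (fun k => \sum_(i < n.+1) delayed i k * delayed i j * apart (n - i)%N)) => k; exact: IH.
- rewrite [unmet _ _ _]/= d0S !mul0r add0r.
  rewrite (_ : \sum_(i < n.+1) _ = \sum_(k < n.+1) f k.+1 *
       \sum_(j < n.+1) delayed j i * delayed j k * apart (n - j)); last first.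
    under [RHS]eq_bigr do rewrite mulr_sumr.
    rewrite [RHS]exchange_big/=; apply: eq_bigr => j _.
    have -> := @delayed_jump n j (leq_ord j); rewrite dS.
    rewrite mulrC mulrA mulr_sumr; apply: eq_bigr => k _; ring.
  by apply: (@jump_compl n (unmet n i) (fun k => \sum_(j < n.+1) delayed j i * delayed j k * apart (n - j)%N)) => k; exact: IH.
- rewrite [unmet _ _ _]/= !d0S !mul0r add0r.
  by under eq_bigr do rewrite !dS; exact: IH.
Qed.

(** Adding [tail_renewal_sum] over the times up to [N], each [u k] receives a weight that is a
    partial sum of [tau]. *)
Lemma sum_renewal_ge N T : (forall n, \sum_(k < n) tau k <= T) ->
  N.+1%:R <= T * \sum_(k < N.+1) u k.
Proof.
move=> tauT; have -> : N.+1%:R = \sum_(n < N.+1) \sum_(k < n.+1) tau (n - k)%N * u k :> R.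
  rewrite (eq_bigr (fun=> 1)) ?sumr_const ?card_ord// => n _.
  rewrite -(tail_renewal_sum n) (reindex_inj rev_ord_inj)/=.
  by apply: eq_bigr => k _; rewrite subSS subKn// -ltnS.
rewrite mulr_sumr; under eq_bigr => n _ do
  rewrite (big_ord_widen_cond N.+1 xpredT (fun k => tau (n - k)%N * u k)) ?ltn_ord//=.
rewrite (exchange_big_dep xpredT)//=; apply: ler_sum => k _.
rewrite -mulr_suml ler_wpM2r ?renewal_ge0// (le_trans _ (tauT (N.+1 - k)%N))//.
rewrite -(big_mkord (fun n => (k < n.+1)%N) (fun n => tau (n - k)%N)).
rewrite (big_cat_nat (n := k))//=; last by rewrite ltnW.
rewrite big_nat_cond big_pred0 ?add0r; last by move=> n; lia.
rewrite -{1}[nat_of_ord k]add0n big_addn big_mkord.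
under [leLHS]eq_bigl => i do rewrite ltnS leq_addl.
by under eq_bigr => i _ do rewrite addnK.
Qed.

(** With both delays zero, [last_meeting] says that [u^2] convolved with [apart] is 1. Hence a lower
    bound on [sum u_k^2], linear in the number of terms because the mean is finite, is an upper
    bound on [sum apart]. *)
Lemma sum_apart_le T : 0 < T -> (forall n, \sum_(k < n) tau k <= T) ->
  forall N, \sum_(m < N) apart m <= 2 * T ^+ 2.
Proof.
move=> T0 tauT [|N]; first by rewrite big_ord0 mulr_ge0// sqr_ge0.
have u2 : N.+1%:R <= T ^+ 2 * \sum_(k < N.+1) u k ^+ 2.
  (* Here [(T u_k - 1)^2 >= 0] takes the place of Cauchy-Schwarz. *)
  apply: (@le_trans _ _ (\sum_(k < N.+1) (2 * T * u k - 1))).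
    rewrite big_split/= -mulr_sumr sumr_const card_ord.
    by have := sum_renewal_ge N tauT; rewrite -mulrA mulNrn; lra.
  rewrite mulr_sumr; apply: ler_sum => k _.
  by have := sqr_ge0 (T * u k - 1); nra.
(* The range of [n] is doubled so that every pair of indices up to [N] occurs in one of the
   convolutions. *)
have main : (\sum_(k < N.+1) u k ^+ 2) * (\sum_(m < N.+1) apart m) <= N.+1.*2%:R.
  have -> : N.+1.*2%:R = \sum_(n < N.+1.*2) \sum_(k < n.+1) u k ^+ 2 * apart (n - k) :> R.
    rewrite (eq_bigr (fun=> 1)) ?sumr_const ?card_ord// => n _.
    rewrite -(last_meeting n 0 0).
    rewrite (_ : unmet n 0 0 = 0) ?add0r; last by case: (nat_of_ord n).
    by apply: eq_bigr => k _; rewrite /delayed/= subn0 expr2.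
  rewrite mulr_suml; under [leRHS]eq_bigr => n _ do
    rewrite (big_ord_widen_cond N.+1.*2 xpredT (fun k => u k ^+ 2 * apart (n - k)%N)) ?ltn_ord//=.
  rewrite [leRHS](exchange_big_dep xpredT)//=.
  have NN : (N.+1 <= N.+1.*2)%N by lia.
  rewrite (big_ord_widen_cond N.+1.*2 xpredT (fun k => u k ^+ 2 * _) NN)/=.
  rewrite big_mkcond/=; apply: ler_sum => k _; case: ifPn => [kN|_]; last first.
    by rewrite sumr_ge0// => n _; rewrite mulr_ge0// ?sqr_ge0// apart_ge0.
  rewrite -mulr_sumr ler_wpM2l ?sqr_ge0//.
  rewrite -(big_mkord (fun n => (k < n.+1)%N) (fun n => apart (n - k)%N)).
  rewrite (big_cat_nat (n := k))//=; last by lia.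
  rewrite [X in X + _]big_nat_cond [X in X + _]big_pred0 ?add0r; last by move=> n; lia.
  rewrite -[X in index_iota X _]add0n big_addn big_mkord.
  under [leRHS]eq_bigl => i do rewrite ltnS leq_addl.
  under [leRHS]eq_bigr => i _ do rewrite addnK.
  rewrite (big_ord_widen_cond (N.+1.*2 - k) xpredT apart); last by lia.
  by rewrite big_mkcond/=; apply: ler_sum => i _; case: ifP => // _; exact: apart_ge0.
have A0 : 0 <= \sum_(m < N.+1) apart m by apply: sumr_ge0 => i _; exact: apart_ge0.
have N0 : 0 < N.+1%:R :> R by rewrite ltr0n.
rewrite -(ler_pM2l N0) (le_trans (ler_wpM2r A0 u2))//.
rewrite -mulrA (le_trans (ler_wpM2l _ main)) ?sqr_ge0//.
rewrite -muln2 natrM; nra.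
Qed.

(** Two processes that have just met renew next after [N] and [N + 1] steps with probability
    [f N * f N.+1]; from then on they are one unit apart, which is the situation comparing [u n]
    with [u n.+1]. *)
Lemma renewal_diff_apart N n : (0 < N)%N ->
  f N * f N.+1 * `|u n.+1 - u n| <= apart (n + N).+1.
Proof.
case: N => // N _; have fu : `|u n.+1 - u n| <= unmet n.+1 0 1.
  by have := delayed_diff n.+1 0 1; rewrite /delayed/= subn0 subn1.
have shift m k i j : unmet (m + k) (i + k) (j + k) = unmet m i j.
  elim: k => [|k IH]; first by rewrite !addn0.
  by rewrite !addnS.
rewrite -(shift _ N) in fu.
rewrite addnS -addSn apartS.
have jump_ge k m (g : nat -> R) : (k <= m)%N -> (forall i, 0 <= g i) -> f k.+1 * g k <= jump m g.
  move=> km g0; rewrite /jump (bigD1 (Ordinal (km : (k < m.+1)%N)))//=.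
  by rewrite -addrA lerDl addr_ge0// sumr_ge0// => i _; rewrite mulr_ge0.
apply: le_trans (jump_ge N _ _ _ _); last 2 first.
- by rewrite leq_addl.
- by move=> i; rewrite addr_ge0// sumr_ge0// => j _; rewrite mulr_ge0// unmet_ge0.
rewrite -mulrA ler_wpM2l//; apply: le_trans (jump_ge N.+1 _ _ _ _); last 2 first.
- by lia.
- by move=> i; exact: unmet_ge0.
by rewrite ler_wpM2l// -[N.+1]add1n -{1}[N]add0n.
Qed.

Lemma renewal_diff_summable N T : (0 < N)%N -> 0 < f N -> 0 < f N.+1 -> 0 < T ->
  (forall n, \sum_(k < n) tau k <= T) ->
  forall m, \sum_(n < m) `|u n.+1 - u n| <= 2 * T ^+ 2 / (f N * f N.+1).
Proof.
move=> N0 fN fN1 T0 tauT m; rewrite ler_pdivlMr ?mulr_gt0// mulrC mulr_sumr.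
apply: (@le_trans _ _ (\sum_(n < m) apart (n + N).+1)).
  by apply: ler_sum => n _; exact: renewal_diff_apart.
apply: le_trans (sum_apart_le T0 tauT (m + N.+1)%N).
rewrite -(big_mkord xpredT (fun n => apart (n + N).+1)) -(big_mkord xpredT apart).
rewrite [leRHS](big_cat_nat (n := N.+1))//=; last by rewrite leq_addl.
rewrite -{2}[N.+1]add0n [X in _ + X]big_addn addnK.
under [X in _ + X]eq_bigr do rewrite addnS.
by rewrite lerDr; apply: sumr_ge0 => i _; exact: apart_ge0.
Qed.

End Coupling.

(** * Polynomial rates *)

Section PowerSequences.
Context {R : realType}.
Implicit Types (s A B : R) (a b : fps R).

(** The shift by one gives the value 1 at index 0, so that bounds can be stated for all indices. *)
Definition pw s : fps R := fun n => n.+1%:R `^ (- s).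

Lemma pw_gt0 s n : 0 < pw s n.
Proof. by rewrite /pw powR_gt0// ltr0n. Qed.

Lemma pw_ge0 s n : 0 <= pw s n.
Proof. exact: powR_ge0. Qed.

Lemma pw0 s : pw s 0%N = 1.
Proof. by rewrite /pw powR1. Qed.

Lemma pwS s n : n.+1%:R * pw s n = pw (s - 1) n.
Proof.
rewrite /pw opprB addrC powRD; first by rewrite powRr1 1?mulrC.
by rewrite pnatr_eq0 implybT.
Qed.

Lemma pw_scale s c m n : 0 <= s -> 0 < c -> n.+1%:R <= c * m.+1%:R ->
  pw s m <= c `^ s * pw s n.
Proof.
move=> s0 c0 np; rewrite /pw !powRN -ler_pdivrMl ?powR_gt0//.
rewrite -invfM lef_pV2 ?posrE ?mulr_gt0 ?powR_gt0 ?ltr0n//.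
by rewrite -powRM ?(ltW c0)// ge0_ler_powR ?nnegrE ?mulr_ge0 ?(ltW c0).
Qed.

Lemma pw_scale_nat s p m n : 0 <= s -> (0 < p)%N -> (n.+1 <= p * m.+1)%N ->
  pw s m <= p%:R `^ s * pw s n.
Proof. by move=> s0 p0 np; apply: pw_scale; rewrite ?ltr0n// -natrM ler_nat. Qed.

Lemma pw_half s k n : 0 <= s -> (n <= k.*2)%N -> pw s k <= 2 `^ s * pw s n.
Proof. by move=> s0 nk; apply: pw_scale_nat => //; lia. Qed.

Lemma pw_half_sub s k n : 0 <= s -> (k.*2 < n)%N -> pw s (n - k)%N <= 2 `^ s * pw s n.
Proof. by move=> s0 nk; apply: pw_scale_nat => //; lia. Qed.

Lemma pw_le s m n : 0 <= s -> (m <= n)%N -> pw s n <= pw s m.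
Proof.
move=> s0 mn; have := @pw_scale_nat s 1 n m s0 isT; rewrite powR1 mul1r; apply.
by rewrite mul1n.
Qed.

Lemma pw_le1 s n : 0 <= s -> pw s n <= 1.
Proof. by move=> s0; rewrite -(pw0 s) pw_le. Qed.

Lemma pw_small s e : 0 < s -> 0 < e -> exists N, forall n, (N <= n)%N -> pw s n <= e.
Proof.
move=> s0 e0; exists (Num.trunc (e `^ (- s^-1))) => n Nn.
have le_n : e `^ (- s^-1) <= n.+1%:R.
  by rewrite (le_trans (ltW (truncnS_gt _)))// ler_nat.
have E : e = (e `^ (- s^-1)) `^ (- s).
  by rewrite -powRrM mulrNN mulVf ?gt_eqF// powRr1// ltW.
rewrite [leRHS]E /pw !(powRN _ s) lef_pV2 ?posrE ?powR_gt0 ?ltr0n//.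
by rewrite ge0_ler_powR ?nnegrE ?powR_ge0// ltW.
Qed.

Lemma succ_ratio n : n.+1%:R / n.+2%:R = 1 - n.+2%:R^-1 :> R.
Proof.
have m1 : 0 < n.+2%:R :> R by rewrite ltr0n.
rewrite (_ : n.+1%:R = n.+2%:R - 1) ?mulrBl; last by rewrite -[1]/(1%:R) -natrB// subn1.
by rewrite mulfV ?gt_eqF// mul1r.
Qed.

(** Discrete substitute for integrating [x^-(s+1)]; it rests on [((n+2)/(n+1))^s >= 1 + s/(n+2)]. *)
Lemma pw_telescope s n : 0 < s -> s * pw (s + 1) n.+1 <= pw s n - pw s n.+1.
Proof.
move=> s0; have -> : pw s n.+1 = n.+2%:R * pw (s + 1) n.+1 by rewrite pwS addrK.
rewrite lerBrDr -mulrDl.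
have m0 : 0 < n.+1%:R :> R by rewrite ltr0n.
have m1 : 0 < n.+2%:R :> R by rewrite ltr0n.
have E : 1 + s / n.+2%:R <= (n.+2%:R / n.+1%:R) `^ s.
  rewrite /powR gt_eqF ?divr_gt0// (le_trans _ (expR_ge1Dx _))// lerD2l ler_pM2l//.
  have := @le_ln1Dx R (- n.+2%:R^-1); rewrite -succ_ratio -[X in ln X]invf_div lnV ?posrE ?divr_gt0//.
  by rewrite lerN2; apply; rewrite ltrN2 invf_lt1// ltr1n.
have -> : pw (s + 1) n.+1 = n.+2%:R^-1 * n.+2%:R `^ (- s).
  rewrite /pw opprD powRD ?powR_inv1 1?mulrC//.
  by rewrite pnatr_eq0 implybT.
have -> : pw s n = (n.+2%:R / n.+1%:R) `^ s * n.+2%:R `^ (- s).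
  rewrite powRM// ?invr_ge0//.
  rewrite mulrAC powRN mulfV ?mul1r; last by rewrite gt_eqF// powR_gt0.
  by rewrite -powR_inv1// -powRrM mulN1r.
rewrite mulrA ler_wpM2r ?powR_ge0// mulrDl mulfV ?gt_eqF//.
by rewrite addrC.
Qed.

Lemma sum_pw_le s n : 1 < s -> \sum_(k < n) pw s k <= s / (s - 1).
Proof.
move=> s1; have s0 : 0 < s - 1 by rewrite subr_gt0.
rewrite ler_pdivlMr//; case: n => [|n]; first by rewrite big_ord0 mul0r; lra.
suff : (\sum_(k < n.+1) pw s k) * (s - 1) <= s - pw (s - 1) n.
  by move/le_trans; apply; rewrite gerBl pw_ge0.
elim: n => [|n IH]; first by rewrite big_ord1 !pw0; lra.
rewrite big_ord_recr/= mulrDl (le_trans (lerD IH (lexx _)))//.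
by have := pw_telescope n s0; rewrite subrK; lra.
Qed.

(** Applied to [k tau_k] with exponent [s - 1], which may be close to 0: the sequence need not be
    summable, but its averages vanish. *)
Lemma pw_cesaro s e : 0 < s -> 0 < e ->
  exists N, forall n, (N <= n)%N -> \sum_(k < n.+1) pw s k <= e * n.+1%:R.
Proof.
move=> s0 e0; have e2 : 0 < e / 2 by lra.
have [N NP] := pw_small s0 e2.
exists (Num.trunc (N%:R / (e / 2))) => n Nn.
have le_n : N%:R <= e / 2 * n.+1%:R.
  by rewrite mulrC -ler_pdivrMr// (le_trans (ltW (truncnS_gt _)))// ler_nat.
have {Nn} : \sum_(k < n.+1) pw s k <= N%:R + e / 2 * n.+1%:R.
  elim: n.+1 => [|m IH]; first by rewrite big_ord0 mulr0 addr0.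
  have [Nm|mN] := leqP N m.
    rewrite big_ord_recr/= -[m.+1%:R]natr1.
    by have := NP _ Nm; lra.
  apply: (@le_trans _ _ (\sum_(k < m.+1) 1)).
    by apply: ler_sum => k _; rewrite pw_le1// ltW.
  rewrite sumr_const card_ord; apply: (@le_trans _ _ N%:R); first by rewrite ler_nat.
  by rewrite lerDl mulr_ge0// ltW.
lra.
Qed.

(* Either index of a product is at least half of the total. *)
Lemma cauchy_pw_le s A B Da Db a b n : 0 <= s -> 0 <= A -> 0 <= B ->
  (forall k, (k <= n)%N -> `|a k| <= A * pw s k) ->
  (forall k, (k <= n)%N -> `|b k| <= B * pw s k) ->
  \sum_(k < n.+1) `|a k| <= Da -> \sum_(k < n.+1) `|b k| <= Db ->
  `|(a * b) n| <= 2 `^ s * (A * Db + B * Da) * pw s n.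
Proof.
move=> s0 A0 B0 Ha Hb HDa HDb; rewrite fpsM (le_trans (ler_norm_sum _ _ _))//.
apply: (@le_trans _ _ (\sum_(i < n.+1)
    (2 `^ s * pw s n * A * `|b (n - i)%N| + 2 `^ s * pw s n * B * `|a i|))).
  apply: ler_sum => i _; have lei := leq_ord i.
  have c0 : 0 <= 2 `^ s * pw s n by rewrite mulr_ge0 ?powR_ge0 ?pw_ge0.
  rewrite normrM; have [h|h] := leqP n (i.*2).
    apply: (@le_trans _ _ (2 `^ s * pw s n * A * `|b (n - i)%N|)).
      rewrite ler_wpM2r// (le_trans (Ha _ lei))// [leRHS]mulrC ler_wpM2l//.
      by apply: pw_scale_nat => //; lia.
    by rewrite lerDl mulr_ge0 ?normr_ge0// mulr_ge0.
  apply: (@le_trans _ _ (2 `^ s * pw s n * B * `|a i|)).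
    rewrite mulrC ler_wpM2r// (le_trans (Hb _ (leq_subr _ _)))// [leRHS]mulrC ler_wpM2l//.
    by apply: pw_scale_nat => //; lia.
  by rewrite lerDr mulr_ge0// mulr_ge0.
rewrite big_split/= -!mulr_sumr.
have -> : \sum_(i < n.+1) `|b (n - i)%N| = \sum_(i < n.+1) `|b i|.
  by rewrite (reindex_inj rev_ord_inj)/=; apply: eq_bigr => i _; rewrite subSS subKn// leq_ord.
rewrite [leRHS](_ : _ = 2 `^ s * pw s n * A * Db + 2 `^ s * pw s n * B * Da); last by ring.
by rewrite lerD// ler_wpM2l// !mulr_ge0// ?powR_ge0 ?pw_ge0.
Qed.

Lemma sum_norm_pw_le s A a n : 1 < s -> 0 <= A -> (forall k, `|a k| <= A * pw s k) ->
  \sum_(k < n) `|a k| <= A * (s / (s - 1)).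
Proof.
move=> s1 A0 Ha; rewrite (le_trans (ler_sum _ (fun (k : 'I_n) _ => Ha k)))//.
by rewrite -mulr_sumr ler_wpM2l// sum_pw_le.
Qed.

Lemma cauchy_pw_stable s : 1 < s -> exists2 C, 0 < C & forall A B a b n,
  0 <= A -> 0 <= B ->
  (forall k, `|a k| <= A * pw s k) -> (forall k, `|b k| <= B * pw s k) ->
  `|(a * b) n| <= C * A * B * pw s n.
Proof.
move=> s1; have s0 : 0 < s / (s - 1) by rewrite divr_gt0; lra.
exists (2 * 2 `^ s * (s / (s - 1))); first by rewrite mulr_gt0// mulr_gt0// powR_gt0.
move=> A B a b n A0 B0 Ha Hb.
have := @cauchy_pw_le s A B (A * (s / (s - 1))) (B * (s / (s - 1))) a b n.
rewrite (_ : _ * _ * pw s n = 2 * 2 `^ s * (s / (s - 1)) * A * B * pw s n); last by ring.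
by apply => //; [lra|exact: sum_norm_pw_le|exact: sum_norm_pw_le].
Qed.

Lemma sum_norm_cauchy_le a b Da Db n :
  (forall m, \sum_(k < m) `|a k| <= Da) -> (forall m, \sum_(k < m) `|b k| <= Db) ->
  \sum_(k < n) `|(a * b) k| <= Da * Db.
Proof.
move=> Ha Hb; have Da0 : 0 <= Da by rewrite (le_trans _ (Ha 0%N))// big_ord0.
have Db0 : 0 <= Db by rewrite (le_trans _ (Hb 0%N))// big_ord0.
case: n => [|n]; first by rewrite big_ord0 mulr_ge0.
pose a' : fps R := fun k => `|a k|; pose b' : fps R := fun k => `|b k|.
apply: (@le_trans _ _ (\sum_(k < n.+1) (a' * b') k)).
  apply: ler_sum => k _; rewrite !fpsM (le_trans (ler_norm_sum _ _ _))//.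
  by apply: ler_sum => i _; rewrite normrM.
rewrite -fps_sum_ones -mulrA fpsM.
apply: (@le_trans _ _ (\sum_(i < n.+1) a' i * Db)).
  by apply: ler_sum => i _; rewrite ler_wpM2l ?normr_ge0// fps_sum_ones Hb.
by rewrite -mulr_suml ler_wpM2r// Ha.
Qed.

End PowerSequences.

(** * Polynomial decay of renewal differences *)

Section RenewalRate.
Context {R : realType}.
Variables (f u tau : fps R) (s A : R) (N : nat).
Hypothesis s1 : 1 < s.
Hypothesis f_ge0 : forall n, 0 <= f n.
Hypothesis f0 : f 0%N = 0.
Hypothesis tau_ge0 : forall n, 0 <= tau n.
Hypothesis tauE : forall n, tau n = 1 - \sum_(k < n) f k.+1.
Hypothesis tau_le : forall n, tau n <= A * pw s n.
Hypothesis fN : (0 < N)%N /\ 0 < f N /\ 0 < f N.+1.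
Hypothesis uE : (1 - f) * u = 1.

Let delta : fps R := (1 - fpsX) * u.

Lemma tail_delta : tau * delta = 1.
Proof. by rewrite /delta mulrCA (tail_renewal f0 tauE uE) fps_geometric. Qed.

Lemma euler_delta : fps_euler delta = - (fps_euler tau * (delta * delta)).
Proof.
have H : fps_euler tau * delta + tau * fps_euler delta = 0.
  rewrite -fps_eulerM tail_delta; apply/funext => n.
  by rewrite /fps_euler fps1; case: n => [|n]; rewrite ?mul0r ?mulr0.
have : delta * (fps_euler tau * delta + tau * fps_euler delta) = 0 by rewrite H mulr0.
rewrite mulrDr [delta * (tau * _)]mulrA (mulrC delta tau) tail_delta mul1r => /eqP.
by rewrite addrC addr_eq0 => /eqP ->; congr (- _); ring.
Qed.

Lemma delta_summable : exists2 D, 1 <= D & forall m, \sum_(k < m) `|delta k| <= D.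
Proof.
have s1' := s1; have A1 : 1 <= A by have := tau_le 0; rewrite tauE big_ord0 pw0; lra.
pose T := A * (s / (s - 1)).
have T0 : 0 < T by rewrite mulr_gt0 ?divr_gt0; lra.
have tauT n : \sum_(k < n) tau k <= T.
  rewrite (le_trans (ler_sum _ (fun (k : 'I_n) _ => tau_le k)))//.
  by rewrite -mulr_sumr ler_wpM2l ?sum_pw_le//; lra.
case: fN => N0 [fN0 fN1].
have K0 : 0 <= 2 * T ^+ 2 / (f N * f N.+1).
  apply: divr_ge0; first by rewrite mulr_ge0 ?sqr_ge0.
  by rewrite mulr_ge0 ?(ltW fN0) ?(ltW fN1).
have S := renewal_diff_summable f_ge0 f0 tau_ge0 tauE uE N0 fN0 fN1 T0 tauT.
exists (1 + 2 * T ^+ 2 / (f N * f N.+1)).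
  by rewrite lerDl.
case => [|m]; first by rewrite big_ord0 addr_ge0.
rewrite big_ord_recl lerD//.
  by rewrite /delta mulrBl mul1r fpsB fpsXM0 subr0 (renewal0 f0 uE) normr1.
rewrite (le_trans _ (S m))// ler_sum// => k _.
by rewrite /delta mulrBl mul1r fpsB lift0 fpsXMS.
Qed.

(** The sum expressing [n delta_n] is split at [k = n/2]. For larger [k], [k tau_k] is [O(n^(1-s))]
    and [delta * delta] is summable. For smaller [k], induction bounds [(delta * delta)_(n-k)], and
    the averages of [k tau_k] are small enough to absorb the constant. The term [k = 0], which would
    contain [delta n] itself, vanishes. *)
Theorem renewal_rate : exists2 C, 0 < C & forall n, `|((1 - fpsX) * u) n| <= C * pw s n.
Proof.
rewrite -/delta; have [D D1 HD] := delta_summable.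
have s1' := s1; have A1 : 1 <= A by have := tau_le 0; rewrite tauE big_ord0 pw0; lra.
have s0 : 0 <= s by lra.
have sm : 0 <= s - 1 by lra.
have c0 : 0 < 2 `^ s :> R by rewrite powR_gt0.
have [c cE] : exists c : R, c = 2 `^ s by eexists.
rewrite -cE in c0.
have [A0 D0 c0'] : [/\ 0 <= A, 0 <= D & 0 <= c] by split; [lra|lra|exact: ltW].
(* Chosen so that the part with small [k] contributes [B / 4]. *)
have e0 : 0 < (8 * A * c ^+ 2 * D)^-1.
  by rewrite invr_gt0 !mulr_gt0 ?exprn_gt0//; lra.
have [N0 HN0] := @pw_cesaro R (s - 1) _ (eqbRL (subr_gt0 _ _) s1) e0.
(* The first summand makes [A * c * D ^+ 2] at most [B / 4]; the second covers the indices up to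
   [N0], where only the bound [D] is used. *)
have [B BE] : exists B, B = 4 * A * c * D ^+ 2 + D / pw s N0 by eexists.
have B0 : 0 < B.
  by rewrite BE addr_gt0// ?divr_gt0 ?pw_gt0 ?mulr_gt0 ?exprn_gt0//; lra.
have B0' := ltW B0; exists B => // n; elim/ltn_ind: n => n IH.
have [nN|Nn] := leqP n N0.
  apply: (@le_trans _ _ D).
    apply: le_trans (HD n.+1); rewrite big_ord_recr/= lerDr.
    by apply: sumr_ge0 => k _; exact: normr_ge0.
  apply: (@le_trans _ _ (D / pw s N0 * pw s n)).
    by rewrite mulrAC ler_pdivlMr ?pw_gt0// ler_wpM2l ?pw_le//; lra.
  by rewrite ler_wpM2r ?pw_ge0// BE lerDr !mulr_ge0 ?sqr_ge0.
have n0 : (0 < n)%N by apply: leq_ltn_trans Nn.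
have [dd ddE] : exists dd, dd = delta * delta by eexists.
have dd_le m : (m < n)%N -> `|dd m| <= 2 * c * B * D * pw s m.
  move=> mn; have := @cauchy_pw_le R s B B D D delta delta m.
  rewrite -cE -ddE (_ : c * (B * D + B * D) = 2 * c * B * D); last by ring.
  by apply => // k km; rewrite IH//; exact: leq_ltn_trans mn.
have dd_sum m : \sum_(k < m) `|dd k| <= D ^+ 2.
  by rewrite expr2 ddE; exact: sum_norm_cauchy_le.
have E : n%:R * `|delta n| <= \sum_(k < n.+1)
    (A * c * pw (s - 1) n * `|dd (n - k)%N| + A * c ^+ 2 * 2 * B * D * pw s n * pw (s - 1) k).
  have := congr1 (fun a : fps R => a n) euler_delta.
  rewrite /= fpsN /fps_euler => /(congr1 (@Num.norm _ R)).
  rewrite normrM normr_nat normrN fpsM => ->.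
  rewrite (le_trans (ler_norm_sum _ _ _))//; apply: ler_sum => k _.
  rewrite -ddE !normrM normr_nat (ger0_norm (tau_ge0 _)).
  have R0 : 0 <= A * c * pw (s - 1) n * `|dd (n - k)%N|.
    by rewrite !mulr_ge0 ?pw_ge0 ?normr_ge0 ?sqr_ge0.
  have R1 : 0 <= A * c ^+ 2 * 2 * B * D * pw s n * pw (s - 1) k.
    by rewrite !mulr_ge0 ?pw_ge0 ?normr_ge0 ?sqr_ge0.
  have [k0|k0] := posnP k; first by rewrite [X in X%:R]k0 !mul0r addr_ge0.
  have kt : k%:R * tau k <= A * pw (s - 1) k.
    rewrite -pwS mulrCA (le_trans (ler_wpM2l _ (tau_le k)))//.
    by rewrite ler_wpM2r ?mulr_ge0 ?pw_ge0 ?ler_nat.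
  have [h|h] := leqP n k.*2.
    apply: (@le_trans _ _ (A * c * pw (s - 1) n * `|dd (n - k)%N|)); last by rewrite lerDl.
    rewrite ler_wpM2r// (le_trans kt)// -[leRHS]mulrA ler_wpM2l//.
    rewrite (le_trans (pw_half sm h))//.
    rewrite ler_wpM2r ?pw_ge0// cE; apply: ler_powR; first by rewrite ler1n.
    by rewrite gerBl.
  apply: (@le_trans _ _ (A * c ^+ 2 * 2 * B * D * pw s n * pw (s - 1) k)); last by rewrite lerDr.
  have dk : `|dd (n - k)%N| <= 2 * c * B * D * (c * pw s n).
    rewrite (le_trans (dd_le _ _)) ?ltn_subrL ?k0//.
    rewrite ler_wpM2l ?mulr_ge0//.
    by rewrite cE pw_half_sub.
  rewrite (le_trans (ler_pM _ _ kt dk))//; first by rewrite mulr_ge0.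
  by rewrite le_eqVlt; apply/orP; left; apply/eqP; ring.
rewrite big_split/= -!mulr_sumr in E.
have E2 : \sum_(i < n.+1) `|dd (n - i)%N| <= D ^+ 2.
  rewrite (le_trans _ (dd_sum n.+1))// le_eqVlt; apply/orP; left; apply/eqP.
  by rewrite [RHS](reindex_inj rev_ord_inj)/=; apply: eq_bigr => i _; rewrite subSS.
have n1 : 0 < n%:R :> R by rewrite ltr0n.
rewrite -(ler_pM2l n1) (le_trans E)//.
apply: (@le_trans _ _ (A * c * pw (s - 1) n * D ^+ 2 + A * c ^+ 2 * 2 * B * D * pw s n *
   ((8 * A * c ^+ 2 * D)^-1 * n.+1%:R))).
  apply: lerD.
    by rewrite ler_wpM2l// !mulr_ge0 ?pw_ge0.
  move: (HN0 n (ltnW Nn)); apply: ler_wpM2l.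
  by rewrite !mulr_ge0 ?pw_ge0 ?sqr_ge0.
rewrite -pwS (_ : _ + _ = n.+1%:R * (A * c * D ^+ 2 + B / 4) * pw s n); last first.
  have [cn An Dn] : [/\ c != 0, A != 0 & D != 0].
    by split; rewrite gt_eqF// (lt_le_trans ltr01).
  by field; rewrite ?cn ?An ?Dn.
rewrite [leRHS]mulrA ler_wpM2r ?pw_ge0//.
have B4 : A * c * D ^+ 2 <= B / 4.
  rewrite ler_pdivlMr// BE (_ : A * c * D ^+ 2 * 4 = 4 * A * c * D ^+ 2); last by ring.
  by rewrite lerDl divr_ge0 ?pw_ge0.
(* The two parts use [B / 4] each; the remaining factor 2 pays for [n.+1 <= 2 * n]. *)
apply: (@le_trans _ _ (2 * n%:R * (B / 4 + B / 4))); last by lra.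
apply: ler_pM => //; last by rewrite lerD2r.
- apply: addr_ge0; last by rewrite divr_ge0.
  by rewrite !mulr_ge0 ?sqr_ge0.
- by rewrite -natrM ler_nat mul2n -addnn -addn1 leq_add2l.
Qed.

End RenewalRate.

(** The least positive difference [d] of two elements of [G] divides every [n] in [S]: otherwise,
    with [q = n %/ d], the elements [q * y + n] and [q * (y + d)] differ by the smaller number
    [n %% d]. Hence [d = 1]. *)
Lemma semigroup_consecutive (S G : nat -> Prop) :
  (exists2 n, S n & (0 < n)%N) -> (forall n, S n -> G n) ->
  (forall m n, G m -> G n -> G (m + n)%N) ->
  (forall e, (forall n, S n -> (e %| n)%N) -> (e %| 1)%N) ->
  exists N, G N /\ G N.+1.
Proof.
move=> [n0 Sn0 n0_gt0] SG GD Sgcd.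
have GM m q : G m -> (0 < q)%N -> G (q * m)%N.
  move=> Gm; elim: q => // -[|q] IH _; first by rewrite mul1n.
  by rewrite mulSn; apply: GD => //; exact: IH.
pose gap d := `[< (0 < d)%N /\ exists y, G y /\ G (y + d)%N >].
have gap_ex : exists d, gap d.
  exists n0; apply/asboolP; split => //; exists n0; split; first exact: SG.
  by apply: GD; exact: SG.
case: (ex_minnP gap_ex) => d /asboolP[d0 [y [Gy Gyd]]] dmin.
have d1 : (d %| 1)%N.
  apply: Sgcd => n Sn; apply/negPn/negP => nd.
  have r0 : (0 < n %% d)%N by rewrite lt0n.
  have q0 : (0 < n %/ d)%N.
    rewrite divn_gt0//; have n_gt0 : (0 < n)%N by case: n nd Sn {r0} => //; rewrite dvdn0.
    by apply: dmin; apply/asboolP; split => //; exists n; split; [exact: SG|apply: GD; exact: SG].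
  have : gap (n %% d)%N.
    apply/asboolP; split => //; exists (n %/ d * (y + d))%N; split; first exact: GM.
    have -> : (n %/ d * (y + d) + n %% d = n %/ d * y + n)%N.
      by rewrite mulnDr -addnA -divn_eq.
    by apply: GD; [exact: GM|exact: SG].
  by move=> /dmin; rewrite leqNgt ltn_mod d0.
by exists y; split => //; move: d1 Gyd; rewrite dvdn1 => /eqP ->; rewrite addn1.
Qed.

(** Supplies for [tau_tail] an integer comparable with [x] yet strictly below every positive integer
    [j >= x]; the factor 2 absorbs the rounding. *)
Lemma half_trunc (R : realType) (x : R) : 0 <= x ->
  exists n : nat, x <= 2 * n.+1%:R /\ forall j, (0 < j)%N -> x <= j%:R -> (n < j)%N.
Proof.
move=> x0; have le (t : nat) : (t.+1 <= t.-1.+1 * 2)%N by lia.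
have lt (t j : nat) : (t <= j)%N -> (0 < j)%N -> (t.-1 < j)%N by lia.
exists (Num.trunc x).-1; split.
  by rewrite mulrC -natrM (le_trans (ltW (truncnS_gt _)))// ler_nat.
move=> j j0 xj; apply: lt => //; rewrite -ltnS truncn_lt_nat//.
by rewrite (le_lt_trans xj)// ltr_nat.
Qed.

(** * Partial sums of powers and differences of squared tail series *)

Section PowerSums.
Context {R : realType}.
Implicit Types (s : R).

Definition psum s n := \sum_(i < n.+1) pw s i.

Lemma psum_ge0 s n : 0 <= psum s n.
Proof. by apply: sumr_ge0 => i _; exact: pw_ge0. Qed.

Lemma psum_le s m n : (m <= n)%N -> psum s m <= psum s n.
Proof.
move=> mn; rewrite /psum -!(big_mkord xpredT (pw s)) [leRHS](big_cat_nat (n := m.+1))//=.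
by rewrite lerDl; apply: sumr_ge0 => i _; exact: pw_ge0.
Qed.

Lemma psum_ge s n : 0 <= s -> n.+1%:R * pw s n <= psum s n.
Proof.
move=> s0; rewrite /psum mulr_natl -[X in _ *+ X]card_ord -sumr_const.
by apply: ler_sum => i _; rewrite pw_le// leq_ord.
Qed.

Lemma sum_pw_tail s m n : 1 < s -> \sum_(m <= j < n) pw s j <= s / (s - 1) * pw (s - 1) m.
Proof.
move=> s1; have s0 : 0 < s - 1 by lra.
have P k : 0 <= pw (s - 1) k by exact: pw_ge0.
have C0 : 0 <= s / (s - 1) by rewrite divr_ge0; lra.
have key k : (\sum_(j < k.+1) pw s (m + j)%N) * (s - 1) + pw (s - 1) (m + k)%N <= s * pw (s - 1) m.
  elim: k => [|k IH].
    rewrite big_ord1 addn0.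
    have H : pw s m <= pw (s - 1) m by rewrite -pwS ler_peMl ?pw_ge0// ler1n.
    have := ler_wpM2r (ltW s0) H; lra.
  rewrite big_ord_recr/= mulrDl; have := pw_telescope (m + k)%N s0.
  by rewrite subrK; move: IH; rewrite !addnS; lra.
have [nm|mn] := leqP n m; first by rewrite big_geq// mulr_ge0.
have -> : \sum_(m <= j < n) pw s j = \sum_(j < (n - m).-1.+1) pw s (m + j)%N.
  rewrite prednK ?subn_gt0// -{1}[m]add0n big_addn big_mkord.
  by apply: eq_bigr => j _; rewrite addnC.
rewrite mulrAC ler_pdivlMr// (le_trans _ (key (n - m).-1))//.
by rewrite lerDl.
Qed.

(** Young's inequality for [t^a] and 1 with conjugate exponents [1/a] and [1/(1-a)]. *)
Lemma tangent_powR (t a : R) : 0 <= t -> 0 < a < 1 -> t `^ a <= 1 + a * (t - 1).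
Proof.
move=> t0 /andP[a0 a1].
have := @conjugate_powR R (t `^ a) 1 a^-1 (1 - a)^-1 (powR_ge0 _ _) ler01.
rewrite !invr_gt0 subr_gt0 !invrK mulr1 powR1 -powRrM mulfV ?gt_eqF// powRr1// mul1r.
by move=> /(_ a0 a1); rewrite addrC subrK => /(_ erefl); lra.
Qed.

Lemma psum_lt1_le s n : 0 < s < 1 -> psum s n <= (1 - s)^-1 * n.+1%:R `^ (1 - s).
Proof.
move=> /andP[s0 s1]; have a01 : 0 < 1 - s < 1 by apply/andP; split; lra.
rewrite -ler_pdivrMl ?invr_gt0 ?invrK; last by lra.
elim: n => [|n IH]; first by rewrite /psum big_ord1 pw0 powR1; lra.
rewrite /psum big_ord_recr/= mulrDr (le_trans (lerD IH (lexx _)))//.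
have m0 : 0 < n.+1%:R :> R by rewrite ltr0n.
have m1 : 0 < n.+2%:R :> R by rewrite ltr0n.
have := @tangent_powR (n.+1%:R / n.+2%:R) (1 - s) (divr_ge0 (ltW m0) (ltW m1)) a01.
have -> : n.+1%:R / n.+2%:R - 1 = - n.+2%:R^-1 :> R.
  by rewrite succ_ratio; ring.
have P0 : 0 < n.+2%:R `^ (1 - s) by rewrite powR_gt0.
rewrite -(ler_pM2r P0) -powRM ?divr_ge0// divfK ?gt_eqF// => H.
have -> : pw s n.+1 = n.+2%:R^-1 * n.+2%:R `^ (1 - s).
  by rewrite -[1 - s]opprB -/(pw (s - 1) n.+1) -pwS mulKf// gt_eqF.
by rewrite (le_trans (lerD H (lexx _)))// le_eqVlt; apply/orP; left; apply/eqP; ring.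
Qed.

Lemma psum1_le n : psum 1 n <= 1 + ln n.+1%:R.
Proof.
elim: n => [|n IH]; first by rewrite /psum big_ord1 pw0 ln1 addr0.
rewrite /psum big_ord_recr/= (le_trans (lerD IH (lexx _)))// -addrA lerD2l.
have m0 : 0 < n.+1%:R :> R by rewrite ltr0n.
have m1 : 0 < n.+2%:R :> R by rewrite ltr0n.
have := @le_ln1Dx R (- n.+2%:R^-1).
rewrite -succ_ratio lnM ?posrE ?invr_gt0// lnV ?posrE// => H.
have {H} := H _; rewrite ltrN2 invf_lt1// ltr1n => /(_ isT).
by rewrite /pw powR_inv1 ?ler0n//; set x := n.+2%:R^-1; lra.
Qed.

(** Origin of the three cases of [zeta]: the sum of [(k+1)^(1-beta)] is bounded, logarithmic or of
    order [n^(2-beta)]. The extra [pw beta n] is essential at [beta = 2], [n = 1], where [zeta] is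
    0. *)
Lemma psum_zeta beta : 1 < beta -> exists2 C, 0 < C & forall n, (1 <= n)%N ->
  pw beta n * psum (beta - 1) n <= C * (zeta beta n + pw beta n).
Proof.
move=> b1; have b0 : 0 <= beta by lra.
have nn n : (1 <= n)%N -> 0 < n%:R :> R by rewrite ltr0n.
have pw_n n s : (1 <= n)%N -> 0 <= s -> pw s n <= n%:R `^ (- s).
  move=> n1 s0; rewrite /pw !powRN lef_pV2 ?posrE ?powR_gt0 ?nn//.
  by rewrite ge0_ler_powR ?nnegrE ?ler0n// ler_nat.
have [b2|b2] := ltP 2 beta.
  exists ((beta - 1) / (beta - 2)); first by rewrite divr_gt0; lra.
  move=> n n1; rewrite /zeta b2; have P := pw_ge0 beta n; have := @sum_pw_le _ (beta - 1) n.+1 (ltac:(lra)).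
  rewrite -/(psum _ _) -addrA -opprD => /(ler_wpM2l P) /le_trans; apply.
  rewrite mulrC ler_wpM2l ?lerDr ?powR_ge0// divr_ge0; lra.
have b2n : (2 < beta) = false by apply/negbTE; rewrite -leNgt.
have [b2'|/eqP b2'] := eqVneq beta 2.
  exists 2 => // n n1; rewrite /zeta b2' ltxx eqxx; have P := @pw_ge0 R 2 n.
  have -> : (2 - 1 : R) = 1 by lra.
  have := psum1_le n => /(ler_wpM2l P) /le_trans; apply.
  have n0 := nn _ n1; have l0 : 0 <= ln n%:R :> R by rewrite ln_ge0// ler1n.
  have ln2 : ln n.+1%:R <= 1 + ln n%:R :> R.
    have -> : n.+1%:R = n%:R * (1 + n%:R^-1) :> R by rewrite mulrDr mulr1 mulfV ?gt_eqF// natr1.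
    have n1' : 0 < n%:R^-1 :> R by rewrite invr_gt0.
    rewrite lnM ?posrE ?addr_gt0// addrC lerD2r (le_trans (le_ln1Dx _))//; first by lra.
    by rewrite invf_le1// ler1n.
  have : pw 2 n <= (n%:R ^+ 2)^-1 :> R.
    by rewrite (le_trans (pw_n n 2 n1 _))// powRN powR_mulrn// ltW.
  move=> /(ler_wpM2r l0) H; have := ler_wpM2l P ln2.
  have x0 : 0 <= (n%:R ^+ 2)^-1 :> R by rewrite invr_ge0 exprn_ge0// ltW.
  move: H x0; set x := (n%:R ^+ 2)^-1; set l := ln n%:R; set l1 := ln n.+1%:R => H x0 H1.
  have := mulr_ge0 l0 x0; rewrite -/l => H2.
  by rewrite mulrDr mulr1 mulrDr (le_trans (lerD (lexx _) H1))//; move: H H2; rewrite mulrDr mulr1 [x * l]mulrC; lra.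
exists (2 - beta)^-1; first by rewrite invr_gt0; move/eqP in b2'; rewrite subr_gt0 lt_neqAle b2' b2.
have b2s : beta < 2 by move/eqP in b2'; rewrite lt_neqAle b2' b2.
move=> n n1; rewrite /zeta b2n (negbTE (introN eqP b2')); have P := pw_ge0 beta n.
have := @psum_lt1_le (beta - 1) n; rewrite (_ : 1 - (beta - 1) = 2 - beta); last by ring.
move=> /(_ (ltac:(apply/andP; split; lra))) /(ler_wpM2l P) /le_trans; apply.
have K0 : 0 <= (2 - beta)^-1 by rewrite invr_ge0; lra.
rewrite mulrCA ler_wpM2l//.
have -> : pw beta n * n.+1%:R `^ (2 - beta) = pw (2 * (beta - 1)) n.
  rewrite /pw -powRD; last by rewrite pnatr_eq0 implybT.
  by congr (_ `^ _); ring.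
by rewrite (le_trans (pw_n _ _ n1 _)) ?lerDl//; lra.
Qed.

(** In [(1 - x) b^2 = b_0 b - x p b] both terms are in general only [O(n^(1-beta))]. Since the
    partial sums of [p] are [b_0 - b_(n+1)], the leading parts cancel and leave the products
    [p_i (b_(n-i) - b_(n+1))] and a square. *)
Lemma diff_sq_bound beta A (p b : fps R) : 1 < beta -> 0 <= A ->
  (forall n, 0 <= p n <= A * pw beta n) -> (forall n, b n - b n.+1 = p n) ->
  (forall n, 0 <= b n <= A * pw (beta - 1) n) ->
  exists2 C, 0 < C & forall n, `|((1 - fpsX) * (b * b)) n| <= C * (pw beta n * psum (beta - 1) n).
Proof.
move=> b1 A0 p_le bp b_le; have s0 : 0 <= beta - 1 by lra.
have be0 : 0 <= beta by lra.
pose c : R := 2 `^ beta; have c0 : 0 <= c by exact: powR_ge0.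
have cE : 2 `^ beta = c by [].
exists (1 + A ^+ 2 + 2 * A ^+ 2 * c).
  by rewrite -addrA ltr_pwDl// addr_ge0 ?sqr_ge0 ?mulr_ge0// sqr_ge0.
have bS m k : b m - b (m + k)%N = \sum_(j < k) p (m + j)%N.
  elim: k => [|k IH]; first by rewrite addn0 subrr big_ord0.
  by rewrite big_ord_recr/= -IH addnS -bp; ring.
have sq n : b n ^+ 2 <= A ^+ 2 * (pw beta n * psum (beta - 1) n).
  have /andP[bn0 bn] := b_le n.
  rewrite (le_trans (ler_pM bn0 bn0 bn bn))// -expr2 exprMn ler_wpM2l ?sqr_ge0//.
  have := psum_ge n s0 => /(ler_wpM2l (pw_ge0 beta n)); apply: le_trans.
  by rewrite mulrCA mulrA pwS -expr2.
case=> [|n].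
  rewrite mulrBl mul1r fpsB fpsXM0 subr0 fpsM big_ord1 subn0 ger0_norm -expr2 ?sqr_ge0//.
  have X0 : 0 <= pw beta 0 * psum (beta - 1) 0 by rewrite mulr_ge0 ?pw_ge0 ?psum_ge0.
  rewrite (le_trans (sq 0%N))// ler_wpM2r//.
  by have := mulr_ge0 (sqr_ge0 A) c0; lra.
have key : ((1 - fpsX) * (b * b)) n.+1 =
    b n.+1 ^+ 2 - \sum_(i < n.+1) p i * (b (n - i)%N - b n.+1).
  have -> : (1 - fpsX) * (b * b) = fpsC (b 0%N) * b - fpsX * p * b.
    rewrite mulrA; have -> : (1 - fpsX) * b = fpsC (b 0%N) - fpsX * p.
      apply/funext => -[|m]; rewrite mulrBl mul1r !fpsB.
        by rewrite !fpsXM0.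
      by rewrite !fpsXMS -bp /fpsC/=; ring.
    by rewrite mulrBl.
  rewrite fpsB fpsCM -mulrA fpsXMS fpsM.
  under [X in _ = _ - X]eq_bigr do rewrite mulrBr.
  rewrite big_split/= sumrN -mulr_suml.
  have := bS 0%N n.+1; rewrite add0n => E.
  have -> : \sum_(i < n.+1) p i = b 0%N - b n.+1 by rewrite E.
  ring.
pose q := pw beta n.+1; pose L := psum (beta - 1) n.+1.
have q0 : 0 <= q by exact: pw_ge0.
have [D DE] : exists D, D = A ^+ 2 * (c * q) by eexists.
have D0 : 0 <= D by rewrite DE !mulr_ge0 ?sqr_ge0.
have term i : (i <= n)%N -> `|p i * (b (n - i)%N - b n.+1)| <=
    D * pw (beta - 1) i + D * pw (beta - 1) (n - i)%N.
  move=> ile; have /andP[pi0 pi] := p_le i.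
  have db : b (n - i)%N - b n.+1 = \sum_(j < i.+1) p (n - i + j)%N.
    by rewrite -bS addnS subnK.
  have db0 : 0 <= b (n - i)%N - b n.+1.
    by rewrite db; apply: sumr_ge0 => j _; have /andP[] := p_le (n - i + j)%N.
  rewrite ger0_norm ?mulr_ge0//.
  have T1 : 0 <= D * pw (beta - 1) i by rewrite mulr_ge0 ?pw_ge0.
  have T2 : 0 <= D * pw (beta - 1) (n - i)%N by rewrite mulr_ge0 ?pw_ge0.
  (* For small [i] the increment of [b] is a sum of [i + 1] values of [p] at indices comparable with
     [n]; for large [i] it is [p i] that is [O(n^-beta)]. *)
  have [h|h] := leqP (i.+1 * 2) n.+1.
    apply: (@le_trans _ _ (D * pw (beta - 1) i)); last by rewrite lerDl.
    have H : b (n - i)%N - b n.+1 <= (A * (c * q)) *+ i.+1.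
      rewrite db -[X in _ *+ X]card_ord -sumr_const; apply: ler_sum => j _.
      have /andP[_ pj] := p_le (n - i + j)%N; rewrite (le_trans pj)// ler_wpM2l//.
      rewrite (le_trans (pw_le (n := n - i + j) be0 (leq_addr j (n - i))))//.
      by rewrite /q -cE; apply: pw_scale_nat => //; move: h ile; clear; lia.
    rewrite (le_trans (ler_pM pi0 db0 pi H))// DE -pwS -mulr_natl le_eqVlt; apply/orP; left; apply/eqP; ring.
  apply: (@le_trans _ _ (D * pw (beta - 1) (n - i)%N)); last by rewrite lerDr.
  have H1 : p i <= A * (c * q).
    rewrite (le_trans pi)// ler_wpM2l// /q -cE; apply: pw_scale_nat => //.
    by move: h; clear; lia.
  have H2 : b (n - i)%N - b n.+1 <= A * pw (beta - 1) (n - i)%N.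
    have /andP[_ h1] := b_le (n - i)%N; have /andP[h2 _] := b_le n.+1.
    by rewrite (le_trans _ h1)// gerBl.
  rewrite (le_trans (ler_pM pi0 db0 H1 H2))// DE le_eqVlt; apply/orP; left; apply/eqP; ring.
have sumL : \sum_(i < n.+1) pw (beta - 1) i <= L.
  by rewrite /L /psum [leRHS]big_ord_recr/= lerDl pw_ge0.
rewrite key (le_trans (ler_normB _ _))// (ger0_norm (sqr_ge0 _)).
have S : `|\sum_(i < n.+1) p i * (b (n - i)%N - b n.+1)| <= D * L + D * L.
  rewrite (le_trans (ler_norm_sum _ _ _))//.
  apply: (@le_trans _ _ (\sum_(i < n.+1) (D * pw (beta - 1) i + D * pw (beta - 1) (n - i)%N))).
    by apply: ler_sum => i _; apply: term; exact: leq_ord.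
  rewrite big_split/= -!mulr_sumr.
  have -> : \sum_(i < n.+1) pw (beta - 1) (n - i)%N = \sum_(i < n.+1) pw (beta - 1) i.
    by rewrite (reindex_inj rev_ord_inj)/=; apply: eq_bigr => i _; rewrite subSS subKn// leq_ord.
  by rewrite lerD// ler_wpM2l.
rewrite (le_trans (lerD (sq n.+1) S))// -/q -/L.
have qL : 0 <= q * L by rewrite mulr_ge0// psum_ge0.
have -> : A ^+ 2 * (q * L) + (D * L + D * L) = (A ^+ 2 + 2 * A ^+ 2 * c) * (q * L) by rewrite DE; ring.
by rewrite ler_wpM2r// -addrA lerDr.
Qed.

End PowerSums.

(* With [phi] the return time, [p n = P(phi > n)] and [b n = E (phi - n)^+], the
   hypothesis on [wbar] is the expansion of an observable into last visits to the base. *)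
Section BaseRate.
Context {R : realType}.
Variables (beta A : R) (p b s : fps R).
Hypothesis b1 : 1 < beta.
Hypothesis A0 : 0 <= A.
Hypothesis p_le : forall n, 0 <= p n <= A * pw beta n.
Hypothesis bp : forall n, b n - b n.+1 = p n.
Hypothesis b_le : forall n, 0 <= b n <= A * pw (beta - 1) n.
Hypothesis b0 : 0 < b 0%N.
Hypothesis s_ge0 : forall n, 0 <= s n.
Hypothesis s0 : 1 <= s 0%N.

(* The sequence gamma of the statement, with [(n + 1)^-beta] for [n^-beta]. *)
Definition gam : fps R := pw beta * s.

Lemma gam_ge0 n : 0 <= gam n.
Proof. by rewrite /gam fpsM; apply: sumr_ge0 => i _; rewrite mulr_ge0 ?pw_ge0. Qed.

Lemma pw_le_gam n : pw beta n <= gam n.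
Proof.
rewrite /gam fpsM big_ord_recr/= subnn (@le_trans _ _ (pw beta n * s 0%N))//.
  by rewrite ler_peMr ?pw_ge0.
by rewrite lerDr sumr_ge0// => i _; rewrite mulr_ge0 ?pw_ge0.
Qed.

Lemma s_le_gam n : s n <= gam n.
Proof.
rewrite /gam fpsM big_ord_recl subn0 pw0 mul1r lerDl sumr_ge0// => i _.
by rewrite mulr_ge0 ?pw_ge0.
Qed.

Lemma fpsM_norm_le (x y x' y' : fps R) n : (forall k, `|x k| <= x' k) -> (forall k, `|y k| <= y' k) ->
  `|(x * y) n| <= (x' * y') n.
Proof.
move=> xx yy; rewrite !fpsM (le_trans (ler_norm_sum _ _ _))//; apply: ler_sum => i _.
by rewrite normrM ler_pM.
Qed.

Lemma conv_s_gam X (x y : fps R) B n : 0 <= X -> 0 <= B -> (forall k, `|x k| <= X * pw beta k) ->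
  (forall k, `|y k| <= B * s k) -> `|(x * y) n| <= X * B * gam n.
Proof.
move=> X0 B0 Hx Hy.
rewrite (le_trans (fpsM_norm_le (x' := fpsC X * pw beta) (y' := fpsC B * s) n _ _))//.
- by move=> k; rewrite fpsCM.
- by move=> k; rewrite fpsCM.
by rewrite mulrACA -mulrA !fpsCM mulrA.
Qed.

(** As [gam = pw beta * s], this reduces to the stability of [O(pw beta)] under convolution. *)
Lemma pw_gam_le : exists2 C, 0 < C & forall X B (x y : fps R) n, 0 <= X -> 0 <= B ->
  (forall k, `|x k| <= X * pw beta k) -> (forall k, `|y k| <= B * gam k) ->
  `|(x * y) n| <= C * X * B * gam n.
Proof.
have [C C0 HC] := @cauchy_pw_stable R beta b1; exists C => // X B x y n X0 B0 Hx Hy.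
rewrite (le_trans (fpsM_norm_le (x' := fpsC X * pw beta) (y' := fpsC B * gam) n _ _))//.
- by move=> k; rewrite fpsCM.
- by move=> k; rewrite fpsCM.
have -> : fpsC X * pw beta * (fpsC B * gam) = fpsC X * (fpsC B * ((pw beta * pw beta) * s)).
  by rewrite /gam; ring.
rewrite !fpsCM [leRHS](_ : _ = X * (B * (C * gam n))); last by ring.
rewrite ler_wpM2l// ler_wpM2l// (le_trans (ler_norm _))//.
rewrite (le_trans (fpsM_norm_le (x' := fpsC C * pw beta) (y' := s) n _ _))//.
- move=> k; rewrite fpsCM; have := HC 1 1 (pw beta) (pw beta) k ler01 ler01.
  by rewrite !mulr1; apply => j; rewrite mul1r ger0_norm ?pw_ge0.
- by move=> k; rewrite ger0_norm.
by rewrite -mulrA fpsCM.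
Qed.

(** The partial sums [psum] increase, so they can be evaluated at [n] before convolving. *)
Lemma qL_conv : exists2 C, 0 < C & forall X B (x y : fps R) n, 0 <= X -> 0 <= B ->
  (forall k, `|x k| <= X * (pw beta k * psum (beta - 1) k)) -> (forall k, `|y k| <= B * pw beta k) ->
  `|(x * y) n| <= C * X * B * (pw beta n * psum (beta - 1) n).
Proof.
have [C C0 HC] := @cauchy_pw_stable R beta b1; exists C => // X B x y n X0 B0 Hx Hy.
have L0 := @psum_ge0 R (beta - 1) n.
apply: (@le_trans _ _ (X * B * psum (beta - 1) n * (pw beta * pw beta) n)).
  rewrite fpsM (le_trans (ler_norm_sum _ _ _))// fpsM mulr_sumr; apply: ler_sum => i _.
  rewrite normrM (le_trans (ler_pM _ _ (Hx i) (Hy (n - i)%N)))//.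
  rewrite [leLHS](_ : _ = X * B * (pw beta i * pw beta (n - i)%N) * psum (beta - 1) i); last by ring.
  rewrite [leRHS](_ : _ = X * B * (pw beta i * pw beta (n - i)%N) * psum (beta - 1) n); last by ring.
  by rewrite ler_wpM2l ?psum_le ?leq_ord// !mulr_ge0 ?pw_ge0.
rewrite [leRHS](_ : _ = X * B * psum (beta - 1) n * (C * pw beta n)); last by ring.
rewrite ler_wpM2l ?mulr_ge0// (le_trans (ler_norm _))//.
have := HC 1 1 (pw beta) (pw beta) n ler01 ler01.
by rewrite !mulr1; apply => j; rewrite mul1r ger0_norm ?pw_ge0.
Qed.

(** The equation determines [K] up to [b * ((1 - x) K)], which still contains the second-order term.
    Multiplying the equation by [(1 - x) b] expresses that product through [wbar * b], the
    differences of the coefficients of [b^2], and errors; substituting back gives the expansion. *)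
Lemma base_rate C1 C2 : 0 <= C1 -> 0 <= C2 -> exists2 C, 0 < C & forall (K : fps R) B wbar, 0 <= B ->
  (forall n, `|((1 - fpsX) * K) n| <= C1 * B * pw beta n) ->
  (forall n, `|wbar - b 0%N * K n + (b * ((1 - fpsX) * K)) n| <= C2 * B * gam n) ->
  `|wbar| <= b 0%N * B -> forall n,
  `|K n - wbar / b 0%N * (1 + b n.+1 / b 0%N)| <= C * B * (gam n + pw beta n * psum (beta - 1) n).
Proof.
move=> C10 C20; have b00 := ltW b0.
have [Cd Cd0 HCd] := diff_sq_bound b1 A0 p_le bp b_le.
have [Cg Cg0 HCg] := pw_gam_le.
have [Cq Cq0 HCq] := qL_conv.
pose P := b 0%N.
have P0 : 0 < P by [].
pose A' := P + A * 2 `^ beta.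
have c0 : 0 <= 2 `^ beta :> R by exact: powR_ge0.
have A'0 : 0 <= A' by rewrite addr_ge0 ?mulr_ge0.
have db n : `|((1 - fpsX) * b) n| <= A' * pw beta n.
  rewrite mulrBl mul1r fpsB; case: n => [|n].
    by rewrite fpsXM0 subr0 ger0_norm// pw0 mulr1 lerDl mulr_ge0.
  have /andP[pn0 pn] := p_le n.
  rewrite fpsXMS -opprB normrN bp ger0_norm// (le_trans pn)// mulrDl.
  apply: (@le_trans _ _ (A * 2 `^ beta * pw beta n.+1)).
    rewrite -mulrA ler_wpM2l//; apply: pw_scale_nat => //; first by have := b1; lra.
    by clear; lia.
  by rewrite lerDr mulr_ge0 ?pw_ge0// ltW.
pose C := 1 + (C2 / P + A / P + Cq * Cd * C1 / P ^+ 2 + Cg * A' * C2 / P ^+ 2).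
have Cp : 0 <= C2 / P + A / P + Cq * Cd * C1 / P ^+ 2 + Cg * A' * C2 / P ^+ 2.
  by rewrite !addr_ge0 ?divr_ge0 ?mulr_ge0 ?sqr_ge0 ?(ltW P0) ?(ltW Cq0) ?(ltW Cd0) ?(ltW Cg0).
exists C; first by rewrite ltr_pwDl.
move=> K B wbar B0 HK Hw wb n.
pose kap := (1 - fpsX) * K; pose g : fps R := fun n => wbar - P * K n + (b * kap) n.
pose bb := (1 - fpsX) * (b * b).
have gE : g = fpsC wbar * fps_ones - fpsC P * K + b * kap.
  by apply/funext => k; rewrite fpsD fpsB !fpsCM /fps_ones mulr1.
have main : fpsC P * (b * kap) = fpsC wbar * b + bb * kap - (1 - fpsX) * b * g.
  rewrite gE /bb; have -> : (1 - fpsX) * b * (fpsC wbar * fps_ones - fpsC P * K + b * kap) =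
    fpsC wbar * b * ((1 - fpsX) * fps_ones) - fpsC P * (b * kap) + (1 - fpsX) * (b * b) * kap.
    by rewrite /kap; ring.
  by rewrite fps_geometric; ring.
have mainn : P * (b * kap) n = wbar * b n + (bb * kap) n - ((1 - fpsX) * b * g) n.
  by have := congr1 (fun a : fps R => a n) main; rewrite /= fpsB fpsD !fpsCM.
have Kn : P * K n = wbar + (b * kap) n - g n by rewrite /g; ring.
(* The computation produces [b n]; the statement has [b n.+1], and the difference [p n] is within
   the error. *)
have E : K n - wbar / P * (1 + b n.+1 / P) =
   (bb * kap) n / P ^+ 2 - ((1 - fpsX) * b * g) n / P ^+ 2 - g n / P + wbar / P * (p n / P).
  have -> : K n = P^-1 * (P * K n) by rewrite mulKf// gt_eqF.
  have bk : (b * kap) n = P^-1 * (P * (b * kap) n) by rewrite mulKf// gt_eqF.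
  by rewrite Kn bk mainn -bp; field; rewrite gt_eqF.
have U1 : `|(bb * kap) n| <= Cq * Cd * (C1 * B) * (pw beta n * psum (beta - 1) n).
  by apply: HCq => //; [exact: ltW|rewrite mulr_ge0].
have U2 : `|((1 - fpsX) * b * g) n| <= Cg * A' * (C2 * B) * gam n.
  by apply: HCg => //; rewrite mulr_ge0.
have U3 : `|g n| <= C2 * B * gam n by exact: Hw.
have /andP[pn0 pn] := p_le n.
have U4 : `|wbar / P * (p n / P)| <= A / P * B * gam n.
  have Pi : 0 <= P^-1 by rewrite invr_ge0 ltW.
  rewrite !normrM (ger0_norm pn0) (ger0_norm Pi).
  apply: (@le_trans _ _ (B * (A * gam n / P))).
    apply: ler_pM => //; [by rewrite mulr_ge0|by rewrite mulr_ge0|by rewrite ler_pdivrMr// mulrC|].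
    by rewrite ler_wpM2r// (le_trans pn)// ler_wpM2l// pw_le_gam.
  by rewrite le_eqVlt; apply/orP; left; apply/eqP; ring.
have G0 := gam_ge0 n; have Q0 : 0 <= pw beta n * psum (beta - 1) n by rewrite mulr_ge0 ?pw_ge0 ?psum_ge0.
have Pi2 : 0 <= (P ^+ 2)^-1 by rewrite invr_ge0 sqr_ge0.
have Pi1 : 0 <= P^-1 by rewrite invr_ge0 ltW.
rewrite E; set Q := pw beta n * psum (beta - 1) n in U1 Q0 *.
rewrite (le_trans (ler_normD _ _))// (le_trans (lerD (ler_normB _ _) (lexx _)))//.
rewrite (le_trans (lerD (lerD (ler_normB _ _) (lexx _)) U4))//.
rewrite !(normrM _ _^-1) (ger0_norm Pi1) (ger0_norm Pi2).
rewrite (le_trans (lerD (lerD (lerD (ler_wpM2r Pi2 U1) (ler_wpM2r Pi2 U2)) (ler_wpM2r Pi1 U3)) (lexx _)))//.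
have BGQ : 0 <= B * (gam n + Q) by rewrite mulr_ge0 ?addr_ge0.
have BG : B * gam n <= B * (gam n + Q) by rewrite ler_wpM2l// lerDl.
have BQ : B * Q <= B * (gam n + Q) by rewrite ler_wpM2l// lerDr.
have c1 : 0 <= Cq * Cd * C1 / P ^+ 2 by rewrite divr_ge0 ?sqr_ge0 ?mulr_ge0// ltW.
have c2 : 0 <= Cg * A' * C2 / P ^+ 2 by rewrite divr_ge0 ?sqr_ge0 ?mulr_ge0// ltW.
have c3 : 0 <= C2 / P by rewrite divr_ge0// ltW.
have c4 : 0 <= A / P by rewrite divr_ge0// ltW.
have V1 := ler_wpM2l c1 BQ; have V2 := ler_wpM2l c2 BG.
have V3 := ler_wpM2l c3 BG; have V4 := ler_wpM2l c4 BG.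
rewrite /C -[leRHS]mulrA mulrDl mul1r.
apply: (@le_trans _ _ (Cq * Cd * C1 / P ^+ 2 * (B * Q) + Cg * A' * C2 / P ^+ 2 * (B * gam n) +
   C2 / P * (B * gam n) + A / P * (B * gam n))).
  by rewrite le_eqVlt; apply/orP; left; apply/eqP; ring.
rewrite (le_trans (lerD (lerD (lerD V1 V2) V3) V4))//.
rewrite -[leLHS]add0r; apply: lerD => //.
by rewrite le_eqVlt; apply/orP; left; apply/eqP; ring.
Qed.

End BaseRate.

(** * Integration over the atoms of a partition *)

Section Transfer.
Local Open Scope ereal_scope.
Context d (T : measurableType d) (R : realType) (m : {measure set T -> \bar R}).
Import HBNNSimple.

(** Extends a change of measure known on sets to functions, by simple approximation. It serves the
    inverse branches, with [k] the Jacobian, and the invariance of [muY], with [k = 1]. *)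
Lemma ge0_integral_transfer (D E : set T) (k : T -> R) (s : T -> T) (H : T -> \bar R) :
  measurable D -> measurable E -> measurable_fun E s -> (forall x, E x -> D (s x)) ->
  measurable_fun D k -> (forall x, D x -> (0 <= k x)%R) ->
  (forall A, measurable A -> m (E `&` s @^-1` A) = \int[m]_(x in D `&` A) (k x)%:E) ->
  measurable_fun D H -> (forall x, D x -> 0 <= H x) ->
  \int[m]_(x in E) H (s x) = \int[m]_(x in D) (H x * (k x)%:E).
Proof.
move=> mD mE ms sED mk k0 trans mH H0.
pose f_ := nnsfun_approx mD mH.
have mfA n y : measurable (f_ n @^-1` [set y]) by [].
have mEk : measurable_fun D (EFin \o k) by exact/measurable_EFinP.
transitivity (limn (fun n => \int[m]_(x in E) (f_ n (s x))%:E)).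
  rewrite -monotone_convergence//.
  - apply: eq_integral => y /[!inE] yD; apply/esym/cvg_lim => //.
    by apply: cvg_nnsfun_approx => //; exact: sED.
  - by move=> n; apply/measurable_EFinP; apply: measurableT_comp.
  - by move=> n y _; rewrite lee_fin.
  - by move=> y _ a b ab; rewrite lee_fin; exact/lefP/nd_nnsfun_approx.
transitivity (limn (fun n => \int[m]_(x in D) ((f_ n x)%:E * (k x)%:E))); last first.
  rewrite -monotone_convergence//.
  - apply: eq_integral => y /[!inE] yD; apply/cvg_lim => //.
    by apply: cvgeZr => //; exact: cvg_nnsfun_approx.
  - move=> n; apply: emeasurable_funM => //; apply/measurable_EFinP.
    exact: measurable_funTS.
  - by move=> n y Dy; rewrite mule_ge0 ?lee_fin ?k0.
  - move=> y Dy a b ab; rewrite lee_wpmul2r ?lee_fin ?k0//.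
    exact/lefP/nd_nnsfun_approx.
congr (limn _); apply/funext => n.
transitivity (\sum_(y \in range (f_ n)) \int[m]_(x in E) (y * \1_(f_ n @^-1` [set y]) (s x))%:E).
  rewrite -ge0_integral_fsum//.
  - by apply: eq_integral => x _; rewrite fimfunE -fsumEFin.
  - move=> y; apply/measurable_EFinP/measurable_funM => //.
    by apply: measurableT_comp => //; exact: measurable_indic.
  - by move=> y x _; rewrite nnfun_muleindic_ge0.
transitivity (\sum_(y \in range (f_ n))
    \int[m]_(x in D) ((y * \1_(f_ n @^-1` [set y]) x)%:E * (k x)%:E)); last first.
  rewrite -ge0_integral_fsum//.
  - apply: eq_integral => x _; rewrite [in RHS]fimfunE -fsumEFin// ge0_mule_fsuml//.
    by move=> y; rewrite nnfun_muleindic_ge0.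
  - move=> y; apply: emeasurable_funM => //; apply/measurable_EFinP/measurable_funM => //.
  - by move=> y x Dx; rewrite mule_ge0 ?lee_fin ?k0// -lee_fin nnfun_muleindic_ge0.
apply: eq_fsbigr => y _; have [y0|y0] := ltP y 0%R.
  rewrite !integral0_eq// => x _; rewrite preimage_nnfun0// indicE in_set0 mulr0//.
  by rewrite mul0e.
under [RHS]eq_integral do rewrite EFinM -muleA.
have msA : measurable (E `&` s @^-1` (f_ n @^-1` [set y])) by exact: ms.
rewrite [RHS]ge0_integralZl_EFin//; last 2 first.
- by move=> x Dx; rewrite mule_ge0 ?lee_fin ?k0.
- by apply: emeasurable_funM => //; apply/measurable_EFinP.
under [LHS]eq_integral do rewrite EFinM.
rewrite ge0_integralZl_EFin//; last first.
  apply/measurable_EFinP; apply: (measurable_comp (F := setT)) => //.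
congr (_ * _); transitivity (m (E `&` s @^-1` (f_ n @^-1` [set y]))).
  rewrite -[in RHS](setIT (E `&` _)) -[RHS](integral_indic _ measurableT)//=.
  rewrite [RHS]integral_mkcond [LHS]integral_mkcond; apply: eq_integral => x _.
  by rewrite /patch !indicE in_setI in_setT; case: (x \in E).
rewrite trans// integral_mkcondr; apply: eq_integral => x _.
by rewrite /patch indicE; case: ifPn => xA; rewrite ?mul1e ?mul0e.
Qed.

End Transfer.

Section BoundedIntegrals.
Context {R : realType} d (T : measurableType d) (m : probability T R).
Implicit Types (D : set T) (f g : T -> R) (c : R).

Definition bmeas D g := measurable_fun D g /\ exists K : R, forall y, D y -> `|g y| <= K.

Lemma bmeas_int D g : measurable D -> bmeas D g -> m.-integrable D (EFin \o g).
Proof.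
move=> mD [mg [K gK]]; apply: measurable_bounded_integrable => //.
  by rewrite (le_lt_trans (probability_le1 m mD))// ltry.
exists K; split; first exact: num_real.
by move=> x Kx y /= Dy; rewrite (le_trans (gK _ Dy))// ltW.
Qed.

Lemma bmeas_cst D c : bmeas D (fun=> c).
Proof. by split; [exact: measurable_cst | exists `|c|]. Qed.

Lemma bmeasD D f g : bmeas D f -> bmeas D g -> bmeas D (fun x => f x + g x).
Proof.
move=> [mf [K Kf]] [mg [L Lg]]; split; first exact: measurable_funD.
by exists (K + L) => y Dy; rewrite (le_trans (ler_normD _ _))// lerD ?Kf ?Lg.
Qed.

Lemma bmeasM D f g : bmeas D f -> bmeas D g -> bmeas D (fun x => f x * g x).
Proof.
move=> [mf [K Kf]] [mg [L Lg]]; split; first exact: measurable_funM.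
by exists (K * L) => y Dy; rewrite normrM ler_pM ?Kf ?Lg.
Qed.

Lemma bmeasZ D c f : bmeas D f -> bmeas D (fun x => c * f x).
Proof. by move=> bf; apply: bmeasM => //; exact: bmeas_cst. Qed.

Lemma bmeasN D f : bmeas D f -> bmeas D (fun x => - f x).
Proof.
move=> [mf [K Kf]]; split; first exact: measurableT_comp.
by exists K => y Dy; rewrite normrN Kf.
Qed.

Lemma bmeasB D f g : bmeas D f -> bmeas D g -> bmeas D (fun x => f x - g x).
Proof. by move=> bf bg; apply: bmeasD => //; exact: bmeasN. Qed.

Lemma bmeas_norm D f : bmeas D f -> bmeas D (fun x => `|f x|).
Proof.
move=> [mf [K Kf]]; split; first exact: measurableT_comp.
by exists K => y Dy; rewrite normr_id Kf.
Qed.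

Lemma bmeas_sum (I : Type) (s : seq I) (F : I -> T -> R) D :
  (forall i, bmeas D (F i)) -> bmeas D (fun x => \sum_(i <- s) F i x).
Proof.
move=> bF; elim: s => [|i s IH].
  by under eq_fun do rewrite big_nil; exact: bmeas_cst.
by under eq_fun do rewrite big_cons; exact: bmeasD.
Qed.

Lemma bmeasS D E f : measurable E -> D `<=` E -> bmeas E f -> bmeas D f.
Proof.
move=> mE DE [mf [K Kf]]; split; first exact: measurable_funS mf.
by exists K => y /DE; exact: Kf.
Qed.

Lemma eq_bmeas D f g : (forall y, D y -> f y = g y) -> bmeas D f -> bmeas D g.
Proof.
move=> fg [mf [K Kf]]; split.
  by apply: eq_measurable_fun mf => y /[!inE]; exact: fg.
by exists K => y Dy; rewrite -fg// Kf.
Qed.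

Definition EX D g : R := \int[m]_(x in D) g x.

Lemma EX_ext D f g : (forall y, D y -> f y = g y) -> EX D f = EX D g.
Proof. by move=> fg; apply: eq_Rintegral => x /[!inE]; exact: fg. Qed.

Section Domain.
Variables (D : set T).
Hypothesis mD : measurable D.

Lemma EXD f g : bmeas D f -> bmeas D g -> EX D (fun x => f x + g x) = EX D f + EX D g.
Proof. by move=> bf bg; rewrite /EX RintegralD//; exact: bmeas_int. Qed.

Lemma EXB f g : bmeas D f -> bmeas D g -> EX D (fun x => f x - g x) = EX D f - EX D g.
Proof. by move=> bf bg; rewrite /EX RintegralB//; exact: bmeas_int. Qed.

Lemma EXZ c f : bmeas D f -> EX D (fun x => c * f x) = c * EX D f.
Proof. by move=> bf; rewrite /EX RintegralZl//; exact: bmeas_int. Qed.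

Lemma EXZr c f : bmeas D f -> EX D (fun x => f x * c) = EX D f * c.
Proof. by move=> bf; rewrite mulrC -EXZ//; apply: EX_ext => y _; rewrite mulrC. Qed.

Lemma EX_cst c : EX D (fun=> c) = c * fine (m D).
Proof. exact: Rintegral_cst. Qed.

Lemma EX_le f g : bmeas D f -> bmeas D g -> (forall x, D x -> f x <= g x) -> EX D f <= EX D g.
Proof. by move=> bf bg; apply: le_Rintegral => //; exact: bmeas_int. Qed.

Lemma EX_ge0 f : (forall x, D x -> 0 <= f x) -> 0 <= EX D f.
Proof. exact: Rintegral_ge0. Qed.

Lemma EX_norm f : bmeas D f -> `|EX D f| <= EX D (fun x => `|f x|).
Proof. by move=> bf; apply: le_normr_Rintegral => //; exact: bmeas_int. Qed.

Lemma EX_sum (I : Type) (s : seq I) (F : I -> T -> R) : (forall i, bmeas D (F i)) ->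
  EX D (fun x => \sum_(i <- s) F i x) = \sum_(i <- s) EX D (F i).
Proof.
move=> bF; elim: s => [|i s IH].
  by rewrite big_nil; under [X in EX D X]eq_fun do rewrite big_nil; rewrite EX_cst mul0r.
rewrite big_cons -IH -EXD//; last exact: bmeas_sum.
by apply: EX_ext => y _; rewrite big_cons.
Qed.

End Domain.

Lemma EX_setI_indic D A f : EX (D `&` A) f = EX D (fun x => f x * \1_A x).
Proof.
rewrite /EX Rintegral_mkcondr; apply: eq_Rintegral => x _.
by rewrite /patch indicE; case: ifPn => _; rewrite ?mulr1 ?mulr0.
Qed.

Section Atoms.
Variables (Y : set T) (part : T -> nat).
Hypothesis mY : measurable Y.
Hypothesis matom : forall k, measurable (atom Y part k).

Lemma atom_sub k : atom Y part k `<=` Y. Proof. by move=> y []. Qed.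

Lemma bigcup_atom : Y = \bigcup_k atom Y part k.
Proof.
by apply/seteqP; split => [y Yy|y [k _ []//]]; exists (part y).
Qed.

Lemma trivIset_atom : trivIset setT (atom Y part).
Proof.
apply/trivIsetP => i j _ _ ij; apply/seteqP; split => // y [[_ yi] [_ yj]].
by move: ij; rewrite -yi -yj eqxx.
Qed.

Lemma EX_atoms_ge0 f : bmeas Y f -> (forall k, 0 <= EX (atom Y part k) f) -> 0 <= EX Y f.
Proof.
move=> bf f0; rewrite /EX /Rintegral; apply: fine_ge0.
rewrite {1}bigcup_atom integral_bigcup//; last 2 first.
- exact: trivIset_atom.
- by rewrite -bigcup_atom; exact: bmeas_int.
apply: nneseries_ge0 => k _ _; have := f0 k.
rewrite /EX /Rintegral -lee_fin fineK//.
by apply: integrable_fin_num => //; apply: bmeas_int => //; exact: bmeasS (@atom_sub k) bf.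
Qed.

Lemma EX_atoms_le f g : bmeas Y f -> bmeas Y g ->
  (forall k, EX (atom Y part k) f <= EX (atom Y part k) g) -> EX Y f <= EX Y g.
Proof.
move=> bf bg fg; rewrite -subr_ge0 -EXB//; apply: EX_atoms_ge0; first exact: bmeasB.
by move=> k; rewrite EXB ?subr_ge0//; exact: bmeasS (@atom_sub k) _.
Qed.

Lemma EX_atoms_eq f g : bmeas Y f -> bmeas Y g ->
  (forall k, EX (atom Y part k) f = EX (atom Y part k) g) -> EX Y f = EX Y g.
Proof. by move=> bf bg fg; apply/le_anti; rewrite !EX_atoms_le// => k; rewrite fg. Qed.

Lemma measurable_fun_atoms d' (T' : measurableType d') (g : T -> T') :
  (forall k, measurable_fun (atom Y part k) g) -> measurable_fun Y g.
Proof. by move=> mg; rewrite bigcup_atom; apply/measurable_fun_bigcup. Qed.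

Lemma measurable_fun_label d' (T' : measurableType d') (G : nat -> T -> T') :
  (forall k, measurable_fun Y (G k)) -> measurable_fun Y (fun y => G (part y) y).
Proof.
move=> mG; apply: measurable_fun_atoms => k.
apply: (@eq_measurable_fun _ _ _ _ _ (G k)); first by move=> y /[!inE] -[_ /= ->].
exact: measurable_funS (@atom_sub k) (mG k).
Qed.

Lemma bmeas_label (c : nat -> R) K : (forall y, Y y -> `|c (part y)| <= K) ->
  bmeas Y (fun y => c (part y)).
Proof.
move=> cK; split; last by exists K.
by apply: (@measurable_fun_label _ _ (fun k _ => c k)) => k; exact: measurable_cst.
Qed.

Lemma EX_gt f g k e : bmeas Y f -> bmeas Y g -> (forall y, Y y -> f y <= g y) ->
  0 < e -> (0 < m (atom Y part k))%E -> (forall y, atom Y part k y -> f y + e <= g y) ->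
  EX Y f < EX Y g.
Proof.
move=> bf bg fg e0 ak fge; rewrite -subr_gt0 -EXB//.
have bind : bmeas Y (\1_(atom Y part k) : T -> R).
  split; first exact: measurable_indic.
  by exists 1 => y _; rewrite indicE; case: (_ \in _); rewrite ?normr1 ?normr0.
apply: (@lt_le_trans _ _ (EX Y (fun y => e * \1_(atom Y part k) y))).
  rewrite -EX_setI_indic setIidr ?EX_cst//; last exact: atom_sub.
  by rewrite mulr_gt0// fine_gt0// ak (le_lt_trans (probability_le1 m (matom k)))// ltry.
apply: EX_le => //; [exact: bmeasZ|exact: bmeasB|].
move=> y Yy; rewrite indicE; case: (boolP (_ \in _)) => [/set_mem ya|_].
  by rewrite mulr1 lerBrDl addrC; rewrite addrC; exact: fge.
by rewrite mulr0 subr_ge0 fg.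
Qed.

End Atoms.
End BoundedIntegrals.

(** * Regeneration of Gibbs-Markov maps *)

Section SeparationTime.
Context {R : realType} d0 (M : measurableType d0) (part : M -> nat) (F : M -> M) (theta : R).
Hypothesis theta01 : 0 < theta < 1.

Definition ts y y' := thpow theta (sep_time part F y y').

Lemma ts_ge0 y y' : 0 <= ts y y'.
Proof.
case/andP: theta01 => t0 t1; rewrite /ts /thpow.
by case: sep_time => // n; rewrite exprn_ge0// ltW.
Qed.

Lemma ts_le1 y y' : ts y y' <= 1.
Proof.
case/andP: theta01 => t0 t1; rewrite /ts /thpow.
by case: sep_time => // n; rewrite exprn_ile1 ?ltW.
Qed.

(** Under [F], points with equal labels lose one unit of separation time; if they never separate,
    both sides are 0. *)
Lemma ts_shift y y' : part y = part y' -> ts y y' = theta * ts (F y) (F y').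
Proof.
move=> yy'; rewrite /ts /sep_time; case: pselect => [H|H]; case: pselect => [H'|H'].
- case: ex_minnP => n; case: n => [|n]; first by rewrite /= yy' eqxx.
  rewrite !iterSr => Pn min; case: ex_minnP => n' Pn' min'.
  rewrite /= -exprS; congr (_ ^+ _); apply/eqP; rewrite eqSS eqn_leq min'// andbT.
  by rewrite -ltnS; apply: min; rewrite !iterSr.
- case: H' ; case: H => -[|n Pn]; first by rewrite /= => /eqP.
  by exists n; rewrite -!iterSr.
- by case: H' => n Pn; case: H; exists n.+1; rewrite !iterSr.
- by rewrite /= mulr0.
Qed.

End SeparationTime.

Section GibbsMarkov.
Context {R : realType} d0 (M : measurableType d0) (muY : probability M R).
Variables (Y : set M) (part : M -> nat) (F : M -> M) (xi : M -> R) (theta C0 : R).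
Hypothesis mY : measurable Y.
Hypothesis muY1 : muY Y = 1%E.
Hypothesis GM : gibbs_markov muY Y part F xi theta C0.

Local Notation ts := (ts part F theta).
Local Notation atom := (atom Y part).
Local Notation EX := (EX muY).

Let matom k : measurable (atom k) := gm_part_meas GM k.
Let theta01 := gm_theta GM.

Lemma theta_gt0 : 0 < theta. Proof. by case/andP: theta01. Qed.
Lemma theta_lt1 : theta < 1. Proof. by case/andP: theta01. Qed.

Definition live k := exists y, atom k y.

Lemma live_part y : Y y -> live (part y). Proof. by move=> Yy; exists y. Qed.

Lemma F_stable y : Y y -> Y (F y).
Proof. by move=> Yy; have [FY _ _] := gm_full_branch GM (live_part Yy); exact: FY. Qed.

Lemma EX1 : EX Y (fun=> 1) = 1.
Proof. by rewrite EX_cst// muY1 mul1r. Qed.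

Lemma EXY_cst c : EX Y (fun=> c) = c.
Proof. by rewrite EX_cst// muY1 mulr1. Qed.

Lemma EXY_norm_le f (K : R) : bmeas Y f -> (forall y, Y y -> `|f y| <= K) -> `|EX Y f| <= K.
Proof.
move=> bf fK; rewrite (le_trans (EX_norm _ mY bf))// -[leRHS]EXY_cst.
by apply: EX_le => //; [exact: bmeas_norm|exact: bmeas_cst].
Qed.

Definition branch k z := xget z [set y | atom k y /\ F y = z].

Section Branch.
Variable k : nat.
Hypothesis kn : live k.

Lemma branchP z : Y z -> atom k (branch k z) /\ F (branch k z) = z.
Proof.
move=> Yz; have [_ _ surj] := gm_full_branch GM kn.
have [y ya Fy] := surj z Yz.
by have := @xgetPex _ z [set y | atom k y /\ F y = z]; apply; exists y.
Qed.

Lemma branch_F y : atom k y -> branch k (F y) = y.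
Proof.
move=> ya; have [FY inj _] := gm_full_branch GM kn.
have [ba bF] := branchP (FY _ ya).
exact: inj.
Qed.

Lemma branch_part z : Y z -> part (branch k z) = k.
Proof. by move=> /branchP [[_ ->]]. Qed.

Lemma ts_branch z z' : Y z -> Y z' -> ts (branch k z) (branch k z') = theta * ts z z'.
Proof.
move=> Yz Yz'; rewrite ts_shift ?branch_part//.
by rewrite (branchP Yz).2 (branchP Yz').2.
Qed.

Lemma branch_preimage A : Y `&` branch k @^-1` A = F @` (atom k `&` A).
Proof.
apply/seteqP; split => [z [Yz Az]|z [y [ya Ay] <-]].
  by have [ba bF] := branchP Yz; exists (branch k z).
have [FY _ _] := gm_full_branch GM kn.
by split; [exact: FY|rewrite /preimage/= branch_F].
Qed.

Lemma measurable_branch : measurable_fun Y (branch k).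
Proof.
move=> _ A mA; rewrite branch_preimage; apply: (gm_F_image_meas GM (k := k)).
  exact: measurableI.
by move=> y [].
Qed.

Lemma bmeas_branch (f : M -> R) : bmeas (atom k) f -> bmeas Y (fun z => f (branch k z)).
Proof.
move=> [mf [K fK]]; split.
  apply: (measurable_comp (F := atom k)) => //; last exact: measurable_branch.
  by move=> _ [z Yz <-]; have [] := branchP Yz.
by exists K => z Yz; apply: fK; have [] := branchP Yz.
Qed.

Lemma xi_ratio y y' : atom k y -> atom k y' -> xi y <= xi y' * expR (`|C0| * ts y y').
Proof.
move=> [Yy py] [Yy' py'].
have := gm_distortion GM Yy Yy' (etrans py (esym py')); rewrite -/(ts y y') => D.
rewrite -ler_ln ?posrE ?mulr_gt0 ?expR_gt0 ?(gm_xi_pos GM)// lnM ?posrE ?expR_gt0 ?(gm_xi_pos GM)//.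
rewrite expRK -lerBlDl (le_trans (ler_norm _))// (le_trans D)//.
by rewrite ler_wpM2r ?ts_ge0// ler_norm.
Qed.

Lemma bmeas_xi : bmeas (atom k) xi.
Proof.
split; first exact: measurable_funS (@atom_sub _ _ Y part k) (gm_xi_meas GM).
have [y0 y0a] := kn; exists (xi y0 * expR `|C0|) => y ya.
have x0 : 0 < xi y0 by apply: (gm_xi_pos GM); case: y0a.
rewrite ger0_norm; last by apply/ltW/(gm_xi_pos GM); case: ya.
rewrite (le_trans (xi_ratio ya y0a))// ler_pM2l// ler_expR.
by rewrite ler_piMr// ts_le1.
Qed.

Lemma measurable_xiV : measurable_fun (atom k) (fun x => (xi x)^-1).
Proof.
apply: (@eq_measurable_fun _ _ _ _ _ (fun x => xi x `^ (-1))).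
  move=> x /[!inE] -[Yx _]; rewrite powR_inv1// ltW//; exact: (gm_xi_pos GM).
apply: (measurableT_comp (measurable_powR _)).
exact: measurable_funS (@atom_sub _ _ Y part k) (gm_xi_meas GM).
Qed.

(** The transfer operator of a single branch. A signed [f] is made nonnegative by adding a constant,
    and the constant is removed by linearity. *)
Lemma EX_branch f : bmeas (atom k) f ->
  EX Y (fun z => xi (branch k z) * f (branch k z)) = EX (atom k) f.
Proof.
have pos g : bmeas (atom k) g -> (forall y, atom k y -> 0 <= g y) ->
    EX Y (fun z => xi (branch k z) * g (branch k z)) = EX (atom k) g.
  move=> bg g0; rewrite /EX /Rintegral.
  have := @ge0_integral_transfer _ M R muY (atom k) Y (fun x => (xi x)^-1) (branch k)
    (fun x => (xi x * g x)%:E).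
  move=> ->//.
  - congr fine; apply: eq_integral => y /[!inE] ya; rewrite -EFinM; congr EFin.
    by rewrite mulrAC mulfV ?mul1r// gt_eqF//; apply: (gm_xi_pos GM); case: ya.
  - exact: measurable_branch.
  - by move=> z /branchP [].
  - exact: measurable_xiV.
  - by move=> x [Yx _]; rewrite invr_ge0 ltW// (gm_xi_pos GM).
  - move=> A mA; rewrite branch_preimage (gm_jacobian GM (k := k))//.
    exact: measurableI.
  - apply/measurable_EFinP; apply: measurable_funM; first by case: bmeas_xi.
    by case: bg.
  - by move=> x xa; rewrite lee_fin mulr_ge0 ?g0// ltW// (gm_xi_pos GM)//; case: xa.
move=> bf; have [mf [K fK]] := bf.
have bK : bmeas (atom k) (fun=> `|K|) by exact: bmeas_cst.
have bfK := bmeasD bf bK.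
have bx := bmeas_branch bmeas_xi.
have H0 : EX Y (fun z => xi (branch k z) * (f (branch k z) + `|K|)) =
    EX (atom k) (fun y => f y + `|K|).
  apply: (pos _ bfK) => y /fK; rewrite ler_norml => /andP[+ _].
  by rewrite -subr_ge0 opprK => /le_trans; apply; rewrite lerD2l ler_norm.
rewrite EXD// in H0.
have H1 : EX Y (fun z => xi (branch k z) * (f (branch k z) + `|K|)) =
    EX Y (fun z => xi (branch k z) * f (branch k z)) + EX (atom k) (fun=> `|K|).
  rewrite -(pos _ bK)// -EXD//.
  - by apply: EX_ext => z Yz; rewrite mulrDr.
  - exact: bmeasM (bmeas_branch bf).
  - exact: bmeasM (bmeas_branch bK).
apply: (addIr (EX (atom k) (fun=> `|K|))).
by rewrite -H1.
Qed.


(** By the Jacobian formula a null atom would have a null image, but its image is all of [Y]. *)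
Lemma muY_atom_gt0 : (0 < muY (atom k))%E.
Proof.
rewrite lt0e measure_ge0 andbT; apply/eqP => a0.
have Fa : F @` (atom k) = Y.
  rewrite -[atom k]setIid -branch_preimage; apply/seteqP; split => [z []//|z Yz].
  by split => //; have [] := branchP Yz.
have := gm_jacobian GM (matom k) (fun y h => h); rewrite Fa => J.
have {J} : muY Y = _ := J; rewrite muY1.
rewrite null_set_integral//; first by move/eqP; rewrite gt_eqF.
exact/measurable_EFinP/measurable_xiV.
Qed.

End Branch.

(** * Cones of log-Lipschitz densities and the splitting of a constant *)

Definition cone (D : set M) (K : R) (g : M -> R) :=
  [/\ measurable_fun D g, forall y, D y -> 0 < g y &
      forall y y', D y -> D y' -> g y <= g y' * expR (K * ts y y')].

Lemma cone_bmeas D K g : 0 <= K -> cone D K g -> bmeas D g.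
Proof.
move=> K0 [mg g0 gK]; split => //.
have [[y0 Dy0]|/forallNP D0] := pselect (exists y, D y); last by exists 0 => y /D0.
exists (g y0 * expR K) => y Dy; rewrite ger0_norm; last by rewrite ltW// g0.
by rewrite (le_trans (gK _ _ Dy Dy0))// ler_pM2l ?g0// ler_expR ler_piMr// ts_le1.
Qed.

Lemma cone_scale D K g c : 0 < c -> cone D K g -> cone D K (fun y => g y / c).
Proof.
move=> c0 [mg g0 gK]; split.
- by apply: measurable_funM => //; exact: measurable_cst.
- by move=> y Dy; rewrite divr_gt0 ?g0.
- by move=> y y' Dy Dy'; rewrite mulrAC ler_pM2r ?invr_gt0// gK.
Qed.

Lemma cone1 K : 0 <= K -> cone Y K (fun=> 1).
Proof.
move=> K0; split => // y y' _ _; rewrite mul1r -[leLHS]expR0 ler_expR mulr_ge0//.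
exact: ts_ge0.
Qed.

Lemma cone_bounds K g : 0 <= K -> cone Y K g -> EX Y g = 1 ->
  forall y, Y y -> expR (- K) <= g y <= expR K.
Proof.
move=> K0 cg g1 y Yy; have bg := cone_bmeas K0 cg; have [mg g0 gK] := cg.
have le y1 y2 : Y y1 -> Y y2 -> g y1 <= g y2 * expR K.
  move=> Y1 Y2; rewrite (le_trans (gK _ _ Y1 Y2))// ler_pM2l ?g0// ler_expR.
  by rewrite ler_piMr// ts_le1.
apply/andP; split.
  rewrite -(ler_pM2r (expR_gt0 K)) -expRD addNr expR0.
  rewrite -g1 -[leRHS]EXY_cst; apply: EX_le => //; first exact: bmeas_cst.
  by move=> z Yz; rewrite le.
rewrite -[leLHS]EXY_cst -[leRHS]mul1r -g1 -EXZr//; apply: EX_le => //.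
- exact: bmeas_cst.
- by apply: bmeasM => //; exact: bmeas_cst.
- by move=> z Yz; rewrite le.
Qed.

(* [Kc] solves (|C0| + K) theta = K - 1: transfer operators of branches map the
   cone with constant [Kc] into the cone with constant [Kc - 1]. *)
Definition Kc := (`|C0| * theta + 1) / (1 - theta).
Definition eps := expR (- (2 * Kc)) / Kc.

Lemma Kc_ge1 : 1 <= Kc.
Proof.
have := theta_gt0; have := theta_lt1 => t1 t0.
have c0 : 0 <= `|C0| * theta by rewrite mulr_ge0// ltW.
by rewrite /Kc ler_pdivlMr; lra.
Qed.

Lemma Kc_ge0 : 0 <= Kc. Proof. exact: le_trans Kc_ge1. Qed.

Lemma Kc_contract : (`|C0| + Kc) * theta = Kc - 1.
Proof.
have := theta_lt1 => t1; rewrite /Kc; field; lra.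
Qed.

Lemma eps_gt0 : 0 < eps.
Proof. by rewrite /eps divr_gt0 ?expR_gt0// (lt_le_trans _ Kc_ge1). Qed.

Lemma eps_lt_expR : eps < expR (- Kc).
Proof.
have K1 := Kc_ge1; rewrite /eps ltr_pdivrMr; last by lra.
apply: (@lt_le_trans _ _ (expR (- Kc))); first by rewrite ltr_expR; lra.
by rewrite ler_peMr ?expR_ge0.
Qed.

Lemma eps_lt1 : eps < 1.
Proof.
rewrite (lt_le_trans eps_lt_expR)// -[leRHS]expR0 ler_expR.
by have := Kc_ge1; lra.
Qed.

(** Write [K = Kc] and [t = ts y y']. Relaxing the constant from [K - 1] to [K] gains at least
    [p(y') t >= e^-K t], whereas subtracting [eps] costs [eps (e^(Kt) - 1) <= eps K t e^K]. The
    value [eps = e^(-2K) / K] balances the two. *)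
Lemma cone_sub_eps p : cone Y (Kc - 1) p -> EX Y p = 1 ->
  cone Y Kc (fun y => (p y - eps) / (1 - eps)) /\
  EX Y (fun y => (p y - eps) / (1 - eps)) = 1.
Proof.
move=> cp p1; have K1 := Kc_ge1; have e0 := eps_gt0; have e1 := eps_lt1.
have eK := eps_lt_expR.
have K10 : 0 <= Kc - 1 by lra.
have pb y : Y y -> expR (- Kc) <= p y.
  move=> /(cone_bounds K10 cp p1)/andP[+ _]; apply: le_trans.
  by rewrite ler_expR; lra.
have bp := cone_bmeas K10 cp; have [mp p0 pK] := cp.
split; last first.
  have -> : EX Y (fun y => (p y - eps) / (1 - eps)) = EX Y (fun y => p y - eps) / (1 - eps).
    by rewrite EXZr//; apply: bmeasB => //; exact: bmeas_cst.
  rewrite EXB// ?p1 ?EXY_cst ?divff//; last exact: bmeas_cst.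
  by rewrite subr_eq0 gt_eqF.
apply: cone_scale; first by lra.
split; first by apply: measurable_funB => //; exact: measurable_cst.
  by move=> y /pb py; rewrite subr_gt0 (lt_le_trans eK).
move=> y y' Yy Yy'.
have t0 : 0 <= ts y y' by exact: ts_ge0.
have t1 : ts y y' <= 1 by exact: ts_le1.
set t := ts y y' in t0 t1 *.
have E1 : expR ((Kc - 1) * t) = expR (Kc * t) * expR (- t).
  by rewrite -expRD; congr expR; ring.
have E2 : expR (Kc * t) - expR ((Kc - 1) * t) >= t.
  have -> : expR (Kc * t) = expR ((Kc - 1) * t) * expR t.
    by rewrite -expRD; congr expR; ring.
  have := expR_ge1Dx t; have : 1 <= expR ((Kc - 1) * t).
    by rewrite -[leLHS]expR0 ler_expR mulr_ge0.
  by nra.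
have E3 : expR (Kc * t) - 1 <= Kc * t * expR Kc.
  have : expR (Kc * t) <= expR Kc by rewrite ler_expR ler_piMr// Kc_ge0.
  have := expR_ge1Dx (- (Kc * t)); rewrite expRN.
  have x0 := expR_gt0 (Kc * t).
  move=> H /(ler_wpM2l (mulr_ge0 Kc_ge0 t0)); apply: le_trans.
  have : (1 + - (Kc * t)) * expR (Kc * t) <= 1.
    by rewrite -ler_pdivlMr// div1r.
  lra.
have E4 : eps * (expR (Kc * t) - 1) <= expR (- Kc) * t.
  apply: (@le_trans _ _ (eps * (Kc * t * expR Kc))); first by rewrite ler_pM2l.
  rewrite /eps le_eqVlt; apply/orP; left; apply/eqP.
  have -> : - (2 * Kc) = - Kc + - Kc by ring.
  rewrite expRD (expRN Kc); field; rewrite gt_eqF ?expR_gt0//= gt_eqF//; lra.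
have E5 : expR (- Kc) * t <= p y' * (expR (Kc * t) - expR ((Kc - 1) * t)).
  by rewrite ler_pM ?expR_ge0// pb.
by have := pK _ _ Yy Yy'; rewrite -/t; lra.
Qed.

Definition mass k (g : M -> R) := EX (atom k) g.
Definition dens k g z := xi (branch k z) * g (branch k z) / mass k g.
Definition next k g z := (dens k g z - eps) / (1 - eps).

Section Next.
Variables (k : nat) (g : M -> R).
Hypotheses (kn : live k) (cg : cone (atom k) Kc g).

Let bg : bmeas (atom k) g := cone_bmeas Kc_ge0 cg.

Lemma cone_transfer : cone Y (Kc - 1) (fun z => xi (branch k z) * g (branch k z)).
Proof.
have [mg g0 gK] := cg; split.
- by case: (bmeasM (bmeas_branch kn (bmeas_xi kn)) (bmeas_branch kn bg)).
- move=> z Yz; have [ba _] := branchP kn Yz.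
  by rewrite mulr_gt0 ?g0// (gm_xi_pos GM)//; case: ba.
- move=> z z' Yz Yz'; have [ba _] := branchP kn Yz; have [ba' _] := branchP kn Yz'.
  have x0 := gm_xi_pos GM ba.1.
  have -> : expR ((Kc - 1) * ts z z') = expR (`|C0| * ts (branch k z) (branch k z')) *
      expR (Kc * ts (branch k z) (branch k z')).
    by rewrite (ts_branch kn Yz Yz') -expRD -Kc_contract; congr expR; ring.
  rewrite mulrACA ler_pM ?(xi_ratio ba ba') ?gK//; first exact: ltW.
  exact/ltW/g0.
Qed.

Lemma mass_gt0 : 0 < mass k g.
Proof.
have [mg g0 _] := cg; have [y0 ya] := kn.
have [m0 _ mK] := cone_transfer.
have z0 : Y (F y0) by apply: F_stable; case: ya.
have K10 : 0 <= Kc - 1 by have := Kc_ge1; lra.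
rewrite /mass -(EX_branch kn bg).
apply: (@lt_le_trans _ _ (xi y0 * g y0 * expR (- (Kc - 1)))).
  by rewrite !mulr_gt0 ?expR_gt0 ?g0// (gm_xi_pos GM)//; case: ya.
rewrite -[leLHS]EXY_cst; apply: EX_le => //; first exact: bmeas_cst.
  exact: cone_bmeas cone_transfer.
move=> z Yz; rewrite expRN -ler_pdivlMr ?invr_gt0 ?expR_gt0// invrK.
have := mK _ _ z0 Yz; rewrite branch_F// => /le_trans; apply.
rewrite ler_pM2l; last by have [_ + _] := cone_transfer; exact.
by rewrite ler_expR ler_piMr// ts_le1.
Qed.

Lemma dens_cone : cone Y (Kc - 1) (dens k g) /\ EX Y (dens k g) = 1.
Proof.
split; first exact: cone_scale mass_gt0 cone_transfer.
rewrite /dens EXZr// ?EX_branch ?divff//; last first.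
  by apply: cone_bmeas cone_transfer; have := Kc_ge1; lra.
by rewrite gt_eqF// mass_gt0.
Qed.

Lemma next_cone : cone Y Kc (next k g) /\ EX Y (next k g) = 1.
Proof. by have [c e] := dens_cone; exact: cone_sub_eps. Qed.

Lemma EX_next W : bmeas Y W ->
  EX (atom k) (fun y => g y * W (F y)) =
  mass k g * (eps * EX Y W + (1 - eps) * EX Y (fun z => next k g z * W z)).
Proof.
move=> bW; have m0 := mass_gt0; have e1 := eps_lt1.
have bWF : bmeas (atom k) (fun y => W (F y)).
  have [mW [K WK]] := bW; split; last by exists K => y [Yy _]; apply/WK/F_stable.
  apply: (measurable_comp (F := Y)) => //; last first.
    exact: measurable_funS (@atom_sub _ _ Y part k) (gm_F_meas GM).
  by move=> _ [y [Yy _] <-]; exact: F_stable.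
have bn : bmeas Y (next k g) := cone_bmeas Kc_ge0 next_cone.1.
rewrite -(EX_branch kn (bmeasM bg bWF)) -!EXZ//; [|exact: bmeasM..].
rewrite -EXD//; [|exact: bmeasZ|by apply: bmeasZ; exact: bmeasM].
rewrite -EXZ//; last by apply: bmeasD; apply: bmeasZ => //; exact: bmeasM.
apply: EX_ext => z Yz; rewrite (branchP kn Yz).2 /next /dens.
have c1 : 1 - eps != 0 by rewrite gt_eqF// subr_gt0.
have c2 : mass k g != 0 by rewrite gt_eqF.
by field; rewrite ?c1 ?c2.
Qed.

End Next.

(** * The first regeneration time and its tail *)

Section Regeneration.
Variables (ph : nat -> nat) (A0 beta : R).
Hypothesis ph_gt0 : forall k, live k -> (0 < ph k)%N.
Hypothesis beta1 : 1 < beta.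
Hypothesis ph_tail : forall n, EX Y (fun y => (n < ph (part y))%:R) <= A0 * pw beta n.
Hypothesis ph_gcd : forall e, (forall k, live k -> (e %| ph k)%N) -> (e %| 1)%N.

Definition reg g := cone Y Kc g /\ EX Y g = 1.

Lemma reg_cone_atom k g : reg g -> cone (atom k) Kc g.
Proof.
move=> [[mg g0 gK] _]; split.
- exact: measurable_funS (@atom_sub _ _ Y part k) mg.
- by move=> y [Yy _]; exact: g0.
- by move=> y y' [Yy _] [Yy' _]; exact: gK.
Qed.

Lemma reg_next k g : live k -> reg g -> reg (next k g).
Proof. by move=> kn rg; exact: (next_cone kn (reg_cone_atom k rg)). Qed.

Lemma reg_one : reg (fun=> 1).
Proof. by split; [exact: cone1 Kc_ge0|exact: EX1]. Qed.

Lemma reg_bmeas g : reg g -> bmeas Y g.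
Proof. by move=> [cg _]; exact: cone_bmeas Kc_ge0 cg. Qed.

Lemma reg_bounds g y : reg g -> Y y -> expR (- Kc) <= g y <= expR Kc.
Proof. by move=> [cg g1] Yy; exact: cone_bounds Kc_ge0 cg g1 _ Yy. Qed.

Lemma reg_gt0 g y : reg g -> Y y -> 0 < g y.
Proof. by move=> [[_ g0 _] _]; exact: g0. Qed.

Lemma EX_reg_le g (f : M -> R) (K : R) : reg g -> bmeas Y f -> (forall y, Y y -> f y <= K) ->
  EX Y (fun y => g y * f y) <= K.
Proof.
move=> rg bf fK; have bg := reg_bmeas rg.
rewrite -[leRHS]mul1r -rg.2 -EXZr//; apply: EX_le => //.
- exact: bmeasM.
- by apply: bmeasM => //; exact: bmeas_cst.
- by move=> y Yy; rewrite ler_pM2l ?(reg_gt0 rg)// fK.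
Qed.

(* [tau m g] is the probability that the orbit started with density [g] on the
   base has not regenerated by time [m]: at each return through the branch [k]
   the density splits as [eps + (1 - eps) next k g], and the first part
   regenerates. The first argument of [tauF] is fuel. *)
Fixpoint tauF (N m : nat) (g : M -> R) : R :=
  if N is N'.+1 then
    EX Y (fun y => g y * (if (ph (part y) <= m)%N
      then (1 - eps) * tauF N' (m - ph (part y))%N (next (part y) g) else 1))
  else 0.

Definition tau m g := tauF m.+1 m g.

Lemma tauF_fuel N N' m g : (m < N)%N -> (m < N')%N -> tauF N m g = tauF N' m g.
Proof.
elim: N N' m g => [|N IH] [|N'] m g //= mN mN'; apply: EX_ext => y Yy.
case: ifPn => // pm; have p0 := ph_gt0 (live_part Yy).
by rewrite (IH N')//; lia.
Qed.

(** The probability of no regeneration by time [m], given that the first return uses the branch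
    [k]. *)
Definition wt m g k := if (ph k <= m)%N then (1 - eps) * tau (m - ph k)%N (next k g) else 1.

Lemma tau_wt m g : tau m g = EX Y (fun y => g y * wt m g (part y)).
Proof.
rewrite /tau/=; apply: EX_ext => y Yy; rewrite /wt; case: ifPn => // pm.
have p0 := ph_gt0 (live_part Yy).
by rewrite /tau (@tauF_fuel m (m - ph (part y)).+1)//; lia.
Qed.

Lemma wt_tau_bounds m : (forall g, reg g -> 0 <= tau m g <= 1) /\
  (forall g k, reg g -> live k -> 0 <= wt m g k <= 1).
Proof.
suff wtP g k : reg g -> live k -> 0 <= wt m g k <= 1.
  split => // g rg; rewrite tau_wt; apply/andP; split.
    apply: EX_ge0 => y Yy; rewrite mulr_ge0//; first exact/ltW/(reg_gt0 rg).
    by have /andP[] := wtP g _ rg (live_part Yy).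
  apply: EX_reg_le => // [|y Yy]; last by have /andP[] := wtP g _ rg (live_part Yy).
  by apply: (bmeas_label mY matom (K := 1)) => y Yy; have := wtP g _ rg (live_part Yy); rewrite ler_norml; lra.
elim/ltn_ind: m g k => m IH g k rg kn; rewrite /wt; case: ifPn => [pm|_]; last by rewrite ler01 lexx.
have e0 := eps_gt0; have e1 := eps_lt1; have p0 := ph_gt0 kn.
have rn := reg_next kn rg.
suff : 0 <= tau (m - ph k)%N (next k g) <= 1 by move=> /andP[t0 t1]; apply/andP; split; nra.
have IHm := IH (m - ph k)%N (ltac:(lia)).
rewrite tau_wt; apply/andP; split.
  apply: EX_ge0 => y Yy; rewrite mulr_ge0//; first exact/ltW/(reg_gt0 rn).
  by have /andP[] := IHm _ _ rn (live_part Yy).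
apply: EX_reg_le => // [|y Yy]; last by have /andP[] := IHm _ _ rn (live_part Yy).
by apply: (bmeas_label mY matom (K := 1)) => y Yy; have := IHm _ _ rn (live_part Yy); rewrite ler_norml; lra.
Qed.

Lemma tau_bounds m g : reg g -> 0 <= tau m g <= 1.
Proof. by move=> rg; exact: (wt_tau_bounds m).1. Qed.

Lemma wt_bounds m g k : reg g -> live k -> 0 <= wt m g k <= 1.
Proof. by move=> rg kn; exact: (wt_tau_bounds m).2. Qed.

Lemma bmeas_wt m g : reg g -> bmeas Y (fun y => wt m g (part y)).
Proof.
move=> rg; apply: (bmeas_label mY matom (K := 1)) => y Yy.
by have := wt_bounds m rg (live_part Yy); rewrite ler_norml; lra.
Qed.

Lemma bmeas_gwt m g : reg g -> bmeas Y (fun y => g y * wt m g (part y)).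
Proof. by move=> rg; apply: bmeasM; [exact: reg_bmeas|exact: bmeas_wt]. Qed.

Lemma tau0 g : reg g -> tau 0 g = 1.
Proof.
move=> rg; rewrite tau_wt -[RHS]rg.2; apply: EX_ext => y Yy.
by rewrite /wt leqNgt ph_gt0 ?mulr1//; exact: live_part.
Qed.

Lemma wt_tau_mono m : (forall g, reg g -> tau m.+1 g <= tau m g) /\
  (forall g k, reg g -> live k -> wt m.+1 g k <= wt m g k).
Proof.
elim/ltn_ind: m => m IH.
suff wtP g k : reg g -> live k -> wt m.+1 g k <= wt m g k.
  split => // g rg; rewrite !tau_wt; apply: EX_le => //; [exact: bmeas_gwt..|].
  by move=> y Yy; rewrite ler_pM2l ?(reg_gt0 rg)// wtP//; exact: live_part.
move=> rg kn; have e0 := eps_gt0; have e1 := eps_lt1; have p0 := ph_gt0 kn.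
have [pm|mp] := leqP (ph k) m.
  rewrite /wt pm (leqW pm) subSn// ler_pM2l; last by lra.
  by apply: (IH _ _).1 => //; [lia|exact: reg_next].
have -> : wt m g k = 1 by rewrite /wt leqNgt mp.
by have /andP[] := wt_bounds m.+1 rg kn.
Qed.

(** Regeneration at time [n] has positive probability from every density; the quantifier over [g]
    makes the property stable under a preceding return, which changes the density. *)
Definition regen n := (0 < n)%N /\ forall g, reg g -> tau n g < tau n.-1 g.

Lemma tau_lt m g k : reg g -> live k -> wt m.+1 g k < wt m g k -> tau m.+1 g < tau m g.
Proof.
move=> rg kn wl; rewrite !tau_wt.
have ex_gt0 : 0 < expR (- Kc) * (wt m g k - wt m.+1 g k).
  by rewrite mulr_gt0 ?expR_gt0// subr_gt0.
apply: (EX_gt mY matom _ _ _ ex_gt0 (muY_atom_gt0 kn)).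
- exact: bmeas_gwt.
- exact: bmeas_gwt.
- move=> y Yy; have W := (wt_tau_mono m).2 g _ rg (live_part Yy).
  by have g0 := ltW (reg_gt0 rg Yy); rewrite ler_wpM2l.
move=> y [Yy /= ->]; rewrite -lerBrDl -mulrBr ler_pM2r ?subr_gt0//.
by have /andP[] := reg_bounds rg Yy.
Qed.

Lemma regen_ph k : live k -> regen (ph k).
Proof.
move=> kn; have p0 := ph_gt0 kn; split => // g rg.
case pk: (ph k) p0 => [//|n] _; apply: (tau_lt rg kn).
have rn := reg_next kn rg.
rewrite /wt pk leqnn ltnn subnn tau0// mulr1; have := eps_gt0; lra.
Qed.

Lemma regenD n k : live k -> regen n -> regen (ph k + n)%N.
Proof.
move=> kn [n0 rn]; split; first by rewrite addn_gt0 n0 orbT.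
case: n n0 rn => // n _ rn g rg; rewrite addnS; apply: (tau_lt rg kn).
rewrite /wt leq_addr -addnS leq_addr !addKn ltr_pM2l ?subr_gt0 ?eps_lt1//.
exact/rn/reg_next.
Qed.

(** Nonempty finite sums of heights are possible regeneration times, so the gcd condition on the
    heights provides the two consecutive times with positive mass that the coupling requires. *)
Lemma regen_consecutive : exists N, (0 < N)%N /\ regen N /\ regen N.+1.
Proof.
pose S n := exists2 k, live k & n = ph k.
pose G n := n <> 0%N /\ exists l : seq nat, (forall i, i \in l -> live i) /\ n = (\sum_(i <- l) ph i)%N.
have GP n : G n -> regen n.
  move=> [n0 [l [ll en]]]; subst n; elim: l ll n0 => [|i l IH] ll; first by rewrite big_nil.
  rewrite big_cons => _; have il : live i by apply: ll; rewrite inE eqxx.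
  have [->|/eqP l0] := eqVneq (\sum_(i <- l) ph i)%N 0%N; first by rewrite addn0; exact: regen_ph.
  by apply: regenD => //; apply: IH => // j jl; apply: ll; rewrite inE jl orbT.
have [] := @semigroup_consecutive S G.
- have [y0 Yy0] : exists y, Y y.
    apply/not_existsP => Y0; move: muY1; rewrite (_ : Y = set0) ?measure0; last first.
      by apply/seteqP; split => // y /Y0.
    by move/eqP; rewrite lt_eqF// lte01.
  by exists (ph (part y0)); [exists (part y0) => //; exact: live_part|exact/ph_gt0/live_part].
- move=> n [k kn ->]; split; first by have := ph_gt0 kn; lia.
  by exists [:: k]; split => [i|]; rewrite ?inE ?big_seq1// => /eqP ->.
- move=> m n [m0 [l [ll em]]] [n0 [l' [ll' en]]]; split; first by lia.
  exists (l ++ l'); rewrite big_cat/= -em -en; split => // i; rewrite mem_cat => /orP[]; [exact: ll|exact: ll'].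
- by move=> e eS; apply: ph_gcd => k kn; apply: eS; exists k.
move=> N [gN gN1]; exists N; split; last by split; exact: GP.
by have [] := GP _ gN.
Qed.

(** Induction on [m]. If the first return is shorter than a fixed fraction of [m], restarting the
    bound after it costs at most the factor [r], and [(1 - eps) r = 1 - eps / 2]. A longer first
    return has probability [O(m^-beta)], which the choice of [A] fits into the remaining share
    [eps / 2]. *)
Lemma tau_tail : exists2 A, 0 < A & forall m g, reg g -> tau m g <= A * pw beta m.
Proof.
have e0 := eps_gt0; have e1 := eps_lt1; have b1 := beta1; have b0 : 0 <= beta by lra.
have A00 : 0 <= A0.
  have := ph_tail 0; rewrite pw0 mulr1; apply: le_trans.
  by apply: EX_ge0 => y _; exact: ler0n.
pose r := (1 - eps / 2) / (1 - eps).
have r1 : 1 < r by rewrite /r ltr_pdivlMr; lra.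
(* With [b = c / (c - 1)], a return time [j] with [b j < m + 1] satisfies [m + 1 < c (m + 1 - j)],
   so the power of exponent [-beta] grows at most by [c^beta = r]. *)
pose c := r `^ beta^-1.
have cb : c `^ beta = r by rewrite /c -powRrM mulVf ?powRr1//; lra.
have c1 : 1 < c.
  rewrite ltNge; apply/negP => c1.
  have : c `^ beta <= 1 `^ beta by rewrite ge0_ler_powR ?nnegrE ?powR_ge0.
  by rewrite cb powR1 leNgt r1.
pose b := c / (c - 1).
have bge1 : 1 <= b by rewrite /b ler_pdivlMr; lra.
have bb0 : 0 < b by lra.
pose A := Num.max 1 (2 * (expR Kc * (A0 * (2 * b) `^ beta)) / eps).
have A1 : 0 < A by rewrite lt_max ltr01.
have AE : expR Kc * (A0 * (2 * b) `^ beta) <= eps / 2 * A.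
  rewrite mulrAC ler_pdivlMr// mulrC -ler_pdivrMl//  le_max.
  by apply/orP; right; rewrite [leLHS]mulrC.
exists A => //; elim/ltn_ind => m IH g rg.
have mb0 : 0 <= m.+1%:R / b by rewrite divr_ge0// ltW.
have [n' [n'_le n'_lt]] := half_trunc mb0.
have n'_big : m.+1%:R <= 2 * b * n'.+1%:R by rewrite mulrAC -ler_pdivrMr.
have n'_small j : (0 < j)%N -> m.+1%:R <= b * j%:R -> (n' < j)%N.
  by move=> j0 H; apply: n'_lt => //; rewrite ler_pdivrMr// mulrC.
have wt_le k : live k -> wt m g k <= (1 - eps / 2) * A * pw beta m + (n' < ph k)%:R.
  move=> kn; have p0 := ph_gt0 kn; have P0 := pw_ge0 beta m.
  have L0 : 0 <= (1 - eps / 2) * A * pw beta m by rewrite !mulr_ge0//; lra.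
  have [big|small] := ltnP n' (ph k).
    by have /andP[_ w1] := wt_bounds m rg kn; rewrite (le_trans w1)// lerDr.
  have pm : (ph k < m.+1)%N.
    rewrite ltnNge; apply/negP => mp.
    have : (n' < ph k)%N.
      apply: n'_small => //; rewrite (@le_trans _ _ (ph k)%:R) ?ler_nat//.
      by rewrite ler_peMl.
    by rewrite ltnNge small.
  rewrite ltnS in pm; rewrite addr0 /wt pm.
  have H1 : (1 - eps) * tau (m - ph k) (next k g) <= (1 - eps) * (A * pw beta (m - ph k)%N).
    by rewrite ler_pM2l ?subr_gt0//; apply: IH; [by rewrite ltn_subrL p0 (leq_trans p0 pm)|exact: reg_next].
  rewrite (le_trans H1)//.
  have H2 : pw beta (m - ph k)%N <= c `^ beta * pw beta m.
    apply: pw_scale => //; first by lra.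
    have : b * (ph k)%:R < m.+1%:R.
      by rewrite ltNge; apply/negP => /(n'_small _ p0); rewrite ltnNge small.
    rewrite -subSn// natrB ?leqW// /b => H.
    have c10 : 0 < c - 1 by lra.
    have : c * (ph k)%:R < m.+1%:R * (c - 1) by rewrite -ltr_pdivrMr// mulrAC.
    lra.
  rewrite cb in H2; have -> : 1 - eps / 2 = (1 - eps) * r by rewrite /r [RHS]mulrC divfK// gt_eqF// subr_gt0.
  have -> : (1 - eps) * r * A * pw beta m = (1 - eps) * (A * (r * pw beta m)) by ring.
  by rewrite (ler_pM2l (eqbRL (subr_gt0 _ _) e1)) (ler_pM2l A1).
have bind : bmeas Y (fun y => (n' < ph (part y))%:R : R).
  by apply: (bmeas_label mY matom (c := fun k => (n' < ph k)%:R) (K := 1)) => y _; case: (_ < _)%N; rewrite ?normr1 ?normr0.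
rewrite tau_wt; set a := (1 - eps / 2) * A * pw beta m in wt_le.
apply: (@le_trans _ _ (EX Y (fun y => a * g y + expR Kc * (n' < ph (part y))%:R))).
  apply: EX_le => //; first exact: bmeas_gwt.
    by apply: bmeasD; apply: bmeasZ => //; exact: reg_bmeas.
  move=> y Yy; have /andP[_ gK] := reg_bounds rg Yy; have g0 := ltW (reg_gt0 rg Yy).
  apply: (@le_trans _ _ (g y * (a + (n' < ph (part y))%:R))).
    by rewrite ler_wpM2l// wt_le//; exact: live_part.
  by rewrite mulrDr [g y * a]mulrC lerD2l ler_wpM2r.
have bg := reg_bmeas rg.
rewrite EXD ?EXZ//; [|exact: bmeasZ..].
rewrite rg.2 mulr1 /a.
apply: (@le_trans _ _ ((1 - eps / 2) * A * pw beta m + eps / 2 * A * pw beta m)); last first.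
  by rewrite -mulrDl -mulrDl subrK mul1r.
rewrite lerD2l (le_trans (ler_wpM2l (expR_ge0 _) (ph_tail n')))//.
apply: (@le_trans _ _ (expR Kc * (A0 * ((2 * b) `^ beta * pw beta m)))).
  rewrite ler_wpM2l ?expR_ge0// ler_wpM2l//; apply: pw_scale => //.
  by rewrite mulr_gt0.
rewrite [leLHS](_ : _ = expR Kc * (A0 * (2 * b) `^ beta) * pw beta m); last by ring.
by rewrite ler_wpM2r ?pw_ge0.
Qed.

(** * The renewal equation for observations from the base *)

Section Observable.
Variables (W : nat -> M -> R) (B : R).
Hypothesis bW : forall m, bmeas Y (W m).
Hypothesis W_le : forall m y, Y y -> `|W m y| <= B.
Hypothesis WF : forall m y, Y y -> (ph (part y) <= m)%N -> W m y = W (m - ph (part y))%N (F y).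

(* [obs m g] is the mean at time [m] of the process started with density [g], and
   [Kseq] that of the process started with density 1. Were every orbit regenerated
   at time 0, [obs] would be [Kseq]; to first order the delay until regeneration
   contributes [- tconv], and [defect] is what remains. *)
Definition Kseq : fps R := fun m => EX Y (W m).
Definition kappa : fps R := (1 - fpsX) * Kseq.
Definition obs m g := EX Y (fun y => g y * W m y).
Definition tconv m g := \sum_(j < m.+1) tau j g * kappa (m - j)%N.
Definition defect m g := obs m g - Kseq m + tconv m g.

Lemma sum_kappa m : \sum_(j < m.+1) kappa (m - j)%N = Kseq m.
Proof.
rewrite (reindex_inj rev_ord_inj)/=; under eq_bigr => i _ do rewrite subSS subKn ?leq_ord//.
by rewrite -fps_sum_ones /kappa mulrAC fps_geometric mul1r.
Qed.

Lemma sum_kappa_shift m p : (p <= m)%N ->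
  \sum_(p <= j < m.+1) kappa (m - j)%N = Kseq (m - p)%N.
Proof.
move=> pm; rewrite -{1}[p]add0n big_addn subSn// big_mkord -sum_kappa.
by apply: eq_bigr => i _; rewrite addnC subnDA.
Qed.

Lemma sum_wt_kappa m g k : (0 < ph k)%N -> \sum_(j < m.+1) wt j g k * kappa (m - j)%N =
  if (ph k <= m)%N then Kseq m - Kseq (m - ph k)%N + (1 - eps) * tconv (m - ph k)%N (next k g)
  else Kseq m.
Proof.
move=> p0; case: ifPn => [pm|]; last first.
  rewrite -ltnNge => mp; rewrite -sum_kappa; apply: eq_bigr => j _.
  by rewrite /wt leqNgt (leq_trans (ltn_ord j))// mul1r.
rewrite -(sum_kappa_shift pm) -[in Kseq m]sum_kappa.
rewrite -(big_mkord xpredT (fun j => wt j g k * kappa (m - j)%N)) -(big_mkord xpredT (fun j => kappa (m - j)%N)).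
rewrite (big_cat_nat (n := ph k))//=; last exact: leqW.
rewrite [X in X - _](big_cat_nat (n := ph k))//=; last exact: leqW.
rewrite addrK; congr (_ + _).
  by apply: eq_big_nat => j /andP[_ jp]; rewrite /wt leqNgt jp mul1r.
rewrite -{1}[ph k]add0n big_addn subSn// big_mkord mulr_sumr; apply: eq_bigr => i _.
by rewrite /wt leq_addl addnK -mulrA addnC subnDA.
Qed.

Lemma obs_norm_le m g : reg g -> `|obs m g| <= B.
Proof.
move=> rg; have bg := reg_bmeas rg.
rewrite (le_trans (EX_norm _ mY (bmeasM bg (bW m))))//.
rewrite (@le_trans _ _ (EX Y (fun y => g y * `|W m y|)))//.
  rewrite le_eqVlt; apply/orP; left; apply/eqP; apply: EX_ext => y Yy.
  by rewrite normrM ger0_norm// ltW// (reg_gt0 rg).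
by apply: EX_reg_le => //; [exact: bmeas_norm|exact: W_le].
Qed.

Lemma Kseq_norm_le m : `|Kseq m| <= B.
Proof. by apply: EXY_norm_le => //; exact: W_le. Qed.

Lemma bmeas_if (c : nat -> R) (K : R) m f : (forall k, live k -> `|c k| <= K) -> bmeas Y f ->
  bmeas Y (fun y => if (ph (part y) <= m)%N then c (part y) else f y).
Proof.
move=> cK [mf [L fL]]; split.
  apply: (measurable_fun_label mY matom (G := fun k y => if (ph k <= m)%N then c k else f y)) => k.
  by case: (_ <= _)%N => //; exact: measurable_cst.
exists (`|K| + `|L|) => y Yy; case: ifPn => _.
  by rewrite (le_trans (cK _ (live_part Yy)))// (le_trans (ler_norm _))// lerDl.
by rewrite (le_trans (fL _ Yy))// (le_trans (ler_norm _))// lerDr.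
Qed.

Lemma mix_norm_le (a b L : R) : `|a| <= L -> `|b| <= L -> `|eps * a + (1 - eps) * b| <= L.
Proof.
move=> aL bL; have e0 := eps_gt0; have e1 := eps_lt1.
rewrite (le_trans (ler_normD _ _))// (normrM eps) (normrM (1 - eps)).
rewrite (gtr0_norm e0) (gtr0_norm (eqbRL (subr_gt0 _ _) e1)).
have e1' : 0 <= 1 - eps by lra.
by have := ler_wpM2l (ltW e0) aL; have := ler_wpM2l e1' bL; lra.
Qed.

Lemma obs_step m g : reg g -> obs m g = EX Y (fun y => g y * (if (ph (part y) <= m)%N
  then eps * Kseq (m - ph (part y))%N + (1 - eps) * obs (m - ph (part y))%N (next (part y) g)
  else W m y)).
Proof.
move=> rg; have bg := reg_bmeas rg; have e0 := eps_gt0; have e1 := eps_lt1.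
have cB k : live k -> `|eps * Kseq (m - ph k)%N + (1 - eps) * obs (m - ph k)%N (next k g)| <= B.
  by move=> kn; rewrite mix_norm_le ?Kseq_norm_le ?obs_norm_le//; exact: reg_next.
apply: (EX_atoms_eq mY matom); first exact: bmeasM.
  by apply: bmeasM => //; exact: (bmeas_if (c := fun k => eps * Kseq (m - ph k)%N + (1 - eps) * obs (m - ph k)%N (next k g)) m cB (bW m)).
move=> k; have [kn|kn] := pselect (live k); last first.
  by rewrite /EX (_ : atom k = set0) ?Rintegral_set0//; apply/seteqP; split => // y ya; case: kn; exists y.
have [pm|mp] := boolP (ph k <= m)%N; last first.
  by apply: EX_ext => y [Yy /= ->]; rewrite (negbTE mp).
transitivity (EX (atom k) (fun y => g y * W (m - ph k)%N (F y))).
  by apply: EX_ext => y [Yy /= yk]; rewrite WF ?yk.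
rewrite (EX_next kn (reg_cone_atom k rg) (bW _)) -EXZr//; last exact: bmeasS (@atom_sub _ _ Y part k) bg.
by apply: EX_ext => y [Yy /= ->]; rewrite pm.
Qed.

Lemma tconv_step m g : reg g ->
  tconv m g = EX Y (fun y => g y * \sum_(j < m.+1) wt j g (part y) * kappa (m - j)%N).
Proof.
move=> rg; have bg := reg_bmeas rg; rewrite /tconv.
rewrite (eq_bigr (fun j : 'I_m.+1 => EX Y (fun y => g y * wt j g (part y) * kappa (m - j)%N))); last first.
  by move=> j _; rewrite tau_wt -EXZr//; exact: bmeas_gwt.
rewrite -EX_sum//; last by move=> j; apply: bmeasM; [exact: bmeas_gwt|exact: bmeas_cst].
by apply: EX_ext => y Yy; rewrite mulr_sumr; apply: eq_bigr => j _; rewrite mulrA.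
Qed.

Lemma defect_step m g : reg g -> defect m g = EX Y (fun y => g y *
  (if (ph (part y) <= m)%N then (1 - eps) * defect (m - ph (part y))%N (next (part y) g)
   else W m y)).
Proof.
move=> rg; have bg := reg_bmeas rg; have e0 := eps_gt0; have e1 := eps_lt1.
have KE : Kseq m = EX Y (fun y => g y * Kseq m) by rewrite EXZr// rg.2 mul1r.
rewrite {1}/defect (obs_step m rg) (tconv_step m rg) KE.
have cB k : live k -> `|eps * Kseq (m - ph k)%N + (1 - eps) * obs (m - ph k)%N (next k g)| <= B.
  by move=> kn; rewrite mix_norm_le ?Kseq_norm_le ?obs_norm_le//; exact: reg_next.
have b1 : bmeas Y (fun y => g y * (if (ph (part y) <= m)%N
  then eps * Kseq (m - ph (part y))%N + (1 - eps) * obs (m - ph (part y))%N (next (part y) g)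
  else W m y)).
  by apply: bmeasM => //; exact: (bmeas_if (c := fun k => eps * Kseq (m - ph k)%N + (1 - eps) * obs (m - ph k)%N (next k g)) m cB (bW m)).
have b2 : bmeas Y (fun y => g y * Kseq m) by apply: bmeasM => //; exact: bmeas_cst.
have b3 : bmeas Y (fun y => g y * \sum_(j < m.+1) wt j g (part y) * kappa (m - j)%N).
  apply: bmeasM => //; apply: bmeas_sum => j; apply: bmeasM; last exact: bmeas_cst.
  exact: bmeas_wt.
rewrite -EXB// -EXD//; last exact: bmeasB.
apply: EX_ext => y Yy; rewrite sum_wt_kappa; last exact/ph_gt0/live_part.
by case: ifPn => _; rewrite /defect; ring.
Qed.

(** By summation by parts, [Kseq m - tconv m g] is the contribution of the orbits regenerated at a
    time [j <= m], each observed as [Kseq (m - j)]. What [defect] retains is the orbits not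
    regenerated by time [m]: it obeys the recursion of [tau] with [W] in place of 1. *)
Lemma defect_norm_le m g : reg g -> `|defect m g| <= B * tau m g.
Proof.
elim/ltn_ind: m g => m IH g rg; have bg := reg_bmeas rg.
have e0 := eps_gt0; have e1 := eps_lt1.
have B0 : 0 <= B by rewrite (le_trans _ (Kseq_norm_le 0)).
have cB k : live k -> (ph k <= m)%N -> `|(1 - eps) * defect (m - ph k)%N (next k g)| <= B * wt m g k.
  move=> kn pm; rewrite /wt pm normrM gtr0_norm ?subr_gt0// mulrCA ler_pM2l ?subr_gt0//.
  have p0 := ph_gt0 kn; apply: IH; last exact: reg_next.
  by rewrite ltn_subrL p0 (leq_trans p0 pm).
rewrite (defect_step m rg) tau_wt -EXZ//; last exact: bmeas_gwt.
pose c k := if (ph k <= m)%N then (1 - eps) * defect (m - ph k)%N (next k g) else 0.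
have cc k : live k -> `|c k| <= B.
  move=> kn; rewrite /c; case: ifPn => [pm|_]; last by rewrite normr0.
  by rewrite (le_trans (cB _ kn pm))// ler_piMr//; have /andP[] := wt_bounds m rg kn.
have bI : bmeas Y (fun y => g y * (if (ph (part y) <= m)%N
    then (1 - eps) * defect (m - ph (part y))%N (next (part y) g) else W m y)).
  apply: eq_bmeas (bmeasM bg (bmeas_if m cc (bW m))) => y Yy.
  by rewrite /c; case: (ph (part y) <= m)%N.
rewrite (le_trans (EX_norm _ mY bI))//; apply: EX_le => //.
- exact: bmeas_norm.
- by apply: bmeasZ; exact: bmeas_gwt.
move=> y Yy; rewrite normrM (gtr0_norm (reg_gt0 rg Yy)) mulrCA ler_pM2l ?(reg_gt0 rg Yy)//.
have kn := live_part Yy; case: ifPn => pm; first exact: cB.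
by rewrite /wt (negbTE pm) mulr1 W_le.
Qed.

End Observable.

Definition observable (W : nat -> M -> R) (B : R) :=
  [/\ forall m, bmeas Y (W m), forall m y, Y y -> `|W m y| <= B &
      forall m y, Y y -> (ph (part y) <= m)%N -> W m y = W (m - ph (part y))%N (F y)].

(** For [g = 1] the terms [obs] and [Kseq] coincide, so [defect] is [t * kappa], which decays like
    the tail [t]. The inverse [(1 - x) u] of [t] decays at the same rate, hence so does [kappa]; a
    general [g] then follows from [obs - Kseq = defect - tconv]. *)
Lemma regeneration_rate : exists2 C, 0 < C & forall W B, observable W B -> forall m,
  `|kappa W m| <= C * B * pw beta m /\
  forall g, reg g -> `|obs W m g - Kseq W m| <= C * B * pw beta m.
Proof.
have [A A_gt0 tauA] := tau_tail; have b1 := beta1; have A_ge0 := ltW A_gt0.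
pose t : fps R := fun m => tau m (fun=> 1).
(* The law of the first regeneration time from the density 1, with [t] as its tail. *)
pose f : fps R := 1 - (1 - fpsX) * t.
have t0 : t 0%N = 1 by exact: tau0 reg_one.
have fS n : f n.+1 = t n - t n.+1.
  by rewrite /f mulrBl mul1r !fpsB fps1 fpsXMS/= sub0r opprB.
have f0 : f 0%N = 0 by rewrite /f mulrBl mul1r !fpsB fps1 fpsXM0 t0 /= subr0 subrr.
have f_ge0 n : 0 <= f n.
  by case: n => [|n]; rewrite ?f0// fS subr_ge0; exact: (wt_tau_mono n).1 _ reg_one.
have t_ge0 n : 0 <= t n by have /andP[] := tau_bounds n reg_one.
have tE n : t n = 1 - \sum_(k < n) f k.+1.
  elim: n => [|n IH]; first by rewrite big_ord0 subr0.
  by rewrite big_ord_recr/= fS; lra.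
have tA n : t n <= A * pw beta n by exact: tauA reg_one.
have fN : exists N, (0 < N)%N /\ 0 < f N /\ 0 < f N.+1.
  have [N [N0 [rN rN1]]] := regen_consecutive; exists N.
  have fpos n : regen n -> 0 < f n.
    by case: n => [[]//|n] [_ /(_ _ reg_one)] /= h; rewrite fS subr_gt0.
  by split => //; split; exact: fpos.
have [N hN] := fN; have [u uE] := renewal_seq_exists f0.
have [Cd Cd0 dC] := renewal_rate b1 f_ge0 f0 t_ge0 tE tA hN uE.
have [C1 C10 convC] := @cauchy_pw_stable R beta b1.
have td : t * ((1 - fpsX) * u) = 1 := tail_delta f0 tE uE.
pose Ck := C1 * Cd * A; have Ck0 : 0 < Ck by rewrite !mulr_gt0.
have Cd0' := ltW Cd0; have Ck0' := ltW Ck0; have C10' := ltW C10.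
pose C := Num.max Ck (A + C1 * A * Ck).
exists C; first by rewrite lt_max Ck0.
move=> W B [bW WB WF].
have B0 : 0 <= B by rewrite (le_trans _ (Kseq_norm_le bW WB 0)).
have D1 m : `|(t * kappa W) m| <= B * A * pw beta m.
  have : defect W m (fun=> 1) = (t * kappa W) m.
    rewrite /defect /obs /Kseq; under [X in EX Y X]eq_fun do rewrite mul1r.
    by rewrite subrr add0r.
  move=> <-; rewrite (le_trans (defect_norm_le bW WB WF m reg_one))// -mulrA.
  by rewrite ler_wpM2l//; exact: tA.
have kap m : `|kappa W m| <= Ck * B * pw beta m.
  have -> : kappa W = ((1 - fpsX) * u) * (t * kappa W) by rewrite mulrA [_ * t]mulrC td mul1r.
  rewrite (le_trans (convC Cd (B * A) _ _ m _ _ dC D1))// ?mulr_ge0//.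
  by rewrite le_eqVlt; apply/orP; left; apply/eqP; rewrite /Ck; ring.
move=> m; have P0 := pw_ge0 beta m; have BP : 0 <= B * pw beta m by rewrite mulr_ge0.
split.
  by rewrite -[leRHS]mulrA (le_trans (kap m))// -mulrA ler_wpM2r// le_max lexx.
move=> g rg; have := defect_norm_le bW WB WF m rg; rewrite /defect => D.
have T : `|tconv W m g| <= C1 * A * (Ck * B) * pw beta m.
  apply: (convC A (Ck * B) (fun j => tau j g) (kappa W) m) => //; first by rewrite mulr_ge0.
  by move=> j; have /andP[t1 _] := tau_bounds j rg; rewrite ger0_norm// tauA.
have tm := ler_wpM2l B0 (tauA m g rg).
apply: (@le_trans _ _ ((A + C1 * A * Ck) * (B * pw beta m))); last first.
  by rewrite -[leRHS]mulrA ler_wpM2r// le_max lexx orbT.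
have -> : obs W m g - Kseq W m = (obs W m g - Kseq W m + tconv W m g) - tconv W m g by ring.
rewrite (le_trans (ler_normB _ _))// (le_trans (lerD D T))//.
have -> : (A + C1 * A * Ck) * (B * pw beta m) = B * (A * pw beta m) + C1 * A * (Ck * B) * pw beta m by ring.
by rewrite lerD2r.
Qed.

Definition holder_atoms (V : M -> R) (L : R) := [/\ measurable_fun Y V,
  forall y, Y y -> `|V y| <= L &
  forall y y', Y y -> Y y' -> part y = part y' -> `|V y - V y'| <= L * ts y y'].

(** The offset keeps the function above [L], so its relative oscillation is at most [ts y y'], and
    [Kc >= 1]. *)
Lemma holder_cone k V L : 0 < L -> holder_atoms V L -> cone (atom k) Kc (fun y => V y + 2 * L).
Proof.
move=> L0 [mV VL VH]; have K1 := Kc_ge1.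
have lb y : Y y -> L <= V y + 2 * L.
  by move=> /VL; rewrite ler_norml => /andP[+ _]; lra.
split.
- apply: measurable_funD; last exact: measurable_cst.
  exact: measurable_funS (@atom_sub _ _ Y part k) mV.
- by move=> y [/lb + _]; apply: lt_le_trans.
move=> y y' [Yy /= py] [Yy' /= py'].
have t0 : 0 <= ts y y' by exact: ts_ge0.
have H := VH _ _ Yy Yy' (etrans py (esym py')).
have H1 : V y - V y' <= L * ts y y' by rewrite (le_trans (ler_norm _)).
have H2 := expR_ge1Dx (Kc * ts y y').
have H3 : ts y y' <= Kc * ts y y' by rewrite ler_peMl.
have H4 := lb _ Yy'.
have H5 : (V y' + 2 * L) * (1 + ts y y') <= (V y' + 2 * L) * expR (Kc * ts y y').
  by rewrite ler_wpM2l//; lra.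
have H6 : L * ts y y' <= (V y' + 2 * L) * ts y y' by rewrite ler_wpM2r.
by lra.
Qed.

(** On each atom [V] is the difference of [V + 2 L] and [2 L], both in the cone and with sum at most
    [5 L]. Arguing atom by atom retains the measure of the atoms marked by [P], which for
    [Vback v j] becomes the tail of the heights. *)
Lemma return_rate : exists2 C, 0 < C & forall W B, observable W B ->
  forall V L (P : pred nat), 0 < L -> holder_atoms V L ->
  (forall y, Y y -> ~~ P (part y) -> V y = 0) -> forall m,
  `|EX Y (fun y => V y * W m (F y)) - EX Y V * Kseq W m| <=
    C * B * L * pw beta m * EX Y (fun y => (P (part y))%:R).
Proof.
have [C C_gt0 HC] := regeneration_rate; exists (5 * C); first by rewrite mulr_gt0.
move=> W B obsW V L P L0 hV VP m; have [_ H] := HC W B obsW m.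
have [bW WB WF] := obsW; have C_ge0 := ltW C_gt0; have L_ge0 := ltW L0.
have B0 : 0 <= B by rewrite (le_trans _ (Kseq_norm_le bW WB 0)).
have P0 := pw_ge0 beta m; have e0 := eps_gt0; have e1 := eps_lt1.
have [mV VL VH] := hV.
have bV : bmeas Y V by split => //; exists L.
have bWF : bmeas Y (fun y => W m (F y)).
  have [mW [K WK]] := bW m; split; last by exists K => y Yy; apply/WK/F_stable.
  apply: (measurable_comp (F := Y)) => //; last exact: (gm_F_meas GM).
  by move=> _ [y Yy <-]; exact: F_stable.
have cone_rate k g : live k -> cone (atom k) Kc g ->
    `|EX (atom k) (fun y => g y * W m (F y)) - EX (atom k) g * Kseq W m| <=
    C * B * pw beta m * EX (atom k) g.
  move=> kn cg; rewrite (EX_next kn cg (bW m)) -/(mass k g).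
  have -> : mass k g * (eps * EX Y (W m) + (1 - eps) * EX Y (fun z => next k g z * W m z)) -
      mass k g * Kseq W m = (1 - eps) * (obs W m (next k g) - Kseq W m) * mass k g.
    by rewrite /obs /Kseq; ring.
  have m0 := ltW (mass_gt0 kn cg); rewrite normrM (ger0_norm m0) ler_wpM2r//.
  rewrite (normrM (1 - eps)) (gtr0_norm (eqbRL (subr_gt0 _ _) e1)).
  rewrite (le_trans _ (H _ (next_cone kn cg)))// ler_piMl//; lra.
pose f y := V y * W m (F y) - V y * Kseq W m.
pose c := 5 * C * B * L * pw beta m.
have c0 : 0 <= c by rewrite /c !mulr_ge0.
have bf : bmeas Y f by apply: bmeasB; apply: bmeasM => //; exact: bmeas_cst.
have bP : bmeas Y (fun y => (P (part y))%:R : R).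
  by apply: (bmeas_label mY matom (c := fun k => (P k)%:R) (K := 1)) => y _;
    case: (P _); rewrite ?normr1 ?normr0.
have bcP : bmeas Y (fun y => c * (P (part y))%:R) by exact: bmeasZ.
have fP k : `|EX (atom k) f| <= EX (atom k) (fun y => c * (P (part y))%:R).
  have sub := @atom_sub _ _ Y part k.
  have [kn|kn] := pselect (live k); last first.
    rewrite /EX (_ : atom k = set0) ?Rintegral_set0 ?normr0//.
    by apply/seteqP; split => // y ya; case: kn; exists y.
  have [Pk|Pk] := boolP (P k); last first.
    rewrite (@EX_ext _ _ _ _ _ f (fun=> 0)).
      by rewrite EX_cst// mul0r normr0; apply: EX_ge0 => y _; rewrite mulr_ge0.
    by move=> y [Yy /= yk]; rewrite /f VP ?yk// !mul0r subrr.
  have bVa := bmeasS mY sub bV; have bWFa := bmeasS mY sub bWF.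
  have bL : bmeas (atom k) (fun=> 2 * L) by exact: bmeas_cst.
  have bg1 := bmeasD bVa bL.
  have cL : cone (atom k) Kc (fun=> 2 * L).
    split => [|y _|y y' _ _]; [exact: measurable_cst|by rewrite mulr_gt0|].
    rewrite ler_peMr ?mulr_ge0// -[leLHS]expR0 ler_expR mulr_ge0 ?ts_ge0//; exact: Kc_ge0.
  have R1 := cone_rate k _ kn (holder_cone k L0 hV).
  have R2 := cone_rate k _ kn cL.
  have -> : EX (atom k) f =
      (EX (atom k) (fun y => (V y + 2 * L) * W m (F y)) - EX (atom k) (fun y => V y + 2 * L) * Kseq W m) -
      (EX (atom k) (fun y => 2 * L * W m (F y)) - EX (atom k) (fun=> 2 * L) * Kseq W m).
    rewrite -!EXZr// -!EXB//.
    - by apply: EX_ext => y _; rewrite /f; ring.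
    - by apply: bmeasB; apply: bmeasM => //; exact: bmeas_cst.
    - by apply: bmeasB; apply: bmeasM => //; exact: bmeas_cst.
    - exact: bmeasM.
    - by apply: bmeasM => //; exact: bmeas_cst.
    - exact: bmeasM.
    - by apply: bmeasM => //; exact: bmeas_cst.
  rewrite (le_trans (ler_normB _ _))// (le_trans (lerD R1 R2))//.
  rewrite -mulrDr -EXD// -EXZ//; last exact: bmeasD.
  apply: EX_le => //.
  - by apply: bmeasZ; exact: bmeasD.
  - exact: bmeasS mY sub bcP.
  move=> y [Yy /= yk]; rewrite yk Pk mulr1 /c.
  have V3 : V y + 2 * L + 2 * L <= 5 * L.
    by have := VL _ Yy; rewrite ler_norml => /andP[_]; lra.
  rewrite (_ : 5 * C * B * L * pw beta m = C * B * pw beta m * (5 * L)); last by ring.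
  by rewrite ler_wpM2l// !mulr_ge0.
have -> : EX Y (fun y => V y * W m (F y)) - EX Y V * Kseq W m = EX Y f.
  rewrite -EXZr// -EXB//; first exact: bmeasM.
  by apply: bmeasM => //; exact: bmeas_cst.
rewrite -/c -EXZ// ler_norml; apply/andP; split.
  rewrite lerNl -mulN1r -EXZ//; apply: (EX_atoms_le mY matom) => // [|k]; first exact: bmeasZ.
  rewrite EXZ ?mulN1r; last exact: bmeasS mY (@atom_sub _ _ Y part k) bf.
    by have := fP k; rewrite ler_norml => /andP[+ _]; rewrite lerNl.
  exact: matom.
apply: (EX_atoms_le mY matom) => // k.
by have := fP k; rewrite ler_norml => /andP[].
Qed.

End Regeneration.
End GibbsMarkov.

(** * Correlations on the tower *)

Section Tower.
Context {R : realType} d0 (M : measurableType d0) (muY : probability M R).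
Variables (Y : set M) (part : M -> nat) (F : M -> M) (xi : M -> R) (theta C0 : R).
Hypothesis mY : measurable Y.
Hypothesis muY1 : muY Y = 1%E.
Hypothesis GM : gibbs_markov muY Y part F xi theta C0.
Variables (ph : nat -> nat) (A0 beta : R) (Phi : M -> nat).
Hypothesis ph_gt0 : forall k, live Y part k -> (0 < ph k)%N.
Hypothesis beta1 : 1 < beta.
Hypothesis ph_tail : forall n, EX muY Y (fun y => (n < ph (part y))%:R) <= A0 * pw beta n.
Hypothesis ph_gcd : forall e, (forall k, live Y part k -> (e %| ph k)%N) -> (e %| 1)%N.
Hypothesis PhiE : forall y, Y y -> Phi y = ph (part y).

Local Notation EX := (EX muY).
Local Notation fD := (fDelta F Phi).
Let matom k : measurable (atom Y part k) := gm_part_meas GM k.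

Definition tobs (w : M -> nat -> R) n y l := w (iter n fD (y, l)).1 (iter n fD (y, l)).2.

Lemma Phi_gt0 y : Y y -> (0 < Phi y)%N.
Proof. by move=> Yy; rewrite PhiE//; exact/ph_gt0/live_part. Qed.

Lemma iter_fD_up n y l : (l + n < Phi y)%N -> iter n fD (y, l) = (y, l + n)%N.
Proof.
elim: n => [|n IH] lt; first by rewrite addn0.
by rewrite iterS IH; [rewrite /fDelta/= -addnS lt|lia].
Qed.

Lemma tobs_up w n y l : (l + n < Phi y)%N -> tobs w n y l = w y (l + n)%N.
Proof. by move=> lt; rewrite /tobs iter_fD_up. Qed.

Lemma tobs_base w n y l : (l < Phi y)%N -> (Phi y - l <= n)%N ->
  tobs w n y l = tobs w (n - (Phi y - l))%N (F y) 0%N.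
Proof.
move=> lt le; rewrite /tobs -{1 2}(subnK le) iterD.
suff -> : iter (Phi y - l) fD (y, l) = (F y, 0%N) by [].
have -> : (Phi y - l = (Phi y - l.+1).+1)%N by lia.
rewrite iterS iter_fD_up; last by lia.
by rewrite /fDelta/= ifF//; lia.
Qed.

Definition tower_bd (w : M -> nat -> R) (B : R) :=
  (forall l, measurable_fun Y (fun y => w y l)) /\
  forall y l, Y y -> (l < Phi y)%N -> `|w y l| <= B.

Definition tower_holder (v : M -> nat -> R) (L : R) := tower_bd v L /\
  forall y y' l, Y y -> Y y' -> (l < Phi y)%N -> `|v y l - v y' l| <= L * ts part F theta y y'.

Lemma measurable_tobs w n : (forall l, measurable_fun Y (fun y => w y l)) ->
  measurable_fun Y (fun y => tobs w n y 0%N).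
Proof.
move=> mw; elim/ltn_ind: n => n IH.
pose G k y := if (0 < ph k <= n)%N then tobs w (n - ph k)%N (F y) 0%N else w y n.
apply: (@eq_measurable_fun _ _ _ _ _ (fun y => G (part y) y)).
  move=> y /[!inE] Yy; have P0 := Phi_gt0 Yy; rewrite /G -PhiE// P0/=.
  by case: leqP => [le|lt]; [rewrite (@tobs_base w n y 0%N)// subn0|rewrite tobs_up].
apply: (measurable_fun_label mY matom) => k; rewrite /G.
case: (boolP (0 < ph k <= n)%N) => [/andP[k0 kn]|_]; last exact: mw.
apply: (@measurable_comp _ _ _ _ _ _ Y (fun y => tobs w (n - ph k)%N y 0%N)) => //.
- by move=> _ [y Yy <-]; exact: (F_stable GM).
- by apply: IH; rewrite ltn_subrL k0 (leq_trans k0 kn).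
- exact: (gm_F_meas GM).
Qed.

Lemma tobs_norm_le w B n y l : tower_bd w B -> Y y -> (l < Phi y)%N -> `|tobs w n y l| <= B.
Proof.
move=> [_ wB]; elim/ltn_ind: n y l => n IH y l Yy lP.
have [lt|le] := ltnP (l + n) (Phi y); first by rewrite tobs_up// wB.
rewrite tobs_base//; last by lia.
have FY := F_stable GM Yy; apply: IH => //; last exact: Phi_gt0.
by rewrite ltn_subrL; lia.
Qed.

Lemma observable_tobs w B : tower_bd w B -> observable Y part F ph (fun n y => tobs w n y 0%N) B.
Proof.
move=> bw; have nb n y : Y y -> `|tobs w n y 0%N| <= B.
  by move=> Yy; exact: tobs_norm_le bw Yy (Phi_gt0 Yy).
split => //.
  by move=> n; split; [apply: measurable_tobs; case: bw|exists B; exact: nb].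
move=> n y Yy; rewrite -PhiE// => le; rewrite (@tobs_base w n y 0%N)// ?subn0//.
exact: Phi_gt0.
Qed.

Lemma bmeas_FY (W : M -> R) : bmeas Y W -> bmeas Y (fun y => W (F y)).
Proof.
move=> [mW [K WK]]; split; last by exists K => y Yy; apply/WK/(F_stable GM).
apply: (measurable_comp (F := Y)) => //; last exact: (gm_F_meas GM).
by move=> _ [y Yy <-]; exact: (F_stable GM).
Qed.

Lemma EX_invariant (W : M -> R) : bmeas Y W -> EX Y (fun y => W (F y)) = EX Y W.
Proof.
have pos g : bmeas Y g -> (forall y, Y y -> 0 <= g y) -> EX Y (fun y => g (F y)) = EX Y g.
  move=> [mg _] g0; rewrite /EX /Rintegral; congr fine.
  rewrite (@ge0_integral_transfer _ M R muY Y Y (fun=> 1) F (fun y => (g y)%:E))//.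
  - by apply: eq_integral => y _; rewrite mule1.
  - exact: (gm_F_meas GM).
  - by move=> x; exact: (F_stable GM).
  - move=> A mA; rewrite integral_cst ?mul1e; last exact: measurableI.
    rewrite -[RHS](gm_F_pres GM); last exact: measurableI.
    congr (muY _); apply/seteqP; split => y [Yy Ay]; split => //; last by case: Ay.
    by split => //; exact: (F_stable GM).
  - exact/measurable_EFinP.
move=> bW; have [mW [K WK]] := bW.
have bK : bmeas Y (fun=> K) by exact: bmeas_cst.
have := pos _ (bmeasD bW bK); rewrite !EXD//; last exact: bmeas_FY.
move=> /(_ _)/addIr; apply => y /WK; rewrite ler_norml => /andP[+ _].
by rewrite -subr_ge0 opprK.
Qed.

(** * Tails and mean of the column heights *)

Definition ptail n : R := EX Y (fun y => (n < ph (part y))%:R).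

Lemma bmeas_label01 (P : pred nat) : bmeas Y (fun y => (P (part y))%:R : R).
Proof.
by apply: (bmeas_label mY matom (c := fun k => (P k)%:R) (K := 1)) => y _;
  case: (P _); rewrite ?normr1 ?normr0.
Qed.

Lemma ptail_ge0 n : 0 <= ptail n.
Proof. by apply: EX_ge0 => y _; exact: ler0n. Qed.

Lemma A0_ge0 : 0 <= A0.
Proof. by have := ph_tail 0; rewrite pw0 mulr1; apply: le_trans; exact: ptail_ge0. Qed.

Lemma ptail_fin n : (\int[muY]_(y in Y) (n < Phi y)%:R%:E)%E = (ptail n)%:E.
Proof.
rewrite /ptail /EX /Rintegral fineK.
  by apply: eq_integral => y /[!inE] Yy; rewrite PhiE.
by apply: integrable_fin_num => //; apply: bmeas_int => //; exact: (bmeas_label01 (fun k => n < ph k)%N).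
Qed.

Lemma measurable_Phi_label d' (T' : measurableType d') (G : nat -> M -> T') :
  (forall k, measurable_fun Y (G k)) -> measurable_fun Y (fun y => G (Phi y) y).
Proof.
move=> mG; apply: (@eq_measurable_fun _ _ _ _ _ (fun y => G (ph (part y)) y)).
  by move=> y /[!inE] Yy; rewrite PhiE.
by apply: (measurable_fun_label mY matom (G := fun k => G (ph k))) => k; exact: mG.
Qed.

Lemma int_Phi : (\int[muY]_(y in Y) (Phi y)%:R%:E)%E = (\sum_(0 <= j <oo) (ptail j)%:E)%E.
Proof.
transitivity (\int[muY]_(y in Y) \sum_(0 <= j <oo) (j < Phi y)%:R%:E)%E.
  apply: eq_integral => y _; rewrite (nneseries_split _ (Phi y)); last by move=> k _; rewrite lee_fin ler0n.
  rewrite add0n eseries0 ?adde0; last by move=> i le _; rewrite ltnNge le.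
  rewrite sumEFin big_mkord (eq_bigr (fun=> 1)) ?sumr_const ?card_ord//.
  by move=> i _; rewrite ltn_ord.
rewrite integral_nneseries//.
- by apply: eq_eseriesr => i _; exact: ptail_fin.
- move=> n; apply/measurable_EFinP.
  by apply: (measurable_Phi_label (G := fun k _ => (n < k)%:R : R)) => k; exact: measurable_cst.
Qed.

Lemma ptail_series_le n : (\sum_(n <= j <oo) (ptail j)%:E <=
  (A0 * (beta / (beta - 1) * pw (beta - 1) n))%:E)%E.
Proof.
apply: lime_le; first by apply: is_cvg_nneseries => k _ _; rewrite lee_fin ptail_ge0.
apply: nearW => k; rewrite sumEFin lee_fin.
apply: (@le_trans _ _ (\sum_(n <= j < k) A0 * pw beta j)); first by apply: ler_sum => j _; exact: ph_tail.
by rewrite -mulr_sumr ler_wpM2l ?A0_ge0// sum_pw_tail.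
Qed.

Lemma ptail_series_fin n : (\sum_(n <= j <oo) (ptail j)%:E)%E \is a fin_num.
Proof.
rewrite ge0_fin_numE; last by apply: nneseries_ge0 => k _ _; rewrite lee_fin ptail_ge0.
exact: le_lt_trans (ptail_series_le n) (ltry _).
Qed.

(** The mean of [(Phi - n)^+], written as a sum of tails. *)
Definition btail n : R := fine (\sum_(n <= j <oo) (ptail j)%:E)%E.

Lemma btailS n : btail n - btail n.+1 = ptail n.
Proof.
rewrite /btail (nneseries_split _ 1); last by move=> k _; rewrite lee_fin ptail_ge0.
by rewrite !addn1 big_nat1 fineD ?ptail_series_fin//= addrK.
Qed.

Lemma btail_bounds n : 0 <= btail n <= A0 * (beta / (beta - 1)) * pw (beta - 1) n.
Proof.
apply/andP; split.
  by apply: fine_ge0; apply: nneseries_ge0 => k _ _; rewrite lee_fin ptail_ge0.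
rewrite -lee_fin /btail fineK ?ptail_series_fin// -mulrA; exact: ptail_series_le.
Qed.

Lemma Phi_integrable : muY.-integrable Y (fun y => (Phi y)%:R%:E).
Proof.
apply/integrableP; split.
  apply/measurable_EFinP.
  by apply: (measurable_Phi_label (G := fun k _ => k%:R : R)) => k; exact: measurable_cst.
under eq_integral do rewrite gee0_abs ?lee_fin ?ler0n//.
by rewrite int_Phi (le_lt_trans (ptail_series_le 0))// ltry.
Qed.

Lemma Phibar_btail : Phibar muY Y Phi = btail 0.
Proof. by rewrite /Phibar /Rintegral int_Phi. Qed.

Lemma btail0_gt0 : 0 < btail 0.
Proof.
have := btailS 0; have /andP[b0 _] := btail_bounds 1.
have -> : ptail 0 = 1.
  rewrite /ptail -[RHS](EXY_cst mY muY1); apply: EX_ext => y Yy.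
  by rewrite ph_gt0//; exact: live_part.
lra.
Qed.

(* [Tsum] is the part of [Rsum] due to the orbits still in their column at time
   [n]; [Vback v j] collects the values of [v] from which the top of the column is
   [j] steps away. *)
Definition Rsum (v w : M -> nat -> R) n y : R := \sum_(l < Phi y) v y l * tobs w n y l.
Definition Tsum (v w : M -> nat -> R) n y : R :=
  \sum_(l < Phi y) (if (l + n < Phi y)%N then v y l * w y (l + n)%N else 0).
Definition Vback (v : M -> nat -> R) j y : R := if (j < Phi y)%N then v y (Phi y - j.+1)%N else 0.
Definition tmean (v : M -> nat -> R) : R := EX Y (fun y => \sum_(l < Phi y) v y l).
Definition one2 : M -> nat -> R := fun _ _ => 1.

Lemma tower_integrable (c : M -> nat -> R) D :
  (forall l, measurable_fun Y (fun y => c y l)) ->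
  (forall y l, Y y -> (l < Phi y)%N -> `|c y l| <= D) ->
  muY.-integrable Y (fun y => (\sum_(l < Phi y) c y l)%:E).
Proof.
move=> mc cD; apply: (le_integrable mY _ _ (integrableZl mY D Phi_integrable)).
  apply/measurable_EFinP; apply: (measurable_Phi_label (G := fun k y => \sum_(l < k) c y l)) => k.
  exact: measurable_sum.
move=> y Yy; rewrite lee_fin normrM normr_nat (le_trans (ler_norm_sum _ _ _))//.
apply: (@le_trans _ _ (\sum_(l < Phi y) `|D|)); last by rewrite sumr_const card_ord mulr_natr.
by apply: ler_sum => l _; rewrite (le_trans (cD _ _ Yy (ltn_ord l)))// ler_norm.
Qed.

Lemma tower_EX_norm_le (c : M -> nat -> R) D :
  (forall l, measurable_fun Y (fun y => c y l)) ->
  (forall y l, Y y -> (l < Phi y)%N -> `|c y l| <= D) ->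
  `|EX Y (fun y => \sum_(l < Phi y) c y l)| <= D * btail 0.
Proof.
move=> mc cD; have ic := tower_integrable mc cD.
rewrite (le_trans (le_normr_Rintegral mY ic))// -Phibar_btail /Phibar.
rewrite -RintegralZl//; last exact: Phi_integrable.
apply: le_Rintegral => //.
- exact: integrable_norm ic.
- exact: (integrableZl mY D Phi_integrable).
move=> y Yy; rewrite (le_trans (ler_norm_sum _ _ _))//.
apply: (@le_trans _ _ (\sum_(l < Phi y) D)); last by rewrite sumr_const card_ord mulr_natr.
by apply: ler_sum => l _; exact: cD.
Qed.

Lemma tobs_one n y l : tobs one2 n y l = 1. Proof. by []. Qed.

(** A point at level [Phi y - j.+1] reaches the base at [F y] after [j.+1] steps, so the orbits that
    return by time [n] are those with [j < n]. *)
Lemma Rsum_decomp v w n y : Y y ->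
  Rsum v w n y = Tsum v w n y + \sum_(j < n) Vback v j y * tobs w (n - j.+1)%N (F y) 0%N.
Proof.
move=> Yy; pose H j := v y (Phi y - j.+1)%N * tobs w (n - j.+1)%N (F y) 0%N.
apply/eqP; rewrite addrC -subr_eq; apply/eqP; rewrite /Rsum /Tsum -sumrB.
transitivity (\sum_(j < Phi y | (j < n)%N) H j).
  rewrite [LHS](reindex_inj rev_ord_inj)/= [RHS]big_mkcond/=; apply: eq_bigr => j _.
  have jP := ltn_ord j; have -> : (Phi y - j.+1 + n < Phi y)%N = ~~ (j < n)%N by apply/idP/idP; lia.
  have [jn|nj] := boolP (j < n)%N; last by rewrite /= tobs_up ?subrr//; lia.
  rewrite /= subr0 /H tobs_base//; try lia.
  by have -> : (Phi y - (Phi y - j.+1) = j.+1)%N by lia.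
rewrite (big_ord_widen_cond (Phi y + n) (fun j => (j < n)%N) H) ?leq_addr//.
rewrite [RHS](_ : _ = \sum_(j < n | (j < Phi y)%N) H j); last first.
  by rewrite [RHS]big_mkcond/=; apply: eq_bigr => j _; rewrite /Vback /H; case: ifP; rewrite ?mul0r.
rewrite [RHS](big_ord_widen_cond (Phi y + n) (fun j => (j < Phi y)%N) H) ?leq_addl//.
by apply: eq_bigl => j; rewrite andbC.
Qed.

Lemma Tsum_integrable v w L B n : tower_bd v L -> tower_bd w B ->
  muY.-integrable Y (EFin \o Tsum v w n).
Proof.
move=> [mv vL] [mw wB].
apply: (@tower_integrable (fun y l => if (l + n < Phi y)%N then v y l * w y (l + n)%N else 0) (`|L| * `|B|)).
  move=> l; apply: (measurable_Phi_label
    (G := fun k y => if (l + n < k)%N then v y l * w y (l + n)%N else 0)) => k.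
  by case: (_ < _)%N; [exact: measurable_funM|exact: measurable_cst].
move=> y l Yy lP; case: ifPn => [lnP|_]; last by rewrite normr0 mulr_ge0.
rewrite normrM ler_pM//; first by rewrite (le_trans (vL _ _ Yy lP))// ler_norm.
by rewrite (le_trans (wB _ _ Yy lnP))// ler_norm.
Qed.

Lemma Vback_bmeas v L j : tower_bd v L -> bmeas Y (Vback v j).
Proof.
move=> [mv vL]; split.
  apply: (measurable_Phi_label (G := fun k y => if (j < k)%N then v y (k - j.+1)%N else 0)) => k.
  by case: (_ < _)%N; [exact: mv|exact: measurable_cst].
exists `|L| => y Yy; rewrite /Vback; case: ifPn => [jP|_]; last by rewrite normr0.
by rewrite (le_trans (vL _ _ Yy _)) ?ler_norm//; lia.
Qed.

Lemma Vback_holder v L j : 0 <= L -> tower_holder v L -> holder_atoms Y part F theta (Vback v j) L.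
Proof.
move=> L0 [bv vH]; have [mv vL] := bv; split.
- by case: (Vback_bmeas j bv).
- move=> y Yy; rewrite /Vback; case: ifPn => [jP|_]; last by rewrite normr0.
  by apply: vL => //; lia.
move=> y y' Yy Yy' yy'; have PP : Phi y = Phi y' by rewrite !PhiE// yy'.
rewrite /Vback -PP; case: ifPn => [jP|_]; first by apply: vH => //; lia.
by rewrite subrr normr0 mulr_ge0// ts_ge0// (gm_theta GM).
Qed.

Lemma bmeas_tobsF w B n : tower_bd w B -> bmeas Y (fun y => tobs w n (F y) 0%N).
Proof.
move=> bw; have [bW _ _] := observable_tobs bw.
exact: (bmeas_FY (W := fun y => tobs w n y 0%N)).
Qed.

Lemma Rsum_integrable v w L B n : tower_bd v L -> tower_bd w B ->
  muY.-integrable Y (EFin \o Rsum v w n).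
Proof.
move=> bv bw; have bS : bmeas Y (fun y => \sum_(j < n) Vback v j y * tobs w (n - j.+1)%N (F y) 0%N).
  by apply: bmeas_sum => j; apply: bmeasM; [exact: Vback_bmeas bv|exact: bmeas_tobsF bw].
have := integrableD mY (Tsum_integrable n bv bw) (bmeas_int muY mY bS).
by apply: eq_integrable => // y /[!inE] Yy /=; rewrite Rsum_decomp// EFinD.
Qed.

Lemma EX_Rsum v w L B n : tower_bd v L -> tower_bd w B ->
  EX Y (Rsum v w n) = EX Y (Tsum v w n) +
    \sum_(j < n) EX Y (fun y => Vback v j y * tobs w (n - j.+1)%N (F y) 0%N).
Proof.
move=> bv bw; have bM j : bmeas Y (fun y => Vback v j y * tobs w (n - j.+1)%N (F y) 0%N).
  by apply: bmeasM; [exact: Vback_bmeas bv|exact: bmeas_tobsF bw].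
have bS : bmeas Y (fun y => \sum_(j < n) Vback v j y * tobs w (n - j.+1)%N (F y) 0%N).
  by apply: bmeas_sum => j; exact: bM.
rewrite (EX_ext _ (Rsum_decomp v w n)).
transitivity (EX Y (Tsum v w n) + EX Y (fun y => \sum_(j < n) Vback v j y * tobs w (n - j.+1)%N (F y) 0%N)).
  by rewrite /EX RintegralD//; [exact: Tsum_integrable bv bw|exact: bmeas_int].
by rewrite EX_sum.
Qed.

Lemma tower_bd_one : tower_bd one2 1.
Proof. by split => [l|y l _ _]; [exact: measurable_cst|rewrite normr1]. Qed.

Lemma tower_holder_one : tower_holder one2 1.
Proof.
split; first exact: tower_bd_one.
by move=> y y' l _ _ _; rewrite subrr normr0 mul1r ts_ge0// (gm_theta GM).
Qed.

Lemma Rsum_one v n : EX Y (Rsum v one2 n) = tmean v.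
Proof. by apply: EX_ext => y _; apply: eq_bigr => l _; rewrite tobs_one mulr1. Qed.

Lemma tmean_decomp v L n : tower_bd v L ->
  tmean v = EX Y (Tsum v one2 n) + \sum_(j < n) EX Y (Vback v j).
Proof.
move=> bv; rewrite -(Rsum_one v n) (EX_Rsum n bv tower_bd_one); congr (_ + _).
by apply: eq_bigr => j _; apply: EX_ext => y _; rewrite tobs_one mulr1.
Qed.

(** One more step replaces, in each column, the observation from the bottom level by the one from
    [F y]; the two have equal means by the invariance of [muY]. *)
Lemma Rsum_invariant w B n : tower_bd w B -> EX Y (Rsum one2 w n) = tmean w.
Proof.
move=> bw; elim: n => [|n IH].
  by apply: EX_ext => y _; apply: eq_bigr => l _; rewrite mul1r.
have [bW _ _] := observable_tobs bw; have bWF := bmeas_tobsF n bw.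
have step y : Y y -> Rsum one2 w n.+1 y = Rsum one2 w n y + (tobs w n (F y) 0%N - tobs w n y 0%N).
  move=> Yy; have P0 := Phi_gt0 Yy; rewrite /Rsum.
  case E: (Phi y) P0 => [//|p] _; rewrite [LHS]big_ord_recr [X in _ = X + _]big_ord_recl/=.
  rewrite (eq_bigr (fun l : 'I_p => one2 y (lift ord0 l) * tobs w n y (lift ord0 l))); last first.
    move=> l _; congr (_ * _); rewrite /tobs iterSr /fDelta/= E ifT//.
    by have := ltn_ord l; lia.
  have -> : tobs w n.+1 y p = tobs w n (F y) 0%N by rewrite /tobs iterSr /fDelta/= E ltnn.
  by rewrite /one2 !mul1r; ring.
rewrite (EX_ext _ step) /EX RintegralD//; last 2 first.
- exact: Rsum_integrable tower_bd_one bw.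
- by apply: bmeas_int => //; exact: bmeasB.
rewrite -/(EX Y _) IH -[X in _ + X]/(EX Y (fun y => tobs w n (F y) 0%N - tobs w n y 0%N)).
rewrite EXB//.
by rewrite (EX_invariant (W := fun y => tobs w n y 0%N))// subrr addr0.
Qed.

Lemma EX_Vback_one j : EX Y (Vback one2 j) = ptail j.
Proof. by apply: EX_ext => y Yy; rewrite /Vback PhiE//; case: ifP. Qed.

Lemma tmean_one : tmean one2 = btail 0.
Proof.
by rewrite -Phibar_btail; apply: EX_ext => y _; rewrite /one2 sumr_const card_ord.
Qed.

Lemma Tsum_one n : EX Y (Tsum one2 one2 n) = btail n.
Proof.
have := tmean_decomp n tower_bd_one; rewrite tmean_one.
under [X in _ + X]eq_bigr do rewrite EX_Vback_one.
have -> : btail 0 = btail n + \sum_(j < n) ptail j.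
  elim: n => [|n IH]; first by rewrite big_ord0 addr0.
  by rewrite big_ord_recr/= {1}IH -btailS; ring.
by move/addIr.
Qed.

Let Kw w : fps R := Kseq muY Y (fun n y => tobs w n y 0%N).
Let kap w : fps R := kappa muY Y (fun n y => tobs w n y 0%N).
Let Vt v : fps R := fun n => EX Y (Tsum v one2 n).

(** Summation by parts: the means of [Vback v j] have partial sums [tmean v - Vt v n], which moves
    the difference onto [Kw]. *)
Lemma Vback_conv v w L n : tower_bd v L ->
  \sum_(j < n) EX Y (Vback v j) * Kw w (n - j.+1)%N = tmean v * Kw w n - (Vt v * kap w) n.
Proof.
move=> bv; pose a : fps R := fun n => if n is j.+1 then EX Y (Vback v j) else 0.
have aE : a = fpsC (tmean v) - (1 - fpsX) * Vt v.
  apply/funext => -[|m]; rewrite fpsB mulrBl mul1r fpsB /=.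
    by rewrite fpsXM0 subr0 /Vt -(Rsum_one v 0) (EX_Rsum 0 bv tower_bd_one) big_ord0 addr0 subrr.
  rewrite fpsXMS sub0r opprB /Vt; apply/eqP; rewrite -subr_eq0; apply/eqP.
  have := tmean_decomp m bv; have := tmean_decomp m.+1 bv; rewrite big_ord_recr/=; lra.
transitivity ((a * Kw w) n).
  rewrite fpsM big_ord_recl mul0r add0r; apply: eq_bigr => j _.
  by rewrite lift0.
have -> : Vt v * kap w = (1 - fpsX) * Vt v * Kw w by rewrite /kap /kappa -/(Kw w); ring.
by rewrite aE mulrBl fpsB fpsCM.
Qed.

Lemma obs_bound_ge0 w B : tower_bd w B -> 0 <= B.
Proof.
move=> bw; have [bW WB _] := observable_tobs bw.
exact: le_trans (normr_ge0 _) (EXY_norm_le mY muY1 (bW 0%N) (WB 0%N)).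
Qed.

(** The function [Vback v j] lives on columns higher than [j], so [return_rate] bounds its term by
    [pw beta j * pw beta (n - j.+1)], and the convolution of the two powers is again
    [O(pw beta n)]. *)
Lemma correlation_rate : exists2 C, 0 < C & forall v L w B, 0 < L ->
  tower_holder v L -> tower_bd w B -> forall n,
  `|EX Y (Rsum v w n) - EX Y (Tsum v w n) - (tmean v * Kw w n - (Vt v * kap w) n)| <=
    C * L * B * pw beta n.
Proof.
have [C C_gt0 HC] := return_rate mY muY1 GM ph_gt0 beta1 ph_tail ph_gcd.
have [C1 C1_gt0 HC1] := @cauchy_pw_stable R beta beta1.
have b0 : 0 <= beta by have := beta1; lra.
have A0' := A0_ge0; have c0 : 0 <= 2 `^ beta :> R by exact: powR_ge0.
exists (1 + C * A0 * C1 * 2 `^ beta); first by rewrite ltr_pwDl// !mulr_ge0// ltW.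
move=> v L w B L0 hv bw n; have [bv _] := hv; have oW := observable_tobs bw.
have B0 := obs_bound_ge0 bw; have L0' := ltW L0; have C0' := ltW C_gt0; have C10' := ltW C1_gt0.
rewrite (EX_Rsum n bv bw) -(Vback_conv w n bv) [_ + _ - EX Y (Tsum v w n)]addrAC subrr add0r -sumrB.
apply: (@le_trans _ _ (C * A0 * C1 * 2 `^ beta * (L * B * pw beta n))); last first.
  rewrite [leRHS](_ : _ = (1 + C * A0 * C1 * 2 `^ beta) * (L * B * pw beta n)); last by ring.
  by rewrite ler_wpM2r ?lerDr// !mulr_ge0 ?pw_ge0.
rewrite (le_trans (ler_norm_sum _ _ _))//.
apply: (@le_trans _ _ (\sum_(j < n) C * B * L * A0 * (pw beta j * pw beta (n - j.+1)%N))).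
  apply: ler_sum => j _.
  have := HC _ _ oW (Vback v j) L (fun k => (j < ph k)%N) L0 (Vback_holder j L0' hv).
  have V0 y : Y y -> ~~ (j < ph (part y))%N -> Vback v j y = 0.
    by move=> Yy /negbTE jP; rewrite /Vback PhiE// jP.
  move=> /(_ V0 (n - j.+1)%N) H; rewrite (le_trans H)//.
  rewrite [leRHS](_ : _ = C * B * L * pw beta (n - j.+1)%N * (A0 * pw beta j)); last by ring.
  by rewrite ler_wpM2l ?ph_tail// !mulr_ge0 ?pw_ge0.
rewrite -mulr_sumr.
case: n => [|n].
  have K1 : 0 <= C * A0 * C1 by rewrite !mulr_ge0.
  have K2 : 0 <= L * B * pw beta 0 by rewrite !mulr_ge0 ?pw_ge0.
  by rewrite big_ord0 mulr0 mulr_ge0// mulr_ge0.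
have -> : \sum_(j < n.+1) pw beta j * pw beta (n.+1 - j.+1)%N = (pw beta * pw beta) n.
  by rewrite fpsM; apply: eq_bigr => j _; rewrite subSS.
have q1 k : `|pw beta k| <= 1 * pw beta k by rewrite mul1r ger0_norm ?pw_ge0.
have := HC1 1 1 (pw beta) (pw beta) n ler01 ler01 q1 q1; rewrite !mulr1 => H.
have H2 : pw beta n <= 2 `^ beta * pw beta n.+1 by apply: pw_scale_nat => //; rewrite mul2n -addnn addnS ltnS leq_addr.
have CB : 0 <= C * B * L * A0 by rewrite !mulr_ge0.
rewrite (le_trans (ler_wpM2l CB (le_trans (ler_norm _) H)))//.
rewrite (le_trans (ler_wpM2l CB (ler_wpM2l C10' H2)))// le_eqVlt; apply/orP; left; apply/eqP; ring.
Qed.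

Lemma kap_rate : exists2 C, 0 < C & forall w B, tower_bd w B -> forall n,
  `|kap w n| <= C * B * pw beta n.
Proof.
have [C C_gt0 HC] := regeneration_rate mY muY1 GM ph_gt0 beta1 ph_tail ph_gcd.
by exists C => // w B bw n; have [] := HC _ _ (observable_tobs bw) n.
Qed.

(** * Decay of correlations under a bound on unreturned orbits *)

Section Decorrelation.
Variable s : fps R.
Hypothesis s_ge0 : forall n, 0 <= s n.
Hypothesis s0 : 1 <= s 0%N.

(** The base observations [Kw w n] are left unexpanded: they drop out when [v] has mean zero, which
    is how an arbitrary bounded [w] is reached in part (b). *)
Lemma centred_decorrelation : exists2 C, 0 < C & forall v L w B, 0 < L ->
  tower_holder v L -> tower_bd w B ->
  (forall n, `|EX Y (Tsum v w n)| <= L * B * s n) ->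
  (forall n, `|EX Y (Tsum v one2 n)| <= L * s n) -> forall n,
  `|EX Y (Rsum v w n) - tmean v * Kw w n| <= C * L * B * gam beta s n.
Proof.
have [C C_gt0 HC] := correlation_rate; have [Ck Ck_gt0 HCk] := kap_rate.
exists (C + 1 + Ck); first by rewrite !addr_gt0.
move=> v L w B L0 hv bw Tvw Tv n; have B0 := obs_bound_ge0 bw; have L0' := ltW L0.
have G0 := gam_ge0 beta s_ge0 n; have LB : 0 <= L * B by rewrite mulr_ge0.
have H1 : `|EX Y (Rsum v w n) - EX Y (Tsum v w n) - (tmean v * Kw w n - (Vt v * kap w) n)| <=
    C * (L * B * gam beta s n).
  rewrite (le_trans (HC v L w B L0 hv bw n))// -!mulrA ler_wpM2l ?(ltW C_gt0)// !mulrA ler_wpM2l//.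
  exact: pw_le_gam.
have H2 : `|EX Y (Tsum v w n)| <= L * B * gam beta s n.
  by rewrite (le_trans (Tvw n))// ler_wpM2l// s_le_gam.
have H3 : `|(Vt v * kap w) n| <= Ck * (L * B * gam beta s n).
  rewrite mulrC (le_trans (conv_s_gam n _ _ (HCk w B bw) Tv))//.
    by rewrite mulr_ge0// ltW.
  by rewrite le_eqVlt; apply/orP; left; apply/eqP; ring.
have -> : EX Y (Rsum v w n) - tmean v * Kw w n =
  (EX Y (Rsum v w n) - EX Y (Tsum v w n) - (tmean v * Kw w n - (Vt v * kap w) n)) +
  EX Y (Tsum v w n) - (Vt v * kap w) n by ring.
rewrite (le_trans (ler_normB _ _))// (le_trans (lerD (ler_normD _ _) (lexx _)))//.
rewrite (le_trans (lerD (lerD H1 H2) H3))// le_eqVlt; apply/orP; left; apply/eqP; ring.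
Qed.

(** Since [Vt one2] is [btail], the case [v = one2] of [correlation_rate] is the equation that
    [base_rate] solves. *)
Lemma base_decorrelation : exists2 C, 0 < C & forall w B, tower_bd w B ->
  (forall n, `|EX Y (Tsum one2 w n)| <= B * s n) -> forall n,
  `|Kw w n - tmean w / btail 0 * (1 + btail n.+1 / btail 0)| <=
    C * B * (gam beta s n + pw beta n * psum (beta - 1) n).
Proof.
have [C C_gt0 HC] := correlation_rate; have [Ck Ck_gt0 HCk] := kap_rate.
have bb1 := beta1; have A00 := A0_ge0.
pose A := A0 + A0 * (beta / (beta - 1)).
have A1 : 0 <= A0 * (beta / (beta - 1)) by rewrite mulr_ge0// divr_ge0; lra.
have A_ge0 : 0 <= A by rewrite addr_ge0.
have pA n : 0 <= ptail n <= A * pw beta n.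
  by rewrite ptail_ge0/= (le_trans (ph_tail n))// ler_wpM2r ?pw_ge0// lerDl.
have bA n : 0 <= btail n <= A * pw (beta - 1) n.
  have /andP[-> /= h] := btail_bounds n; rewrite (le_trans h)//.
  by rewrite ler_wpM2r ?pw_ge0// lerDr.
have C10 : 0 <= Ck by exact: ltW.
have C20 : 0 <= C + 1 by rewrite addr_ge0// ltW.
have [C' C'_gt0 HC'] := base_rate beta1 A_ge0 pA btailS bA btail0_gt0 s_ge0 s0 C10 C20.
exists C' => // w B bw Tw n; have B0 := obs_bound_ge0 bw.
apply: HC' => //; first by move=> m; exact: (HCk w B bw m).
  move=> m; have := HC one2 1 w B ltr01 tower_holder_one bw m.
  rewrite (Rsum_invariant m bw) tmean_one mulr1.
  have -> : Vt one2 = (btail : fps R) by apply/funext => k; exact: Tsum_one.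
  rewrite -[(1 - fpsX) * Kw w]/(kap w) => H.
  have G0 := gam_ge0 beta s_ge0 m.
  have -> : tmean w - btail 0 * Kw w m + ((btail : fps R) * kap w) m =
    (tmean w - EX Y (Tsum one2 w m) - (btail 0 * Kw w m - ((btail : fps R) * kap w) m)) + EX Y (Tsum one2 w m).
    by ring.
  rewrite (le_trans (ler_normD _ _))// (le_trans (lerD H (Tw m)))//.
  rewrite mulrDl mul1r mulrDl; apply: lerD.
    have CB : 0 <= C * B by rewrite mulr_ge0// ltW.
    by rewrite ler_wpM2l// pw_le_gam.
  by rewrite ler_wpM2l// s_le_gam.
by rewrite mulrC; apply: tower_EX_norm_le; case: bw.
Qed.

Lemma decorrelation : exists2 C, 0 < C & forall v L w B, 0 < L ->
  tower_holder v L -> tower_bd w B ->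
  (forall n, `|EX Y (Tsum v w n)| <= L * B * s n) ->
  (forall n, `|EX Y (Tsum v one2 n)| <= L * s n) ->
  (forall n, `|EX Y (Tsum one2 w n)| <= B * s n) -> forall n,
  `|EX Y (Rsum v w n) - tmean v * (tmean w / btail 0 * (1 + btail n.+1 / btail 0))| <=
    C * L * B * (gam beta s n + pw beta n * psum (beta - 1) n).
Proof.
have [C C_gt0 HC] := centred_decorrelation; have [C' C'_gt0 HC'] := base_decorrelation.
have P0 := btail0_gt0; exists (C + btail 0 * C'); first by rewrite addr_gt0// mulr_gt0.
move=> v L w B L0 hv bw Tvw Tv Tw n; have B0 := obs_bound_ge0 bw.
have H1 := HC v L w B L0 hv bw Tvw Tv n; have H2 := HC' w B bw Tw n.
have H3 : `|tmean v| <= L * btail 0 by apply: tower_EX_norm_le; case: hv => -[].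
have G0 := gam_ge0 beta s_ge0 n.
have Q0 : 0 <= pw beta n * psum (beta - 1) n by rewrite mulr_ge0 ?pw_ge0 ?psum_ge0.
set E := tmean w / btail 0 * _ in H2 *.
have -> : EX Y (Rsum v w n) - tmean v * E =
  (EX Y (Rsum v w n) - tmean v * Kw w n) + tmean v * (Kw w n - E) by ring.
rewrite (le_trans (ler_normD _ _))// normrM.
rewrite (le_trans (lerD H1 (ler_pM (normr_ge0 _) (normr_ge0 _) H3 H2)))//.
set Q := pw beta n * _ in Q0 *; set G := gam beta s n in G0 *.
have CLB : 0 <= C * L * B by rewrite !mulr_ge0// ltW.
have : C * L * B * G <= C * L * B * (G + Q) by rewrite ler_wpM2l// lerDl.
have -> : L * btail 0 * (C' * B * (G + Q)) = btail 0 * C' * L * B * (G + Q) by ring.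
have -> : (C + btail 0 * C') * L * B * (G + Q) = C * L * B * (G + Q) + btail 0 * C' * L * B * (G + Q) by ring.
by move=> H; rewrite lerD2r.
Qed.

End Decorrelation.
End Tower.

(** * Chernov-Markarian-Zhang structures *)

Section VisitCount.
Context d0 (M : measurableType d0).
Variables (f : M -> M) (X : set M) (h : M -> nat).
Hypothesis fr : first_return f X h.

(** The time under [f] of [m] returns to [X]; [phiY] is the case [m = sigma y]. *)
Definition elapsed m y := (\sum_(j < m) h (iter j (Defs.induced f h) y))%N.

Lemma iter_induced m y : iter m (Defs.induced f h) y = iter (elapsed m y) f y.
Proof.
elim: m => [|m IH]; first by rewrite /elapsed big_ord0.
by rewrite /elapsed big_ord_recr/= -/(elapsed m y) {1}/Defs.induced {2}IH addnC iterD.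
Qed.

Lemma induced_X m y : X y -> X (iter m (Defs.induced f h) y).
Proof. by move=> Xy; elim: m => // m IH; have [] := fr IH. Qed.

Lemma sum_visits m y : X y -> (\sum_(i < elapsed m y) `[< X (iter i f y) >] = m)%N.
Proof.
move=> Xy; elim: m => [|m IH]; first by rewrite /elapsed big_ord0 big_ord0.
have -> : elapsed m.+1 y = (elapsed m y + h (iter m (Defs.induced f h) y))%N.
  by rewrite /elapsed big_ord_recr.
rewrite big_split_ord/= IH.
set z := iter m (Defs.induced f h) y; have Xz : X z by exact: induced_X.
have zE : z = iter (elapsed m y) f y by exact: iter_induced.
have [hz _ hmin] := fr Xz; case: (h z) hz hmin => // k _ hmin.
rewrite big_ord_recl/= addn0 -zE asboolT// big1 ?addn1// => i _.
rewrite /bump/= addnC iterD -zE asboolF//; apply: hmin => //.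
by rewrite add1n ltnS.
Qed.

Lemma sum_blocks (G : nat -> nat) d n :
  (\sum_(l < n) \sum_(k < d) G (d * l + k) = \sum_(i < d * n) G i)%N.
Proof.
elim: n => [|n IH]; first by rewrite muln0 !big_ord0.
have -> : (d * n.+1 = d * n + d)%N by rewrite mulnS addnC.
by rewrite big_ord_recr/= IH big_split_ord.
Qed.

(** A level lies in [Xhat] only if its block of [d] consecutive times contains a visit to [X], and
    there are exactly [sigma y] visits before time [phi y]. *)
Lemma Xhat_count (Y : set M) (sigma : M -> nat) d y : Y `<=` X -> Y y ->
  let phi := phiY f h sigma in (d %| phi y)%N ->
  (\sum_(l < phi y %/ d) `[< Xhat f X Y (fun y => phi y %/ d) d (y, l : nat) >] <= sigma y)%N.
Proof.
move=> YX Yy phi dphi; have Xy := YX _ Yy.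
have E : (\sum_(i < d * (phi y %/ d)) `[< X (iter i f y) >] = sigma y)%N.
  by rewrite mulnC divnK// [RHS](esym (sum_visits (sigma y) Xy)).
rewrite -[leqRHS]E -(sum_blocks (fun i => `[< X (iter i f y) >] : nat)).
apply: leq_sum => l _; case: asboolP => // -[_ [k kd /= Xk]].
have {}Xk : X (iter (d * l + k) f y) by rewrite addnC iterD.
by rewrite (bigD1 (Ordinal kd))//= asboolT.
Qed.

End VisitCount.

(** * Heights, tails and norms of a CMZ structure *)

Section Assembly.
Context {R : realType} d0 (M : measurableType d0).
Variables (mu : probability M R) (f : M -> M) (X Y : set M).
Variables (h sigma part : M -> nat) (muY : probability M R) (xi : M -> R).
Variables (theta C0 beta : R) (d : nat).
Hypothesis cmz : CMZ mu f X Y h sigma part muY xi theta C0.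
Hypothesis beta1 : 1 < beta.
Hypothesis tail : exists K : R, forall n : nat, (1 <= n)%N ->
  fine (muY (Y `&` [set y | (n < phiY f h sigma y)%N])) <= K * n%:R `^ (- beta).
Hypothesis gcd_d : gcd_of [set phiY f h sigma y | y in Y] d.

Local Notation phi := (phiY f h sigma).
Local Notation F := (FY f h sigma).
Local Notation EX := (EX muY).
Local Notation Phi := (fun y => phi y %/ d)%N.

Let mY : measurable Y := cmz_Y cmz.
Let GM := cmz_GM cmz.

Lemma phi_const y y' : Y y -> Y y' -> part y = part y' -> phi y = phi y'.
Proof.
move=> Yy Yy' e; have se := cmz_sigma_const cmz Yy Yy' e.
have hc := cmz_h_const cmz Yy Yy' e.
rewrite /phiY -se; apply: eq_bigr => l _; exact: hc.
Qed.

Lemma phi_gt0 y : Y y -> (0 < phi y)%N.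
Proof.
move=> Yy; have := cmz_sigma_pos cmz Yy; rewrite /phiY; case: (sigma y) => // m _.
by rewrite big_ord_recl/= ltn_addr//; have [] := cmz_h cmz (cmz_YX cmz Yy).
Qed.

Lemma dvd_phi y : Y y -> (d %| phi y)%N.
Proof. by move=> Yy; apply: gcd_d.1; exists y. Qed.

Lemma Y_nonempty : exists y, Y y.
Proof.
apply/set0P/eqP => Y0; have := cmz_muY_Y cmz.
by rewrite Y0 measure0 => /esym/eqP; rewrite onee_eq0.
Qed.

Lemma d_gt0 : (0 < d)%N.
Proof. by have [y Yy] := Y_nonempty; exact: dvdn_gt0 (phi_gt0 Yy) (dvd_phi Yy). Qed.

Lemma lt_Phi n y : Y y -> (n < Phi y)%N = (n * d < phi y)%N.
Proof. by move=> Yy; rewrite -[in RHS](divnK (dvd_phi Yy)) ltn_pmul2r// d_gt0. Qed.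

Lemma heights : exists ph : nat -> nat, forall y, Y y -> Phi y = ph (part y).
Proof.
have /choice[ph phE] : forall k, exists m, forall y, atom Y part k y -> Phi y = m.
  move=> k; have [[y [Yy yk]]|no] := pselect (exists y, atom Y part k y).
    by exists (Phi y) => z [Yz zk]; rewrite (phi_const Yz Yy)// zk -yk.
  by exists 0%N => y ay; case: no; exists y.
by exists ph => y Yy; exact: phE.
Qed.

Variable ph : nat -> nat.
Hypothesis PhiE : forall y, Y y -> Phi y = ph (part y).

Lemma ph_gt0 k : live Y part k -> (0 < ph k)%N.
Proof.
move=> [y [Yy <-]]; rewrite -PhiE// divn_gt0 ?d_gt0//.
exact: dvdn_leq (phi_gt0 Yy) (dvd_phi Yy).
Qed.

Lemma ph_gcd e : (forall k, live Y part k -> (e %| ph k)%N) -> (e %| 1)%N.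
Proof.
move=> ek; rewrite -(@dvdn_pmul2r d) ?d_gt0// mul1n; apply: gcd_d.2 => _ [y Yy <-].
rewrite -(divnK (dvd_phi Yy)) dvdn_pmul2r ?d_gt0//.
by have := PhiE Yy => /= ->; apply: ek; exists y.
Qed.

Local Notation pt := (ptail muY Y part ph).
Local Notation bt := (btail muY Y part ph).

Lemma measurable_Phi_lt n : measurable (Y `&` [set y | (n < Phi y)%N]).
Proof.
have [/(_ mY _ (measurable_set1 1)) + _] := @bmeas_label01 R _ _ muY _ _ _ _ _ _ mY GM (fun k => n < ph k)%N.
have -> // : Y `&` (fun y => (n < ph (part y))%:R : R) @^-1` [set 1] = Y `&` [set y | (n < Phi y)%N].
rewrite eqEsubset; split => y /= [Yy]; have /= -> := PhiE Yy; case: (n < _)%N => //.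
by move=> /eqP; rewrite eq_sym oner_eq0.
Qed.

Lemma muY_Phi_lt n : (muY (Y `&` [set y | (n < Phi y)%N]) = (pt n)%:E)%E.
Proof.
rewrite -(ptail_fin mY GM PhiE) -[in LHS](setIid Y) -setIA setIC.
rewrite -(integral_indic muY mY); last exact: measurable_Phi_lt.
apply: eq_integral => y /[!inE] Yy; rewrite indicE; congr (_%:R%:E); congr nat_of_bool.
by apply/idP/idP; rewrite in_setE/=; [move=> []|].
Qed.

(* Times on the tower are multiples of [d] in the time scale of [f]. *)
Definition level n := sigma_seq muY Y sigma phi (n * d).
Definition level_dens n y : R := (sigma y)%:R * (n < Phi y)%:R.

Lemma levelE n : level n = EX Y (level_dens n).
Proof.
rewrite /level /sigma_seq -[LHS]/(EX _ _) EX_setI_indic; apply: eq_Rintegral => y /[!inE] Yy.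
rewrite indicE /level_dens lt_Phi//; congr (_ * _%:R); congr nat_of_bool.
by apply/idP/idP; rewrite in_setE.
Qed.

Lemma level_dens_int n : muY.-integrable Y (EFin \o level_dens n).
Proof.
apply: (le_integrable mY _ _ (cmz_sigma_int cmz)).
  apply/measurable_EFinP; apply: measurable_funM.
    exact/measurable_EFinP/(measurable_int muY (cmz_sigma_int cmz)).
  apply: (@eq_measurable_fun _ _ _ _ _ (fun y => (n < ph (part y))%:R : R)).
    by move=> y /[!inE] Yy; have /= -> := PhiE Yy.
  by have [] := @bmeas_label01 R _ _ muY _ _ _ _ _ _ mY GM (fun k => n < ph k)%N.
move=> y Yy; rewrite lee_fin /level_dens normrM !normr_nat.
by case: (n < _)%N; rewrite ?mulr1// mulr0.
Qed.

Lemma level_ge0 n : 0 <= level n.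
Proof. by apply: Rintegral_ge0 => y _; exact: ler0n. Qed.

Lemma level0 : 1 <= level 0.
Proof.
have <- : EX Y (cst 1) = 1 by rewrite (EX_cst muY mY 1) (cmz_muY_Y cmz) mul1r.
rewrite levelE.
apply: le_Rintegral => //.
- by apply: bmeas_int => //; exact: bmeas_cst.
- exact: level_dens_int.
move=> y Yy; rewrite /level_dens; have /= -> := PhiE Yy.
by rewrite ph_gt0 ?mulr1 ?ler1n ?(cmz_sigma_pos cmz)//; exact: live_part.
Qed.

Lemma sum_shift_le (x : nat -> R) N n : (forall i, 0 <= x i) ->
  \sum_(l < N) (if (l + n < N)%N then x (l + n)%N else 0) <= \sum_(l < N) x l.
Proof.
move=> x0; pose z i := if (i < N)%N then x i else 0.
have z0 i : 0 <= z i by rewrite /z; case: ifP.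
rewrite -[leLHS]/(\sum_(l < N) z (l + n)%N); elim: n => [|n]; last first.
  apply: le_trans; have := @big_ord_recr R 0 +%R N (fun l => z (l + n)%N).
  have zN : z (N + n)%N = 0 by rewrite /z ltnNge leq_addr.
  rewrite big_ord_recl/= zN addr0 => <-.
  rewrite [X in _ <= _ + X](eq_bigr (fun i : 'I_N => z (i + n.+1)%N)) ?lerDr// => i _.
  by rewrite /bump/= add1n addSn addnS.
by apply: ler_sum => l _; rewrite addn0 /z ltn_ord.
Qed.

Lemma heights_tail : exists A0, forall n, EX Y (fun y => (n < ph (part y))%:R) <= A0 * pw beta n.
Proof.
(* The summand 1 serves [n = 0], where the tail hypothesis says nothing. *)
have [K KP] := tail; exists (1 + `|K| * 2 `^ beta) => n.
have b0 : 0 <= beta by have := beta1; lra.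
have K0 : 0 <= `|K| * 2 `^ beta by rewrite mulr_ge0// powR_ge0.
have -> : EX Y (fun y => (n < ph (part y))%:R) = fine (muY (Y `&` [set y | (n < Phi y)%N])).
  by rewrite muY_Phi_lt.
case: n => [|n].
  rewrite pw0 mulr1 (@le_trans _ _ 1) ?lerDl// -lee_fin fineK ?probability_le1//.
    exact: measurable_Phi_lt.
  by rewrite muY_Phi_lt.
have -> : Y `&` [set y | (n.+1 < Phi y)%N] = Y `&` [set y | (n.+1 * d < phi y)%N].
  by rewrite eqEsubset; split => y /= [Yy]; have /= -> := lt_Phi n.+1 Yy.
rewrite (le_trans (KP _ _)) ?muln_gt0 ?d_gt0//.
have p0 := pw_ge0 beta n.+1; rewrite mulrDl mul1r -[leLHS]add0r lerD// -mulrA.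
apply: (@le_trans _ _ (`|K| * (n.+1 * d)%:R `^ (- beta))).
  by rewrite ler_wpM2r ?powR_ge0// ler_norm.
rewrite ler_wpM2l//; apply: (@le_trans _ _ (pw beta n)).
  rewrite /pw !powRN lef_pV2 ?posrE ?powR_gt0 ?ltr0n ?muln_gt0 ?d_gt0//.
  by rewrite ge0_ler_powR ?nnegrE ?ler_nat// leq_pmulr// d_gt0.
by apply: pw_scale => //; rewrite -natrM ler_nat; lia.
Qed.

Variable A0 : R.
Hypothesis ph_tail : forall n, EX Y (fun y => (n < ph (part y))%:R) <= A0 * pw beta n.

Lemma sum_multiples_le (G : nat -> R) n : (forall j, 0 <= G j) ->
  \sum_(1 <= i < n.+1) G (i * d)%N <= \sum_(1 <= j < (n * d).+1) G j.
Proof.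
move=> G0; elim: n => [|n IH]; first by rewrite mul0n !big_geq.
rewrite big_nat_recr//= (@big_cat_nat _ _ _ (n * d).+1 1 (n.+1 * d).+1)//=; last first.
  by rewrite ltnS leq_mul2r leqnSn orbT.
rewrite lerD// big_nat_recr/=; last by rewrite ltn_mul2r d_gt0 leqnn.
by rewrite lerDr sumr_ge0.
Qed.

(** In [gamma_seq] at time [n * d] only the indices [j = i * d] are retained; [j^-beta] is [d^-beta]
    times [i^-beta]. *)
Lemma gam_level_le n : gam beta level n <= d%:R `^ beta * gamma_seq muY Y sigma phi beta (n * d).
Proof.
have b0 : 0 <= beta by have := beta1; lra.
have d1 : 1 <= d%:R `^ beta.
  by rewrite [leLHS](_ : 1 = 1 `^ beta); [rewrite ge0_ler_powR// ?nnegrE ?ler1n// d_gt0|rewrite powR1].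
have q0 j : 0 <= j%:R `^ (- beta) * sigma_seq muY Y sigma phi (n * d - j).
  by rewrite mulr_ge0 ?powR_ge0//; apply: Rintegral_ge0 => y _; exact: ler0n.
rewrite /gam fpsM big_ord_recl pw0 mul1r subn0 /gamma_seq mulrDr lerD//.
  by rewrite ler_peMl// level_ge0.
apply: le_trans (ler_wpM2l (powR_ge0 _ _) (sum_multiples_le n q0)).
rewrite big_add1/= big_mkord mulr_sumr; apply: ler_sum => i _.
rewrite /bump/= add1n /level mulnBl mulrA ler_wpM2r//; first by apply: Rintegral_ge0 => y _; exact: ler0n.
have dp : d%:R `^ beta != 0 by rewrite lt0r_neq0// (lt_le_trans ltr01).
rewrite natrM powRM ?ler0n// [X in _ * (_ * X)]powRN mulrC -mulrA mulVf// mulr1.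
exact: (@pw_le _ beta i i.+1).
Qed.

Local Notation XH := (Xhat f X Y Phi d).

(** A column contributes only if it is higher than [n], and then through at most [sigma y] levels.
    The two alternatives count the initial levels, for [v] supported in [Xhat], or the final ones,
    for [w]. *)
Lemma Tsum_level v w L B D n : 0 <= D -> tower_bd Y Phi v L -> tower_bd Y Phi w B ->
  (forall y l, Y y -> (l + n < Phi y)%N ->
     `|v y l * w y (l + n)%N| <= D * `[< XH (y, l) >]%:R) \/
  (forall y l, Y y -> (l + n < Phi y)%N ->
     `|v y l * w y (l + n)%N| <= D * `[< XH (y, l + n)%N >]%:R) ->
  `|EX Y (Tsum Phi v w n)| <= D * level n.
Proof.
move=> D0 bv bw H; have iT := Tsum_integrable mY GM beta1 ph_tail PhiE n bv bw.
rewrite (le_trans (le_normr_Rintegral mY iT))// levelE -RintegralZl//; last exact: level_dens_int.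
apply: le_Rintegral => //.
- exact: integrable_norm iT.
- exact: (integrableZl mY D (level_dens_int n)).
move=> y Yy; rewrite /Tsum.
pose c l : R := `[< XH (y, l) >]%:R.
have cs : \sum_(l < Phi y) c l <= (sigma y)%:R.
  rewrite /c -natr_sum ler_nat.
  exact: (Xhat_count (cmz_h cmz) (cmz_YX cmz) Yy (dvd_phi Yy)).
rewrite /level_dens; have [nP|Pn] := ltnP n (Phi y); last first.
  rewrite mulr0 mulr0 big1 ?normr0// => l _; rewrite ifF//.
  by apply/negbTE; rewrite -leqNgt (leq_trans Pn)// leq_addl.
rewrite mulr1 (le_trans (ler_norm_sum _ _ _))// (@le_trans _ _ (D * \sum_(l < Phi y) c l))//; last first.
  by rewrite ler_wpM2l.
case: H => H; last rewrite (@le_trans _ _ (D * \sum_(l < Phi y) (if (l + n < Phi y)%N then c (l + n)%N else 0)))//.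
- rewrite mulr_sumr; apply: ler_sum => l _; case: ifP => [|_]; first exact: H.
  by rewrite normr0 mulr_ge0.
- rewrite mulr_sumr; apply: ler_sum => l _; case: ifP => [|_]; first exact: H.
  by rewrite normr0 mulr0.
- by rewrite ler_wpM2l// sum_shift_le.
Qed.

Lemma tail_sum_btail n : tail_sum muY Y Phi n = bt n.+1.
Proof.
rewrite /tail_sum /btail; congr fine; apply: eq_eseriesr => j _; exact: muY_Phi_lt.
Qed.

Lemma intDelta_tmean v : intDelta muY Y Phi v = tmean muY Y Phi v / bt 0.
Proof. by rewrite /intDelta (Phibar_btail mY GM PhiE). Qed.

Lemma rho_starE v w n : rho_star muY Y F Phi v w n = EX Y (Rsum F Phi v w n) / bt 0.
Proof. exact: intDelta_tmean. Qed.

Section Norms.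
Implicit Types v w : M -> nat -> R.

Lemma sup_nonneg (E : set R) : (forall x, E x -> 0 <= x) -> 0 <= sup E.
Proof.
move=> E0; have [[[x Ex] ubE]|/sup_out->//] := pselect (has_sup E).
exact: le_trans (E0 _ Ex) (ub_le_sup ubE Ex).
Qed.

Lemma supnorm_ub w y l : Linf Y Phi w -> Y y -> (l < Phi y)%N -> `|w y l| <= supnorm Y Phi w.
Proof.
move=> [_ [K HK]] Yy lP; apply: ub_le_sup; last by exists (y, l).
by exists K => _ [p /HK le <-].
Qed.

Lemma supnorm_ge0 w : 0 <= supnorm Y Phi w.
Proof. by apply: sup_nonneg => _ [p _ <-]. Qed.

Lemma thpow_ge0 o : 0 <= thpow theta o.
Proof. by have /andP[/ltW t0 _] := gm_theta GM; case: o => //= k; rewrite exprn_ge0. Qed.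

Lemma holder_semi_ge0 v : 0 <= holder_semi Y Phi part F theta v.
Proof. by apply: sup_nonneg => _ [q _ <-]; rewrite divr_ge0// thpow_ge0. Qed.

Lemma holder_semi_ub S v y y' l : Ftheta Y Phi part F theta S v -> Y y -> Y y' -> (l < Phi y)%N ->
  `|v y l - v y' l| <= holder_semi Y Phi part F theta v * ts part F theta y y'.
Proof.
move=> [_ [K HK]] Yy Yy' lP; rewrite /ts.
have [<-|ne] := pselect (y = y').
  by rewrite subrr normr0 mulr_ge0 ?thpow_ge0// holder_semi_ge0.
have HKy := HK _ _ _ Yy Yy' ne lP.
(* For points that never separate the quotient in the seminorm is 0 by the convention on division;
   there [Ftheta] forces [v] to agree. *)
have := thpow_ge0 (sep_time part F y y'); rewrite le_eqVlt => /predU1P[t0|t0].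
  by move: HKy; rewrite -t0 !mulr0.
rewrite -ler_pdivrMr//; apply: ub_le_sup; last by exists ((y, y'), l).
exists `|K| => _ [[[z z'] k] /= [Yz Yz' nz kP] <-].
have [->|tn] := eqVneq (thpow theta (sep_time part F z z')) 0; first by rewrite invr0 mulr0.
have tz : 0 < thpow theta (sep_time part F z z') by rewrite lt0r tn thpow_ge0.
by rewrite ler_pdivrMr// (le_trans (HK _ _ _ Yz Yz' nz kP))// ler_wpM2r ?ler_norm// ltW.
Qed.

Lemma Linf_tower_bd w e : Linf Y Phi w -> 0 <= e -> tower_bd Y Phi w (supnorm Y Phi w + e).
Proof.
move=> lw e0; split; first by case: lw.
by move=> y l Yy lP; rewrite (le_trans (supnorm_ub lw Yy lP))// lerDl.
Qed.

Lemma Ftheta_tower_holder S v e : Ftheta Y Phi part F theta S v -> 0 <= e ->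
  tower_holder Y part F theta Phi v (norm_theta Y Phi part F theta v + e).
Proof.
move=> Fv e0; have [[lv _] _] := Fv; have s0 := supnorm_ge0 v; have h0 := holder_semi_ge0 v.
split.
  split; first by case: lv.
  move=> y l Yy lP; rewrite (le_trans (supnorm_ub lv Yy lP))// /norm_theta; lra.
move=> y y' l Yy Yy' lP; apply: le_trans (holder_semi_ub Fv Yy Yy' lP) _.
rewrite ler_wpM2r ?thpow_ge0// /norm_theta; lra.
Qed.
Lemma Ftheta_Tsum v w B n e : Ftheta Y Phi part F theta XH v -> 0 <= e -> tower_bd Y Phi w B -> 0 <= B ->
  `|EX Y (Tsum Phi v w n)| <= (norm_theta Y Phi part F theta v + e) * B * level n.
Proof.
move=> Fv e0 bw B0; have [bv _] := Ftheta_tower_holder Fv e0.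
have N0 : 0 <= norm_theta Y Phi part F theta v + e.
  by rewrite addr_ge0// addr_ge0 ?supnorm_ge0 ?holder_semi_ge0.
apply: (Tsum_level (mulr_ge0 N0 B0) bv bw); left => y l Yy lP.
have lP' : (l < Phi y)%N by rewrite (leq_ltn_trans _ lP)// leq_addr.
rewrite normrM; case: asboolP => [_|nX]; last by rewrite ((proj2 (proj1 Fv)) (y, l))// normr0 mul0r mulr0.
by rewrite mulr1 ler_pM// ?(proj2 bv)// (proj2 bw).
Qed.

Lemma Linf_on_Tsum w n : Linf_on Y Phi XH w ->
  `|EX Y (Tsum Phi (@one2 R _ M) w n)| <= supnorm Y Phi w * level n.
Proof.
move=> [lw w0]; have bw := Linf_tower_bd lw (lexx 0); rewrite addr0 in bw.
apply: (Tsum_level (supnorm_ge0 w) (@tower_bd_one R _ _ Y Phi) bw); right => y l Yy lP.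
rewrite /one2 mul1r; case: asboolP => [_|nX]; last by rewrite (w0 (y, l + n)%N)// normr0 mulr0.
by rewrite mulr1 (proj2 bw).
Qed.
End Norms.

(** The tower estimates require a positive constant for [v], while [norm v] may be 0: they are
    applied to [norm v + e], and [e] tends to 0. *)
Lemma ler_scale_eps (c N x : R) : 0 <= c -> (forall e, 0 < e -> x <= c * (N + e)) -> x <= c * N.
Proof.
move=> c0 H; apply/ler_addgt0Pr => e e0.
have c1 : 0 < c + 1 by lra.
apply: le_trans (H (e / (c + 1)) (divr_gt0 e0 c1)) _.
rewrite mulrDr lerD2l mulrA ler_pdivrMr// mulrC ler_pM2l//; lra.
Qed.

Local Notation gs := (gamma_seq muY Y sigma phi beta).
Local Notation norm := (norm_theta Y Phi part F theta).
Local Notation sn := (supnorm Y Phi).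

Lemma gs_ge0 n : 0 <= gs n.
Proof.
rewrite addr_ge0 ?sumr_ge0//; first by apply: Rintegral_ge0 => y _; exact: ler0n.
by move=> j _; rewrite mulr_ge0 ?powR_ge0//; apply: Rintegral_ge0 => y _; exact: ler0n.
Qed.

Lemma zeta_ge0 n : (1 <= n)%N -> 0 <= zeta beta n.
Proof.
move=> n1; rewrite /zeta; case: ifP => _; first exact: powR_ge0.
case: ifP => _; last exact: powR_ge0.
by rewrite divr_ge0 ?exprn_ge0// ln_ge0// ler1n.
Qed.

Let bt0 : 0 < bt 0 := btail0_gt0 mY (cmz_muY_Y cmz) ph_gt0 beta1 ph_tail.

Lemma centred_bound : exists2 C, 0 < C & forall n v w,
  Ftheta Y Phi part F theta XH v -> intDelta muY Y Phi v = 0 -> Linf Y Phi w ->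
  `|rho_star muY Y F Phi v w n| <= C * norm v * sn w * gs (n * d).
Proof.
have [C C0' H] := centred_decorrelation mY (cmz_muY_Y cmz) GM ph_gt0 beta1 ph_tail ph_gcd PhiE level_ge0 level0.
have D0 : 0 < d%:R `^ beta :> R by rewrite powR_gt0// ltr0n d_gt0.
exists (C * d%:R `^ beta / bt 0); first by rewrite divr_gt0// mulr_gt0.
move=> n v w Fv v0 lw.
have bw := Linf_tower_bd lw (lexx 0); rewrite addr0 in bw; have B0 := supnorm_ge0 w.
have tv : tmean muY Y Phi v = 0.
  by move: v0; rewrite intDelta_tmean => /eqP; rewrite mulf_eq0 invr_eq0 (gt_eqF bt0) orbF => /eqP.
have G0 := gs_ge0 (n * d).
rewrite rho_starE normrM normfV (gtr0_norm bt0) ler_pdivrMr//.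
have -> : C * d%:R `^ beta / bt 0 * norm v * sn w * gs (n * d) * bt 0 =
    C * sn w * (d%:R `^ beta * gs (n * d)) * norm v by field; exact: lt0r_neq0.
apply: ler_scale_eps => [|e e0]; first by rewrite !mulr_ge0// ltW.
have N0 : 0 < norm v + e by rewrite ltr_wpDl// addr_ge0 ?supnorm_ge0 ?holder_semi_ge0.
have e0' := ltW e0.
have bT m := Ftheta_Tsum m Fv e0' bw B0.
have oT m := Ftheta_Tsum m Fv e0' (@tower_bd_one R _ _ Y Phi) ler01.
have {oT} oT m : `|EX Y (Tsum Phi v (@one2 R _ M) m)| <= (norm v + e) * level m.
  by have := oT m; rewrite mulr1.
have := H v (norm v + e) w (sn w) N0 (Ftheta_tower_holder Fv e0') bw bT oT n.
rewrite tv mul0r subr0 => /le_trans; apply.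
rewrite [leRHS](_ : _ = C * (norm v + e) * sn w * (d%:R `^ beta * gs (n * d))); last by ring.
by rewrite ler_wpM2l ?gam_level_le// !mulr_ge0// ltW.
Qed.

Lemma expansion_bound : exists2 C, 0 < C & forall n v w, (1 <= n)%N ->
  Ftheta Y Phi part F theta XH v -> Linf_on Y Phi XH w ->
  `|rho_star muY Y F Phi v w n - (1 + (Phibar muY Y Phi)^-1 * tail_sum muY Y Phi n)
     * intDelta muY Y Phi v * intDelta muY Y Phi w| <= C * norm v * sn w * (gs (n * d) + zeta beta n).
Proof.
have [C C0' H] := decorrelation mY (cmz_muY_Y cmz) GM ph_gt0 beta1 ph_tail ph_gcd PhiE level_ge0 level0.
have [C2 C20 Hz] := psum_zeta beta1.
have D0 : 0 < d%:R `^ beta :> R by rewrite powR_gt0// ltr0n d_gt0.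
(* The part [(1 + C2) * d^beta] bounds [gam] together with the term [C2 * pw beta n <= C2 * gam]
   left by [psum_zeta]; the last [C2] is for [zeta]. *)
have [D DE] : exists D, D = (1 + C2) * d%:R `^ beta + C2 by eexists.
have Dp : 0 < D by rewrite DE addr_gt0// mulr_gt0// addr_gt0.
exists (C * D / bt 0); first by rewrite divr_gt0 ?(mulr_gt0 C0' Dp).
move=> n v w n1 Fv [lw sw].
have bw := Linf_tower_bd lw (lexx 0); rewrite addr0 in bw; have B0 := supnorm_ge0 w.
have G0 := gs_ge0 (n * d); have Z0 := zeta_ge0 n1.
have nz : bt 0 != 0 by exact: lt0r_neq0.
rewrite rho_starE !intDelta_tmean tail_sum_btail (Phibar_btail mY GM PhiE).
rewrite [X in `|X|](_ : _ = (EX Y (Rsum F Phi v w n) -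
   tmean muY Y Phi v * (tmean muY Y Phi w / bt 0 * (1 + bt n.+1 / bt 0))) / bt 0); last by field.
rewrite normrM normfV (gtr0_norm bt0) ler_pdivrMr//.
have -> : C * D / bt 0 * norm v * sn w * (gs (n * d) + zeta beta n) * bt 0 =
    C * sn w * (D * (gs (n * d) + zeta beta n)) * norm v by field.
apply: ler_scale_eps => [|e e0]; first exact: mulr_ge0 (mulr_ge0 (ltW C0') B0) (mulr_ge0 (ltW Dp) (addr_ge0 G0 Z0)).
have N0 : 0 < norm v + e by rewrite ltr_wpDl// addr_ge0 ?supnorm_ge0 ?holder_semi_ge0.
have e0' := ltW e0.
have bT m := Ftheta_Tsum m Fv e0' bw B0.
have oT m := Ftheta_Tsum m Fv e0' (@tower_bd_one R _ _ Y Phi) ler01.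
have {oT} oT m : `|EX Y (Tsum Phi v (@one2 R _ M) m)| <= (norm v + e) * level m.
  by have := oT m; rewrite mulr1.
have wT m : `|EX Y (Tsum Phi (@one2 R _ M) w m)| <= sn w * level m by exact: Linf_on_Tsum.
have := H v (norm v + e) w (sn w) N0 (Ftheta_tower_holder Fv e0') bw bT oT wT n.
move=> /le_trans; apply.
rewrite [leRHS](_ : _ = C * (norm v + e) * sn w * (D * (gs (n * d) + zeta beta n))); last by ring.
rewrite ler_wpM2l//; first exact: mulr_ge0 (mulr_ge0 (ltW C0') (ltW N0)) B0.
have g1 := gam_level_le n; have g2 := Hz n n1; have g3 := pw_le_gam beta level_ge0 level0 n.
have g4 := ler_wpM2l (ltW C20) g3.
have g5 : (1 + C2) * gam beta level n <= (1 + C2) * (d%:R `^ beta * gs (n * d)).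
  by rewrite ler_wpM2l// addr_ge0// ltW.
have g6 : 0 <= C2 * gs (n * d) by exact: mulr_ge0 (ltW C20) G0.
have g7 : 0 <= (1 + C2) * d%:R `^ beta * zeta beta n.
  exact: mulr_ge0 (mulr_ge0 (addr_ge0 ler01 (ltW C20)) (ltW D0)) Z0.
move: g2 g4 g5 g6 g7; rewrite DE; lra.
Qed.

End Assembly.

Theorem theorem4p1 (R : realType) (d0 : measure_display) (M : measurableType d0)
    (mu : probability M R) (f : M -> M) (X Y : set M)
    (h sigma part : M -> nat) (muY : probability M R) (xi : M -> R)
    (theta C0 beta : R) (d : nat) :
  CMZ mu f X Y h sigma part muY xi theta C0 ->
  1 < beta ->
  (exists K : R, forall n : nat, (1 <= n)%N ->
     fine (muY (Y `&` [set y | (n < phiY f h sigma y)%N])) <= K * n%:R `^ (- beta)) ->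
  gcd_of [set phiY f h sigma y | y in Y] d ->
  let phi := phiY f h sigma in
  let Phi := fun y => (phi y %/ d)%N in
  let F := FY f h sigma in
  exists C : R, 0 < C /\
  forall n : nat, (1 <= n)%N ->
    (forall v w : M -> nat -> R,
       Ftheta Y Phi part F theta (Xhat f X Y Phi d) v ->
       Linf_on Y Phi (Xhat f X Y Phi d) w ->
       `|rho_star muY Y F Phi v w n
         - (1 + (Phibar muY Y Phi)^-1 * tail_sum muY Y Phi n)
           * intDelta muY Y Phi v * intDelta muY Y Phi w|
       <= C * norm_theta Y Phi part F theta v * supnorm Y Phi w
            * (gamma_seq muY Y sigma phi beta (n * d) + zeta beta n)) /\
    (forall v w : M -> nat -> R,
       Ftheta Y Phi part F theta (Xhat f X Y Phi d) v ->
       intDelta muY Y Phi v = 0 ->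
       Linf Y Phi w ->
       `|rho_star muY Y F Phi v w n|
       <= C * norm_theta Y Phi part F theta v * supnorm Y Phi w
            * gamma_seq muY Y sigma phi beta (n * d)).
Proof.
move=> cmz beta1 tail gcd_d phi Phi F.
have [ph PhiE] := heights d cmz.
have [A0 ph_tail] := heights_tail cmz beta1 tail gcd_d PhiE.
have [Ca Ca0 Ha] := expansion_bound cmz beta1 gcd_d PhiE ph_tail.
have [Cb Cb0 Hb] := centred_bound cmz beta1 gcd_d PhiE ph_tail.
exists (Ca + Cb); split; first exact: addr_gt0.
have nv v : 0 <= norm_theta Y Phi part F theta v.
  by rewrite addr_ge0 ?supnorm_ge0// (holder_semi_ge0 d cmz).
move=> n n1; have Z0 := zeta_ge0 beta n1.
have G0 : 0 <= gamma_seq muY Y sigma phi beta (n * d) by exact: gs_ge0.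
split => v w; have W0 : 0 <= supnorm Y Phi w by exact: supnorm_ge0.
  move=> Fv lw; apply: le_trans (Ha n v w n1 Fv lw) _.
  apply: (ler_wpM2r (addr_ge0 G0 Z0)); apply: (ler_wpM2r W0); apply: (ler_wpM2r (nv v)).
  by rewrite lerDl ltW.
move=> Fv v0 lw; apply: le_trans (Hb n v w Fv v0 lw) _.
apply: (ler_wpM2r G0); apply: (ler_wpM2r W0); apply: (ler_wpM2r (nv v)).
by rewrite lerDr ltW.
Qed.
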